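(* Let $0<p\le q<\infty$, $\omega\in\mathcal{D}$ and let $\mu$ be a positive Borel measure on $\mathbb{D}$. Then there exists $r=r(\omega)\in(0,1)$ such that the following statements hold: (i) $\mu$ is a $q$-Carleson measure for $A^p_\omega$ if and only if $$\sup_{a\in\mathbb{D}}\frac{\mu(\Delta(a,r))}{\left(\omega(\Delta(a,r))\right)^{q/p}}<\infty.$$ Moreover, if $\mu$ is a $q$-Carleson measure for $A^p_\omega$, then the identity operator $I_d:A^p_\omega\to L^q_\mu$ satisfies $$\|I_d\|^q_{A^p_\omega\to L^q_\mu}\asymp\sup_{a\in\mathbb{D}}\frac{\mu(\Delta(a,r))}{\left(\omega(\Delta(a,r))\right)^{q/p}}.$$ (ii) The identity operator $I_d:A^p_\omega\to L^q_\mu$ is compact if and only if $$\lim_{|a|\to1^-}\frac{\mu(\Delta(a,r))}{\left(\omega(\Delta(a,r))\right)^{q/p}}=0.$$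
   Context: $\mathbb{D}=\{z\in\mathbb{C}:|z|<1\}$ and $\mathcal{H}(\mathbb{D})$ is the space of analytic functions in $\mathbb{D}$. A radial weight is a nonnegative function $\omega\in L^1([0,1))$ extended to $\mathbb{D}$ by $\omega(z)=\omega(|z|)$. Write $\widehat{\omega}(z)=\int_{|z|}^1\omega(s)\,ds$ for $z\in\mathbb{D}$; it is always assumed that $\widehat{\omega}(z)>0$ for all $z\in\mathbb{D}$. Class $\widehat{\mathcal{D}}$: radial weights $\omega$ for which there is $C=C(\omega)\ge1$ such that $\widehat{\omega}(r)\le C\,\widehat{\omega}\left(\frac{1+r}{2}\right)$ for all $0\le r<1$. Class $\check{\mathcal{D}}$: radial weights $\omega$ for which there are $K=K(\omega)>1$ and $C=C(\omega)>1$ such that $\widehat{\omega}(r)\ge C\,\widehat{\omega}\left(1-\frac{1-r}{K}\right)$ for all $0\le r<1$. $\mathcal{D}=\widehat{\mathcal{D}}\cap\check{\mathcal{D}}$. For $0<p<\infty$ the weighted Bergman space $A^p_\omega$ consists of $f\in\mathcal{H}(\mathbb{D})$ with $\|f\|_{A^p_\omega}^p=\int_{\mathbb{D}}|f(z)|^p\omega(z)\,dA(z)<\infty$, where $dA=\frac{dx\,dy}{\pi}$ is the normalized Lebesgue area measure on $\mathbb{D}$. $L^q_\mu$ is the Lebesgue space of $\mu$-measurable functions on $\mathbb{D}$ with $\|f\|_{L^q_\mu}^q=\int_{\mathbb{D}}|f|^q\,d\mu<\infty$. For measurable $E\subset\mathbb{D}$, $\omega(E)=\int_E\omega\,dA$.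 A positive Borel measure $\mu$ on $\mathbb{D}$ is a $q$-Carleson measure for $A^p_\omega$ if the identity operator $I_d:A^p_\omega\to L^q_\mu$, $I_d f=f$, is bounded; $\|I_d\|_{A^p_\omega\to L^q_\mu}=\sup_{\|f\|_{A^p_\omega}\le1}\|f\|_{L^q_\mu}$. $I_d$ is compact if it maps bounded sets of $A^p_\omega$ to relatively compact subsets of $L^q_\mu$. The pseudohyperbolic disc of center $a\in\mathbb{D}$ and radius $r\in(0,1)$ is $\Delta(a,r)=\{z\in\mathbb{D}:\rho(a,z)<r\}$, where $\rho(a,z)=\left|\frac{a-z}{1-\overline{a}z}\right|$. $A\asymp B$ means $C^{-1}B\le A\le CB$ for some constant $C>0$ that does not depend on $\mu$.
   Formalization: In part (ii) the measure μ is additionally assumed finite on compact subsets of the unit disc; without this (ii) fails, e.g. for μ = ∞·δ_0 the limit is 0 but the constant function 1 lies in A^p_ω and not in L^q_μ. *)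

(* Defs.v *)
(* The real numbers are an arbitrary [R : realType] of mathcomp-analysis, the
   complex numbers are [R[i]] of mathcomp-real-closed. *)
From HB Require Import structures.
From mathcomp Require Import all_boot all_order all_algebra.
From mathcomp Require Import all_classical all_reals all_analysis.
From mathcomp Require Import measurable_realfun complex.

Set Implicit Arguments.
Unset Strict Implicit.
Unset Printing Implicit Defensive.

Import Order.TTheory GRing.Theory Num.Theory.
Import numFieldNormedType.Exports.
Import ComplexField.Normc.

Local Open Scope classical_set_scope.
Local Open Scope ring_scope.

(* [R[i]] as a normed space over itself, so that [derivable] is complex
   differentiability. *)
#[non_forgetful_inheritance]
HB.instance Definition _ (R : rcfType) := NormedModule.copy R[i] R[i]^o.

(* The Borel sigma-algebra; measures on [R[i]] are thus Borel measures. *)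
HB.instance Definition _ (R : realType) :=
  Measurable.copy R[i] (g_sigma_algebraType (@open R[i])).

Definition cplx (R : realType) (w : measurableTypeR R * measurableTypeR R) :
  R[i] := Complex w.1 w.2.

Lemma ball_complexE (R : realType) (z w : R[i]) (e : R) :
  ball z (real_complex R e) w <-> normc (z - w) < e.
Proof. by rewrite -ball_normE /ball_ /= normc_def /= ltcR; case: (z - w). Qed.

Lemma normc_le_ReIm (R : realType) (z : R[i]) :
  normc z <= `|complex.Re z| + `|complex.Im z|.
Proof.
case: z => x y /=; rewrite -(@ler_pXn2r _ 2) ?nnegrE ?sqrtr_ge0 ?addr_ge0//.
rewrite sqr_sqrtr ?addr_ge0 ?sqr_ge0// sqrrD !real_normK ?num_real//.
by rewrite -addrA lerD2l lerDr mulrn_wge0 // mulr_ge0.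
Qed.

Lemma normc_ge_Re (R : realType) (z : R[i]) : `|complex.Re z| <= normc z.
Proof.
by case: z => x y /=; rewrite -sqrtr_sqr ler_wsqrtr// lerDl sqr_ge0.
Qed.

Lemma normc_ge_Im (R : realType) (z : R[i]) : `|complex.Im z| <= normc z.
Proof.
by case: z => x y /=; rewrite -sqrtr_sqr ler_wsqrtr// lerDr sqr_ge0.
Qed.

Lemma measurable_cplx (R : realType) : measurable_fun setT (@cplx R).
Proof.
apply: measurability; first by reflexivity.
move=> _ [U oU <-]; rewrite setTI.
pose box (t : rat * rat * rat) : set (measurableTypeR R * measurableTypeR R) :=
  ball (ratr t.1.1 : R) (ratr t.2) `*` ball (ratr t.1.2 : R) (ratr t.2).
have -> : @cplx R @^-1` U = \bigcup_t
    (if `[< box t `<=` @cplx R @^-1` U >] then box t else set0).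
  apply/seteqP; split => [[x y] /= Uxy|w [t _]]; last first.
    by case: asboolP => // tU /tU.
  have /nbhs_ballP[e /= e0 eU] : nbhs (cplx (x, y)) U by exact: open_nbhs_nbhs.
  move: e0 eU; case: e => d d'; rewrite ltcE /= => /andP[/eqP -> d0] eU.
  have /rat_in_itvoo[r] : 0 < d / 4%:R by rewrite divr_gt0.
  rewrite in_itv /= => /andP[r0 rd].
  have rat_near (u : R) : exists p, `|ratr p - u| < ratr r :> R.
    have /rat_in_itvoo[p] : u - ratr r < u + ratr r by rewrite ltrD2l gtrN.
    by rewrite in_itv /= => pu; exists p; rewrite ltr_distl.
  have [[p px] [q qy]] := (rat_near x, rat_near y).
  exists (p, q, r) => //; case: asboolP => [_|[]]; first by split.
  move=> [a b] [] /=; rewrite /ball /= => pa qb; apply: eU.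
  apply/ball_complexE; apply: (le_lt_trans (normc_le_ReIm _)) => /=.
  apply: (@lt_trans _ _ ((ratr r + ratr r) + (ratr r + ratr r))); last first.
    by move: rd; rewrite ltr_pdivlMr// mulr_natr !mulrS mulr0n addr0 !addrA.
  rewrite ltrD//.
    by apply: (le_lt_trans (ler_distD (ratr p) _ _)); rewrite ltrD// distrC.
  by apply: (le_lt_trans (ler_distD (ratr q) _ _)); rewrite ltrD// distrC.
apply: countable_bigcupT_measurable => [//|t]; case: asboolP => // _.
by apply: measurableX; apply: open_measurable; exact: ball_open.
Qed.

Lemma contraction_measurable (R : realType) (h : R[i] -> R) :
  (forall z w, `|h z - h w| <= normc (z - w)) -> measurable_fun setT h.
Proof.
move=> hL; apply: (measurability _ (RGenOpens.measurableE R)).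
move=> _ [_ [a [b ->] <-]]; rewrite setTI.
suff : open (h @^-1` `]a, b[) by exact: sub_sigma_algebra.
rewrite openE => z /= zab.
have : nbhs (h z) `]a, b[%classic.
  by apply: open_nbhs_nbhs; split => //; exact: interval_open.
move=> /nbhs_ballP[e /= e0 eab].
apply/nbhs_ballP; exists (real_complex R e) => /=; first by rewrite ltcR.
by move=> w /ball_complexE zw; apply: eab; exact: le_lt_trans (hL _ _) zw.
Qed.

Lemma measurable_Re (R : realType) :
  measurable_fun setT (@complex.Re R : R[i] -> R).
Proof.
apply: contraction_measurable => z w.
apply: le_trans (normc_ge_Re _); by case: z; case: w.
Qed.

Lemma measurable_Im (R : realType) :
  measurable_fun setT (@complex.Im R : R[i] -> R).
Proof.
apply: contraction_measurable => z w.
apply: le_trans (normc_ge_Im _); by case: z; case: w.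
Qed.

Lemma measurable_normc (R : realType) :
  measurable_fun setT (@normc R : R[i] -> R).
Proof.
apply: contraction_measurable => z w; rewrite ler_norml; apply/andP; split.
  rewrite lerNl opprB lerBlDr -(normcN (z - w)) opprB.
  by apply: le_trans (le_normcD _ _); rewrite subrK.
by rewrite lerBlDr; apply: le_trans (le_normcD _ _); rewrite subrK.
Qed.

Definition disc (R : realType) : set R[i] := [set z | normc z < 1].

Lemma measurable_disc (R : realType) : measurable (@disc R).
Proof.
have -> : @disc R = setT `&` @normc R @^-1` `]-oo, 1[.
  by apply/seteqP; split => [z /= ?|z [_]]; rewrite /disc /= in_itv.
by apply: measurable_normc => //; exact: measurable_itv.
Qed.

Definition lebesgue2 (R : realType) : set R[i] -> \bar R :=
  pushforward (@lebesgue_measure R \x @lebesgue_measure R)%E (@cplx R).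

HB.instance Definition _ (R : realType) :=
  Measure.copy (@lebesgue2 R)
    (measure_function_pushforward__canonical__measure_function_Measure
      (@lebesgue_measure R \x @lebesgue_measure R)%E (@measurable_cplx R)).

Lemma pi_inv_ge0 (R : realType) : 0 <= (pi : R)^-1.
Proof. by rewrite invr_ge0 pi_ge0. Qed.

(* The normalized area measure dx dy / pi. *)
Definition area (R : realType) : {measure set R[i] -> \bar R} :=
  mscale (NngNum (pi_inv_ge0 R)) (@lebesgue2 R).

(* A weight [omega : R -> R] only matters through its values on [0, 1[ and
   stands for the function [z |-> omega (normc z)] on the disc. *)
Definition omega_hat (R : realType) (omega : R -> R) (r : R) : R :=
  \int[@lebesgue_measure R]_(s in `[r, 1[) omega s.

Definition radial_weight (R : realType) (omega : R -> R) : Prop :=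
  [/\ forall s, 0 <= s < 1 -> 0 <= omega s,
      (@lebesgue_measure R).-integrable `[0, 1[ (EFin \o omega) &
      forall r, 0 <= r < 1 -> 0 < omega_hat omega r].

Definition D_hat (R : realType) (omega : R -> R) : Prop :=
  radial_weight omega /\
  exists2 C : R, 1 <= C & forall r, 0 <= r < 1 ->
    omega_hat omega r <= C * omega_hat omega ((1 + r) / 2).

Definition D_check (R : realType) (omega : R -> R) : Prop :=
  radial_weight omega /\
  exists K C : R, [/\ 1 < K, 1 < C & forall r, 0 <= r < 1 ->
    C * omega_hat omega (1 - (1 - r) / K) <= omega_hat omega r].

Definition D_class (R : realType) : set (R -> R) :=
  [set omega | D_hat omega /\ D_check omega].

Definition pseudohyperbolic (R : realType) (a z : R[i]) : R :=
  normc ((a - z) / (1 - conjc a * z)).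

Definition Delta (R : realType) (a : R[i]) (r : R) : set R[i] :=
  [set z | disc z /\ pseudohyperbolic a z < r].

Definition weight_mass (R : realType) (omega : R -> R) (E : set R[i]) : \bar R :=
  \int[@area R]_(z in E) (omega (normc z))%:E.

Definition analytic_in_disc (R : realType) (f : R[i] -> R[i]) : Prop :=
  forall z, disc z -> derivable f z 1.

Definition bergman_norm (R : realType) (omega : R -> R) (p : R)
    (f : R[i] -> R[i]) : \bar R :=
  ((\int[@area R]_(z in @disc R)
     (normc (f z) `^ p * omega (normc z))%:E) `^ p^-1)%E.

(* Functions are total on [R[i]]; only their restrictions to the disc matter. *)
Definition bergman (R : realType) (omega : R -> R) (p : R) :
    set (R[i] -> R[i]) :=
  [set f | analytic_in_disc f /\ (bergman_norm omega p f < +oo)%E].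

Section Lebesgue_space.
Context (R : realType) (mu : {measure set R[i] -> \bar R}) (q : {posnum R}).

Definition lebesgue_int (f : R[i] -> R[i]) : \bar R :=
  \int[mu]_(z in @disc R) (normc (f z) `^ q%:num)%:E.

Definition lebesgue_norm (f : R[i] -> R[i]) : \bar R :=
  (lebesgue_int f `^ q%:num^-1)%E.

Record Lq := MkLq {
  Lq_fun :> R[i] -> R[i];
  Lq_measurable : measurable_fun (@disc R) Lq_fun;
  Lq_finite : (lebesgue_norm Lq_fun < +oo)%E }.

HB.instance Definition _ := gen_eqMixin Lq.
HB.instance Definition _ := gen_choiceMixin Lq.

Lemma normc_ge0 (z : R[i]) : 0 <= normc z.
Proof. by case: z => x y; exact: sqrtr_ge0. Qed.

Lemma lebesgue_int_ge0 f : (0 <= lebesgue_int f)%E.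
Proof. by apply: integral_ge0 => z _; rewrite lee_fin powR_ge0. Qed.

Lemma measurable_dist (f g : Lq) :
  measurable_fun (@disc R) (fun z => normc (f z - g z)).
Proof.
have mRe (h : Lq) : measurable_fun (@disc R) (@complex.Re R \o h).
  by apply: measurableT_comp; [exact: measurable_Re|exact: Lq_measurable].
have mIm (h : Lq) : measurable_fun (@disc R) (@complex.Im R \o h).
  by apply: measurableT_comp; [exact: measurable_Im|exact: Lq_measurable].
pose s (z : R[i]) := (complex.Re (f z) - complex.Re (g z)) ^+ 2 +
  (complex.Im (f z) - complex.Im (g z)) ^+ 2.
have ms : measurable_fun (@disc R) s.
  apply: (@measurable_funD _ _ _ _
    (fun z => (complex.Re (f z) - complex.Re (g z)) ^+ 2)); apply: measurable_funX.
    exact: (measurable_funB (mRe f) (mRe g)).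
  exact: (measurable_funB (mIm f) (mIm g)).
have -> : (fun z => normc (f z - g z)) = (fun z => s z `^ 2^-1).
  by apply/funext => z; rewrite powR12_sqrt ?addr_ge0 ?sqr_ge0// /s;
    case: (f z); case: (g z).
exact: (measurableT_comp (measurable_powR _) ms).
Qed.

Lemma measurable_dist_powR (f g : Lq) : measurable_fun (@disc R)
  (fun z => (normc (f z - g z) `^ q%:num)%:E).
Proof.
apply/measurable_EFinP.
exact: (measurableT_comp (measurable_powR _) (measurable_dist f g)).
Qed.

Lemma normc_powR_triangle (a b : R[i]) :
  normc (a + b) `^ q%:num <=
  2 `^ q%:num * (normc a `^ q%:num + normc b `^ q%:num).
Proof.
wlog ab : a b / normc a <= normc b.
  move=> H; have [/H//|/ltW/H] := leP (normc a) (normc b).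
  by rewrite addrC [in leRHS]addrC.
apply: (@le_trans _ _ ((2 * normc b) `^ q%:num)).
  apply: ge0_ler_powR; rewrite ?nnegrE ?normc_ge0 ?mulr_ge0 ?normc_ge0//.
  by apply: le_trans (le_normcD _ _) _; rewrite mulr_natl mulr2n lerD2r.
by rewrite powRM ?normc_ge0// ler_wpM2l ?powR_ge0// lerDr powR_ge0.
Qed.

(* The uniformity of the (quasi-)norm, valid for 0 < q < 1 as well: for e > 0,
   f and g are e-close when the q-th power of the norm of f - g is less than e.
   Functions equal mu-a.e. on the disc are not identified but are inseparable
   for this uniformity, so that a set is relatively compact here iff its image
   in the quotient is. *)
Definition Lq_ball (e : R) : set (Lq * Lq) :=
  [set fg : Lq * Lq | (lebesgue_int (fun z => fg.1 z - fg.2 z)%R < e%:E)%E].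

Definition Lq_entourage : set_system (Lq * Lq) :=
  [set A | exists2 e, 0 < e & Lq_ball e `<=` A].

Let entourage_filter : Filter Lq_entourage.
Proof.
split; first by exists 1.
- move=> A B [e e0 eA] [d d0 dB]; exists (Num.min e d).
    by rewrite lt_min e0.
  by move=> fg; rewrite /Lq_ball /= EFin_min lt_min => /andP[? ?]; split;
    [exact: eA|exact: dB].
- by move=> A B AB [e e0 eA]; exists e => //; exact: subset_trans AB.
Qed.

Let entourage_diagonal A : Lq_entourage A -> diagonal `<=` A.
Proof.
move=> [e e0 eA] [f g] fg; have {fg}<- : f = g by exact: fg.
apply: eA; rewrite /Lq_ball /= /lebesgue_int.
rewrite integral0_eq ?lte_fin// => z _.
by rewrite subrr normc0 powR0// gt_eqF.
Qed.

Let entourage_inv A : Lq_entourage A -> Lq_entourage (A^-1)%relation.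
Proof.
move=> [e e0 eA]; exists e => // -[f g] fg; apply: eA; move: fg.
rewrite /Lq_ball /= /lebesgue_int; apply: le_lt_trans.
by under eq_integral do rewrite -normcN opprB.
Qed.

Let entourage_split_ex A : Lq_entourage A ->
  exists2 B, Lq_entourage B & (B \; B `<=` A)%relation.
Proof.
move=> [e e0 eA]; pose c : R := 2 `^ q%:num.
have c0 : 0 < c by rewrite powR_gt0.
exists (Lq_ball (e / c / 2)).
  by exists (e / c / 2) => //; rewrite !divr_gt0.
move=> [f h] [g /= fg gh]; apply: eA; move: fg gh; rewrite /Lq_ball /= => fg gh.
have : (lebesgue_int (fun z => f z - h z)%R <= c%:E *
  (lebesgue_int (fun z => f z - g z)%R + lebesgue_int (fun z => g z - h z)%R))%E.
  rewrite /lebesgue_int -ge0_integralD//=; last 5 first.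
  - exact: measurable_disc.
  - by move=> z _; rewrite lee_fin powR_ge0.
  - exact: measurable_dist_powR.
  - by move=> z _; rewrite lee_fin powR_ge0.
  - exact: measurable_dist_powR.
  rewrite -ge0_integralZl_EFin//=; last 4 first.
  - exact: measurable_disc.
  - by move=> z _; rewrite -EFinD lee_fin addr_ge0// powR_ge0.
  - by apply: emeasurable_funD; exact: measurable_dist_powR.
  - exact: ltW.
  apply: ge0_le_integral => //=.
  - exact: measurable_disc.
  - by move=> z _; rewrite lee_fin powR_ge0.
  - exact: measurable_dist_powR.
  - apply: measurable_funeM; apply: emeasurable_funD;
      exact: measurable_dist_powR.
  - move=> z _; rewrite -EFinD -EFinM lee_fin.
    have -> : f z - h z = (f z - g z) + (g z - h z) by rewrite addrA subrK.
    exact: normc_powR_triangle.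
move=> /le_lt_trans; apply.
have -> : e%:E = (c%:E * ((e / c / 2)%:E + (e / c / 2)%:E))%E.
  by rewrite -EFinD -splitr -EFinM mulrC divfK// gt_eqF.
rewrite lte_pmul2l ?lte_fin//; exact: lteD.
Qed.

HB.instance Definition _ := isUniform.Build Lq
  entourage_filter entourage_diagonal entourage_inv entourage_split_ex.

End Lebesgue_space.

(* The identity maps the Bergman space into the Lebesgue space of mu. *)
Definition identity_into (R : realType) (omega : R -> R) (p q : {posnum R})
    (mu : {measure set R[i] -> \bar R}) : Prop :=
  bergman omega p%:num `<=` range (@Lq_fun R mu q).

Definition carleson_measure (R : realType) (omega : R -> R) (p q : {posnum R})
    (mu : {measure set R[i] -> \bar R}) : Prop :=
  identity_into omega p q mu /\
  exists C : R, forall f, bergman omega p%:num f ->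
    (lebesgue_norm mu q f <= C%:E * bergman_norm omega p%:num f)%E.

Definition identity_norm (R : realType) (omega : R -> R) (p q : {posnum R})
    (mu : {measure set R[i] -> \bar R}) : \bar R :=
  ereal_sup [set lebesgue_norm mu q f | f in
    [set f | bergman omega p%:num f /\ (bergman_norm omega p%:num f <= 1)%E]].

Definition bergman_bounded (R : realType) (omega : R -> R) (p : R)
    (B : set (R[i] -> R[i])) : Prop :=
  B `<=` bergman omega p /\
  exists M : R, forall f, B f -> (bergman_norm omega p f <= M%:E)%E.

(* [[set g : Lq mu q | B g]] is the image of [B] under the identity. *)
Definition identity_compact (R : realType) (omega : R -> R) (p q : {posnum R})
    (mu : {measure set R[i] -> \bar R}) : Prop :=
  identity_into omega p q mu /\
  forall B, bergman_bounded omega p%:num B ->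
    compact (closure [set g : Lq mu q | B g]).

(* [Delta a r] has finite weight; were its weight zero, the quotient would be
   0 or +oo according as its [mu]-measure is zero or not. *)
Definition carleson_quotient (R : realType) (omega : R -> R) (p q : {posnum R})
    (mu : {measure set R[i] -> \bar R}) (r : R) (a : R[i]) : \bar R :=
  (mu (Delta a r) / weight_mass omega (Delta a r) `^ (q%:num / p%:num))%E.

Definition carleson_sup (R : realType) (omega : R -> R) (p q : {posnum R})
    (mu : {measure set R[i] -> \bar R}) (r : R) : \bar R :=
  ereal_sup [set carleson_quotient omega p q mu r a | a in @disc R].

(* The filter of |a| -> 1^-. *)
Definition to_boundary (R : realType) : set_system R[i] :=
  [set A | \forall t \near (1 : R)^'-, forall a, normc a = t -> A a].

Lemma to_boundary_filter (R : realType) : ProperFilter (@to_boundary R).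
Proof.
split.
- move=> H; have [t [H0 t0]] : exists t : R,
      (forall a : R[i], normc a = t -> set0 a) /\ 0 < t.
    apply: (@filter_ex _ ((1 : R)^'-)); apply: filterI => //.
    exact: nbhs_left_gt.
  apply: (H0 (Complex t 0)).
  by rewrite /= expr0n addr0 sqrtr_sqr gtr0_norm.
split.
- exact: nearW.
- move=> A B HA HB; rewrite /to_boundary /=.
  apply: (@filterS2 _ ((1 : R)^'-) _ _ _ _ _ HA HB) => t tA tB a at_.
  by split; [exact: tA|exact: tB].
- move=> A B AB HA; rewrite /to_boundary /=.
  by apply: (@filterS _ ((1 : R)^'-) _ _ _ _ HA) => t tA a /tA; exact: AB.
Qed.

#[global] Instance to_boundary_properfilter (R : realType) :
  ProperFilter (@to_boundary R) := @to_boundary_filter R.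

(* The measure is given on the whole of [R[i]]; only its trace on the disc is
   ever used. *)
Definition locally_finite_on_disc (R : realType)
    (mu : {measure set R[i] -> \bar R}) : Prop :=
  forall K : set R[i], compact K -> K `<=` @disc R -> (mu K < +oo)%E.

(* Main.v *)
Require Import Defs.
From HB Require Import structures.
From mathcomp Require Import all_boot all_order all_algebra.
From mathcomp Require Import all_classical all_reals all_analysis.
From mathcomp Require Import complex measurable_realfun.
From mathcomp Require Import ring lra.
Import Order.TTheory GRing.Theory Num.Theory.
Import numFieldNormedType.Exports.
Import ComplexField.Normc.

(** Write [what] for the tail integral of the weight and [tau a] for
    [(1 - |a|) * what |a|]. The plan is to fix one radius [r] for which the mass
    of [Delta a r] is comparable to [tau a], and to prove both implications of
    the embedding theorem with [tau] in place of the mass.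

    The radius. By reverse doubling a fixed proportion of the tail [what |a|] is
    carried by an annulus [1 - (1 - |a|) / 2 <= |z| <= 1 - (1 - |a|) / (2 * 2 ^ m)],
    where [m] depends on the weight only ([what_gap]). A weight in the class may
    vanish on long intervals, so a small disc may have no mass, but if [r] is close
    enough to one then [Delta a r] contains a sector of that annulus of aperture
    comparable to [1 - |a|]; this bounds its mass below ([Delta_mass_ge]). It also
    lies in a box of size comparable to [1 - |a|], and doubling bounds the mass of
    boxes above ([carleson_box_mass], [Delta_mass_le]). Masses of
    sectors are found by rotating them until they fill an annulus.

    Necessity. A high power of the kernel [(1 - |a|) / (1 - conj a z)] is at least
    a constant on [Delta a r], and the sum over dyadic boxes shows that its norm to
    the power [p] is at most a constant times [tau a] ([kernel_pow_integral]). After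
    normalization these are the [test_functions]; a bounded embedding and
    Chebyshev's inequality give [mu (Delta a r) <= C * tau a ^ (q / p)]
    ([carleson_test]).

    Sufficiency. Since [|f| ^ p] is subharmonic, its averages over concentric
    annuli increase outwards, whatever radial weights are used to average. Hence
    the unweighted average of [|f| ^ p] over a neighbourhood of the dyadic ring
    [2 ^- k.+1 < 1 - |z| <= 2 ^- k] is controlled by its average with weight [omega]
    over an annulus further out, of the kind that carries mass
    ([average_le_annulus], [collar_integral_le]); on that neighbourhood itself the
    weight may vanish. The sub-mean value property for area then bounds [|f| ^ p]
    pointwise on the ring, and, on each square of a grid of mesh [2 ^- k.+2], by a
    local mean. Each square lies in some [Delta a r], so the condition on [mu]
    turns the sum over the squares into the integral over the outer annulus, to the
    power [q / p] ([ring_integral_le]). The outer annuli have bounded overlap and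
    [q / p >= 1], so the sum over [k] is at most the whole integral to the power
    [q / p] ([carleson_upper]). Both implications carry explicit constants, which
    is the equivalence of norms ([carleson_measureP], [identity_norm_asymp]).

    Subharmonicity. The exponential carries vertical segments to circles, so Goursat's
    theorem shows that circle means of analytic functions equal the value at the
    center. If [f 0 = 1], then [log |f|] differs from the real part of an analytic
    function by an error cubic in [f - 1], so [|f| ^ p] satisfies the sub-mean value
    inequality over small circles up to a cubic error ([submean_abspow]); such an
    error is harmless in the [max_principle]. Averages of [|f| ^ p] over finitely
    many rotations satisfy the same principle and are nearly radial, hence nearly
    increasing ([rot_mean_max]), and integration over rotation invariant sets
    removes the averages.

    Compactness. Relative compactness is tested along ultrafilters
    ([compact_closure_ultra]). A bounded set of the Bergman space is bounded
    on each smaller disc, so along an ultrafilter it converges there uniformly to an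
    analytic function ([limit_uniform]). If the quotients vanish at the boundary,
    the part of [mu] near the boundary embeds with small constant
    ([tail_integral]), and the convergence takes place in [L^q]
    ([vanishing_compact]). Conversely the test functions tend to zero uniformly on
    smaller discs, because the kernel power decays faster than [tau]
    ([pow_le_tau]); under compactness they tend to zero in [L^q] as well, and the
    quotients vanish ([compact_vanishing]). *)

Local Open Scope classical_set_scope.
Local Open Scope ring_scope.
Set Implicit Arguments.
Unset Strict Implicit.
Unset Printing Implicit Defensive.

(** * Complex numbers, the unit circle and the exponential *)

Section complex_numbers.
Variable R : realType.
Local Notation C := R[i].
Local Notation N := (@normc R).
Implicit Types (z w : C) (x y t : R).

Lemma normc_distC z w : N (z - w) = N (w - z).
Proof. by rewrite -normcN opprB. Qed.

Lemma normc_sqrE z : N z ^+ 2 = complex.Re z ^+ 2 + complex.Im z ^+ 2.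
Proof. by case: z => x y /=; rewrite sqr_sqrtr// addr_ge0// sqr_ge0. Qed.

Lemma normcX z n : N (z ^+ n) = N z ^+ n.
Proof.
by elim: n => [|n IH]; rewrite ?expr0 ?normc1// !exprS normcM IH.
Qed.

Lemma normc_triang z1 z2 z3 : N (z1 - z3) <= N (z1 - z2) + N (z2 - z3).
Proof. by apply: le_trans (le_normcD _ _); rewrite addrA subrK. Qed.

Lemma normc_subD z w : N z - N w <= N (z - w).
Proof. by rewrite lerBlDr; apply: le_trans (le_normcD _ _); rewrite subrK. Qed.

Lemma normc_dist_abs z w : `|N z - N w| <= N (z - w).
Proof.
by rewrite ler_norml normc_subD andbT lerNl opprB normc_distC normc_subD.
Qed.

Lemma normc_real x : N (real_complex R x) = `|x|.
Proof. by rewrite /= expr0n addr0 sqrtr_sqr. Qed.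

Lemma normc_conj z : N (conjc z) = N z.
Proof. by case: z => x y /=; rewrite sqrrN. Qed.

Lemma normc_eq0P z : (N z == 0) = (z == 0).
Proof. by apply/eqP/eqP => [/eq0_normc|->]; rewrite ?normc0. Qed.

Lemma normc_gt0 z : (0 < N z) = (z != 0).
Proof. by rewrite lt_def normc_eq0P normc_ge0 andbT. Qed.

Lemma normc_le_sqr z x : 0 <= x -> N z ^+ 2 <= x ^+ 2 -> N z <= x.
Proof. by move=> x0; rewrite ler_pXn2r// nnegrE// normc_ge0. Qed.

Lemma ler_Re_normc z : complex.Re z <= N z.
Proof. exact: le_trans (ler_norm _) (Defs.normc_ge_Re z). Qed.

Lemma cReB z w : complex.Re (z - w) = complex.Re z - complex.Re w.
Proof. by case: z; case: w. Qed.

Lemma cImB z w : complex.Im (z - w) = complex.Im z - complex.Im w.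
Proof. by case: z; case: w. Qed.

Lemma cReD z w : complex.Re (z + w) = complex.Re z + complex.Re w.
Proof. by case: z; case: w. Qed.

Lemma cImD z w : complex.Im (z + w) = complex.Im z + complex.Im w.
Proof. by case: z; case: w. Qed.

Lemma cReM z w : complex.Re (z * w) =
  complex.Re z * complex.Re w - complex.Im z * complex.Im w.
Proof. by case: z; case: w. Qed.

Lemma cImM z w : complex.Im (z * w) =
  complex.Re z * complex.Im w + complex.Im z * complex.Re w.
Proof. by case: z; case: w => a b c d /=; rewrite addrC. Qed.

(** ** The unit circle *)

Lemma abs_sin_le x : `|sin x| <= `|x|.
Proof.
wlog x0 : x / 0 <= x => [H|].
  have [/H//|/ltW x0] := leP 0 x.
  by have := H (- x); rewrite oppr_ge0 sinN !normrN; exact.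
have cs : {within `[0, x], continuous (@sin R)}.
  by apply: continuous_subspaceT; exact: continuous_sin.
have [c _] := @MVT_segment R sin cos 0 x x0 (fun y _ => is_derive_sin y) cs.
by rewrite sin0 !subr0 => ->; rewrite normrM ler_piMl// cos_max.
Qed.

Lemma cos_ge_sqr x : 1 - x ^+ 2 / 2 <= cos x.
Proof.
have -> : cos x = 1 - sin (x / 2) ^+ 2 *+ 2.
  have xE : x = (x / 2) *+ 2 by rewrite -mulr_natr divfK.
  rewrite {1}xE cos_mulr2n cos2sin2; ring.
rewrite lerD2l lerN2.
have : sin (x / 2) ^+ 2 <= (x / 2) ^+ 2.
  by rewrite -[leLHS]real_normK ?num_real// -[leRHS]real_normK ?num_real//
    ler_pXn2r ?nnegrE// abs_sin_le.
move: (sin _ ^+ 2) => s; rewrite expr_div_n; lra.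
Qed.

Lemma abs_sin_sub x : `|x| <= 1 -> `|sin x - x| <= x ^+ 2.
Proof.
wlog x0 : x / 0 <= x => [H|].
  have [/H//|/ltW x0] := leP 0 x.
  have := H (- x); rewrite oppr_ge0 sinN !normrN sqrrN -opprD normrN; exact.
rewrite ger0_norm// => x1.
have cs : {within `[0, x], continuous (@sin R)}.
  by apply: continuous_subspaceT; exact: continuous_sin.
have [c] := @MVT_segment R sin cos 0 x x0 (fun y _ => is_derive_sin y) cs.
rewrite sin0 !subr0 in_itv/= => /andP[c0 cx] ->.
have -> : cos c * x - x = - (x * (1 - cos c)) by ring.
rewrite normrN normrM ger0_norm// ger0_norm ?subr_ge0 ?cos_le1//.
rewrite expr2 ler_wpM2l//; have := cos_ge_sqr c; nra.
Qed.

Definition cis t : C := Complex (cos t) (sin t).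

Lemma cisD x y : cis (x + y) = cis x * cis y.
Proof.
by apply/eqP; rewrite eq_complex /= cosD sinD !eqxx/= addrC.
Qed.

Lemma cis0 : cis 0 = 1.
Proof. by rewrite /cis cos0 sin0. Qed.

Lemma cis2pi : cis (pi *+ 2) = 1.
Proof. by rewrite /cis cos2pi sin2pi. Qed.

Lemma normc_cis t : N (cis t) = 1.
Proof. by rewrite /= cos2Dsin2 sqrtr1. Qed.

Lemma normc_cis_sub_sqr x y :
  N (cis x - cis y) ^+ 2 = 4 * sin ((x - y) / 2) ^+ 2.
Proof.
rewrite normc_sqrE /=.
have -> : 4 * sin ((x - y) / 2) ^+ 2 = 2 - 2 * cos (x - y).
  have xE : x - y = ((x - y) / 2) *+ 2 by rewrite -mulr_natr divfK.
  rewrite [in RHS]xE cos_mulr2n cos2sin2; ring.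
rewrite cosB; have := cos2Dsin2 x; have := cos2Dsin2 y.
move: (cos x) (sin x) (cos y) (sin y) => a b c d H1 H2.
transitivity ((a ^+ 2 + b ^+ 2) + (c ^+ 2 + d ^+ 2) - 2 * (a * c + b * d)).
  by ring.
by rewrite H1 H2.
Qed.

Lemma normc_cis_sub_le x y : N (cis x - cis y) <= `|x - y|.
Proof.
apply: normc_le_sqr => //; rewrite normc_cis_sub_sqr real_normK ?num_real//.
have : sin ((x - y) / 2) ^+ 2 <= ((x - y) / 2) ^+ 2.
  by rewrite -[leLHS]real_normK ?num_real// -[leRHS]real_normK ?num_real//
    ler_pXn2r ?nnegrE// abs_sin_le.
move: (sin _ ^+ 2) => s; rewrite expr_div_n; lra.
Qed.

Lemma normc_cis_sub_ge x y : `|x - y| <= 1 ->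
  `|x - y| / 2 <= N (cis x - cis y).
Proof.
move=> xy1; rewrite -(@ler_pXn2r _ 2) ?nnegrE ?divr_ge0 ?normc_ge0//.
rewrite normc_cis_sub_sqr expr_div_n.
set u := (x - y) / 2.
have u1 : `|u| <= 1 / 2 by rewrite /u normrM [`|_^-1|]ger0_norm// ler_wpM2r.
have := @abs_sin_sub u; have -> : `|x - y| = 2 * `|u|.
  by rewrite /u normrM [`|_^-1|]ger0_norm//; field.
rewrite -[u ^+ 2]real_normK ?num_real// -[sin u ^+ 2]real_normK ?num_real//.
have h : `|u| <= `|sin u - u| + `|sin u|.
  by rewrite -[leLHS]normrN; apply: le_trans (ler_normB _ _); rewrite addrAC subrr add0r.
have := normr_ge0 u; have := normr_ge0 (sin u).
move: h; move: (`|u|) u1 (`|sin u|) (`|sin u - u|) => a a1 b c h b0 a0 H.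
have {}H := H ltac:(lra).
have h2 : a / 2 <= b by nra.
have : (a / 2) ^+ 2 <= b ^+ 2 by rewrite ler_pXn2r ?nnegrE//; lra.
rewrite !expr_div_n exprMn; nra.
Qed.

(** [acos] gives the angle in the upper half plane, and its reflection the
    angle in the lower one. *)
Lemma unit_cis z : N z = 1 -> exists2 t, 0 <= t <= pi *+ 2 & z = cis t.
Proof.
case: z => x y nz; have xy1 : x ^+ 2 + y ^+ 2 = 1.
  by have := normc_sqrE (Complex x y); rewrite nz expr1n /= => ->.
have x1 : -1 <= x <= 1.
  rewrite -ler_norml -(@ler_pXn2r _ 2) ?nnegrE// real_normK ?num_real//.
  by rewrite expr1n -xy1 lerDl sqr_ge0.
have cx : cos (acos x) = x by rewrite acosK// in_itv.
have sx : sin (acos x) = `|y|.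
  rewrite sin_acos// -sqrtr_sqr; congr Num.sqrt; rewrite -xy1; ring.
have a0 := acos_ge0 x1; have a1 := acos_lepi x1.
have p0 := @pi_ge0 R.
have [y0|y0] := leP 0 y.
  exists (acos x); first by rewrite a0 mulr2n (le_trans a1)// lerDl.
  by rewrite /cis cx sx ger0_norm.
exists (pi *+ 2 - acos x).
  apply/andP; split; first by rewrite mulr2n; lra.
  by rewrite lerBlDr lerDl.
by rewrite /cis cosB sinB cos2pi sin2pi cx sx ltr0_norm//;
  congr Complex; ring.
Qed.

(** ** The complex exponential *)

Definition cexp z : C := real_complex R (expR (complex.Re z)) * cis (complex.Im z).

Lemma cexpD z w : cexp (z + w) = cexp z * cexp w.
Proof.
by rewrite /cexp cReD cImD expRD cisD rmorphM/=; ring.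
Qed.

Lemma normc_cexp z : N (cexp z) = expR (complex.Re z).
Proof. by rewrite normcM normc_real normc_cis mulr1 gtr0_norm// expR_gt0. Qed.

Lemma expR_taylor1 x : `|x| <= 1 / 2 -> 0 <= expR x - 1 - x <= 2 * x ^+ 2.
Proof.
rewrite ler_norml => /andP[xl xr]; apply/andP; split.
  by have := expR_ge1Dx x; lra.
have := expR_ge1Dx (- x); rewrite expRN => h.
have e0 := expR_gt0 x.
have : (1 + - x) * expR x <= 1 by rewrite -ler_pdivlMr// div1r.
by move: (expR x) => e; nra.
Qed.

(** The remainder that makes [cexp] its own derivative at the origin. *)
Lemma cexp_taylor1 z : N z <= 1 / 2 -> N (cexp z - 1 - z) <= 8 * N z ^+ 2.
Proof.
have := normc_ge0 z; have := Defs.normc_ge_Re z; have := Defs.normc_ge_Im z.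
move: (N z) => n; case: z => x y.
rewrite [complex.Re _]/= [complex.Im _]/= => i0 r0 n0 n1.
have /andP[hx1 hx2] : 0 <= expR x - 1 - x <= 2 * x ^+ 2.
  by apply: expR_taylor1; lra.
have hy : `|sin y - y| <= y ^+ 2 by apply: abs_sin_sub; lra.
have hc := cos_ge_sqr y; have hc1 := cos_le1 y.
have x2 : x ^+ 2 <= n ^+ 2.
  by rewrite -[leLHS]real_normK ?num_real// ler_pXn2r// nnegrE.
have y2 : y ^+ 2 <= n ^+ 2.
  by rewrite -[leLHS]real_normK ?num_real// ler_pXn2r// nnegrE.
have sy := abs_sin_le y.
apply: le_trans (normc_le_ReIm _) _ => /=.
move: hx1 hx2 hy hc hc1 sy.
move: (expR x) (cos y) (sin y) => e c s hx1 hx2 hy hc hc1 sy.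
rewrite !mul0r subr0 addr0 oppr0 addr0.
have -> : e * c - 1 - x = (e - 1 - x) * c + (1 + x) * (c - 1) by ring.
have -> : e * s - y = (e - 1 - x) * s + (s - y) + x * s by ring.
have sn : `|s| <= n by lra.
have c1 : `|c| <= 1.
  by rewrite ler_norml hc1 andbT; nra.
have t1 : `|(e - 1 - x) * c| <= 2 * n ^+ 2.
  rewrite normrM (ger0_norm hx1); apply: le_trans (_ : (e - 1 - x) * 1 <= _).
    by rewrite ler_wpM2l.
  lra.
have t2 : `|(1 + x) * (c - 1)| <= n ^+ 2.
  have x1 : `|1 + x| <= 2.
    by apply: le_trans (ler_normD _ _) _; rewrite normr1; lra.
  rewrite normrM distrC (@ger0_norm _ (1 - c)) ?subr_ge0//.
  apply: le_trans (_ : 2 * (n ^+ 2 / 2) <= _); last by lra.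
  by apply: ler_pM => //; rewrite ?subr_ge0//; lra.
have t3 : `|(e - 1 - x) * s| <= n ^+ 2.
  rewrite normrM (ger0_norm hx1).
  apply: le_trans (_ : (2 * n ^+ 2) * n <= _); first by apply: ler_pM => //; lra.
  nra.
have t4 : `|x * s| <= n ^+ 2 by rewrite normrM expr2 ler_pM//; lra.
apply: le_trans (lerD (ler_normD _ _) (le_trans (ler_normD _ _) (lerD (ler_normD _ _) (lexx _)))) _.
lra.
Qed.

End complex_numbers.
(** * Complex differentiability *)

Section complex_derivative.
Variable R : realType.
Local Notation C := R[i].
Local Notation N := (@normc R).
Implicit Types (f g : C -> C) (z w c : C).

(** Complex differentiability with real tolerances, which is what all the
    estimates below use; see [derivableP] for the link with [derivable]. *)
Definition has_cderiv f z c := forall e : R, 0 < e ->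
  exists2 d : R, 0 < d & forall w, N (w - z) < d ->
    N (f w - f z - c * (w - z)) <= e * N (w - z).

Lemma norm_complexE z : `|z| = real_complex R (N z).
Proof. by rewrite normc_def; case: z. Qed.

Lemma derivableP f z : derivable f z 1 <-> exists c, has_cderiv f z c.
Proof.
rewrite /derivable; split.
- move=> /cvg_ex[c /cvgrPdist_le fc]; exists c => e e0.
  have /fc : 0 < real_complex R e by rewrite ltcR.
  rewrite near_withinE => /nbhs_ballP[[d d'] /=]; rewrite ltcE /= => /andP[/eqP -> d0] H.
  exists d => // w wd; have [->|wz] := eqVneq w z.
    by rewrite !subrr mulr0 subrr normc0 mulr0.
  have wz0 : w - z != 0 by rewrite subr_eq0.
  have wd' : N (0 - (w - z)) < d by rewrite normc_distC subr0.
  have := H (w - z) (iffRL (ball_complexE _ _ _) wd') wz0.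
  rewrite /= /shift /= scaler1 subrK norm_complexE lecR => {}H.
  have -> : f w - f z - c * (w - z) = - (c - (w - z)^-1 *: (f w - f z)) * (w - z).
    rewrite mulNr mulrBl opprB; congr (_ - _).
    by rewrite -[_ *: _]/(_ * _) mulrAC mulVf// mul1r.
  by rewrite normcM normcN ler_wpM2r// normc_ge0.
- move=> [c fc]; apply/cvg_ex; exists c; apply/cvgrPdist_le => -[e e'].
  rewrite ltcE /= => /andP[/eqP -> e0].
  have [d d0 H] := fc e e0.
  rewrite near_withinE; apply/nbhs_ballP; exists (real_complex R d) => /=.
    by rewrite ltcR.
  move=> h /ball_complexE; rewrite sub0r normcN => hd h0.
  rewrite /= /shift /= scaler1 norm_complexE lecR.
  have hd' : N (h + z - z) < d by rewrite addrK.
  have {}H := H (h + z) hd'; rewrite addrK in H.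
  have hE : c - h^-1 *: (f (h + z) - f z) =
     - (f (h + z) - f z - c * h) * h^-1.
    rewrite mulNr mulrBl opprB mulfK//; congr (_ - _).
    by rewrite -[_ *: _]/(_ * _) mulrC.
  have nh : 0 < N h by rewrite normc_gt0.
  by rewrite hE normcM normcN normcV ler_pdivrMr.
Qed.

Lemma has_cderiv_lip f z c : has_cderiv f z c ->
  exists2 d : R, 0 < d & forall w, N (w - z) < d ->
    N (f w - f z) <= (N c + 1) * N (w - z).
Proof.
move=> /(_ 1 ltr01)[d d0 H]; exists d => // w /H; rewrite mul1r => {}H.
rewrite mulrDl mul1r -normcM -[X in N X <= _](subrK (c * (w - z))).
by apply: le_trans (le_normcD _ _) _; rewrite addrC lerD2l.
Qed.

Lemma has_cderiv_cont f z c : has_cderiv f z c -> forall e : R, 0 < e ->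
  exists2 d : R, 0 < d & forall w, N (w - z) < d -> N (f w - f z) < e.
Proof.
move=> /has_cderiv_lip[d d0 H] e e0.
have c0 : 0 < N c + 1 by rewrite ltr_pwDr// normc_ge0.
exists (Num.min d (e / (N c + 1))); first by rewrite lt_min d0 divr_gt0.
move=> w; rewrite lt_min => /andP[/H wd we]; apply: le_lt_trans wd _.
by rewrite mulrC -ltr_pdivlMr.
Qed.

Lemma has_cderiv_cst k z : has_cderiv (fun=> k) z 0.
Proof.
move=> e e0; exists 1 => // w _.
by rewrite mul0r !subrr normc0 mulr_ge0 ?normc_ge0// ltW.
Qed.

Lemma has_cderivD f g z c1 c2 : has_cderiv f z c1 -> has_cderiv g z c2 ->
  has_cderiv (fun w => f w + g w) z (c1 + c2).
Proof.
move=> hf hg e e0.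
have [d1 d10 H1] := hf (e / 2) ltac:(by rewrite divr_gt0).
have [d2 d20 H2] := hg (e / 2) ltac:(by rewrite divr_gt0).
exists (Num.min d1 d2); first by rewrite lt_min d10.
move=> w; rewrite lt_min => /andP[/H1 {}H1 /H2 {}H2].
have -> : f w + g w - (f z + g z) - (c1 + c2) * (w - z) =
  (f w - f z - c1 * (w - z)) + (g w - g z - c2 * (w - z)) by ring.
apply: le_trans (le_normcD _ _) _; apply: le_trans (lerD H1 H2) _.
by rewrite -mulrDl -splitr.
Qed.

Lemma has_cderiv_comp f g z c1 c2 : has_cderiv f z c1 ->
  has_cderiv g (f z) c2 -> has_cderiv (g \o f) z (c2 * c1).
Proof.
move=> hf hg e e0.
pose k := N c1 + 1 + N c2 + 1.
have n1 := normc_ge0 c1; have n2 := normc_ge0 c2.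
have k0 : 0 < k by rewrite /k; lra.
have ek0 : 0 < e / 2 / k by rewrite !divr_gt0.
have [d1 d10 H1] := hf _ ek0.
have [d2 d20 H2] := hg _ ek0.
have [d3 d30 H3] := has_cderiv_lip hf.
have [d4 d40 H4] := has_cderiv_cont hf d20.
exists (Num.min (Num.min d1 d3) d4); first by rewrite !lt_min d10 d30.
move=> w; rewrite !lt_min => /andP[/andP[/H1 {}H1 /H3 {}H3] /H4/H2 {}H2].
have -> : (g \o f) w - (g \o f) z - c2 * c1 * (w - z) =
  (g (f w) - g (f z) - c2 * (f w - f z)) + c2 * (f w - f z - c1 * (w - z)).
  by rewrite /=; ring.
apply: le_trans (le_normcD _ _) _; rewrite normcM.
have nw := normc_ge0 (w - z).
have h1 : e / 2 / k * N (f w - f z) <= e / 2 * N (w - z).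
  apply: le_trans (ler_wpM2l (ltW ek0) H3) _.
  rewrite mulrA ler_wpM2r// mulrAC ler_pdivrMr// ler_wpM2l ?divr_ge0 ?(ltW e0)//.
  by rewrite /k; lra.
have h2 : N c2 * N (f w - f z - c1 * (w - z)) <= e / 2 * N (w - z).
  apply: le_trans (ler_wpM2l n2 H1) _.
  rewrite mulrA ler_wpM2r// mulrA ler_pdivrMr// mulrC ler_wpM2l ?divr_ge0 ?(ltW e0)//.
  by rewrite /k; lra.
by apply: le_trans (lerD (le_trans H2 h1) h2) _; rewrite -mulrDl -splitr.
Qed.

Lemma has_cderiv_sqr z : has_cderiv (fun w => w ^+ 2) z (2 * z).
Proof.
move=> e e0; exists e => // w we.
have -> : w ^+ 2 - z ^+ 2 - 2 * z * (w - z) = (w - z) * (w - z) by ring.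
by rewrite normcM ler_wpM2r ?normc_ge0// ltW.
Qed.

Lemma has_cderiv_scale k z : has_cderiv (fun w => k * w) z k.
Proof.
move=> e e0; exists 1 => // w _.
by rewrite mulrBr subrr normc0 mulr_ge0 ?normc_ge0// ltW.
Qed.

Lemma has_cderivZ k f z c : has_cderiv f z c ->
  has_cderiv (fun w => k * f w) z (k * c).
Proof. by move=> hf; exact: has_cderiv_comp hf (has_cderiv_scale k (f z)). Qed.

(** The product reduces to squares by polarization. *)
Lemma has_cderivM f g z c1 c2 : has_cderiv f z c1 -> has_cderiv g z c2 ->
  has_cderiv (fun w => f w * g w) z (c1 * g z + f z * c2).
Proof.
move=> hf hg; have hng := has_cderivZ (-1) hg.
have hs := has_cderiv_comp (has_cderivD hf hg) (has_cderiv_sqr (f z + g z)).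
have hd := has_cderiv_comp (has_cderivD hf hng) (has_cderiv_sqr (f z + -1 * g z)).
have := has_cderivD (has_cderivZ (1 / 4) hs) (has_cderivZ (- (1 / 4)) hd).
have -> : (fun w => 1 / 4 * ((fun w0 => w0 ^+ 2) \o (fun w0 => f w0 + g w0)) w +
    - (1 / 4) * ((fun w0 => w0 ^+ 2) \o (fun w0 => f w0 + -1 * g w0)) w) =
  (fun w => f w * g w).
  by apply/funext => w /=; field.
by congr has_cderiv; field.
Qed.

Lemma has_cderiv_inv z : z != 0 -> has_cderiv (fun w => w^-1) z (- z ^- 2).
Proof.
move=> z0 e e0; have nz : 0 < N z by rewrite normc_gt0.
exists (Num.min (N z / 2) (e * N z ^+ 3 / 2)).
  by rewrite lt_min !divr_gt0// mulr_gt0// exprn_gt0.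
move=> w; rewrite lt_min => /andP[w1 w2].
have wz : N z / 2 <= N w.
  have := le_normcD (z - w) w; rewrite subrK normc_distC; lra.
have w0 : w != 0 by rewrite -normc_gt0; apply: lt_le_trans wz; rewrite divr_gt0.
have -> : w^-1 - z^-1 - - z ^- 2 * (w - z) = (w - z) * ((w - z) * (z ^- 2 * w^-1)).
  by field; rewrite z0 w0.
rewrite normcM mulrC ler_wpM2r ?normc_ge0// !normcM !normcV normcX.
have nw : 0 < N w by rewrite normc_gt0.
rewrite mulrA !ler_pdivrMr ?exprn_gt0//.
apply: le_trans (ltW w2) _; rewrite exprSr.
have -> : e * (N z ^+ 2 * N z) / 2 = e * N z ^+ 2 * (N z / 2) by ring.
rewrite [leRHS]mulrAC; apply: ler_wpM2l => //.
by rewrite mulr_ge0 ?exprn_ge0 ?normc_ge0// ltW.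
Qed.

Lemma has_cderivX f z c n : has_cderiv f z c ->
  exists c', has_cderiv (fun w => f w ^+ n) z c'.
Proof.
move=> hf; elim: n => [|n [c' IH]].
  by exists 0; apply: has_cderiv_cst.
exists (c * f z ^+ n + f z * c').
have -> : (fun w => f w ^+ n.+1) = (fun w => f w * f w ^+ n).
  by apply/funext => w; rewrite exprS.
exact: has_cderivM hf IH.
Qed.

Lemma has_cderiv_cexp z : has_cderiv (@cexp R) z (cexp z).
Proof.
move=> e e0; have nz : 0 < N (cexp z) by rewrite normc_cexp expR_gt0.
exists (Num.min (1 / 2) (e / 8 / N (cexp z))); first by rewrite lt_min !divr_gt0.
move=> w; rewrite lt_min => /andP[w1 w2].
have -> : cexp w - cexp z - cexp z * (w - z) =
    cexp z * (cexp (w - z) - 1 - (w - z)).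
  by rewrite !mulrBr -cexpD mulr1 (addrC z) subrK.
rewrite normcM; apply: le_trans (ler_wpM2l (ltW nz) (cexp_taylor1 (ltW w1))) _.
rewrite expr2 !mulrA ler_wpM2r ?normc_ge0//.
move: w2; rewrite ltr_pdivlMr// ltr_pdivlMr//; nra.
Qed.

Lemma analyticP f : analytic_in_disc f <->
  forall z, N z < 1 -> exists c, has_cderiv f z c.
Proof. by split => H z /H /derivableP. Qed.

(** Restriction of [f] to the disc of center [z0] and radius [h], transported
    to the unit disc. *)
Lemma analytic_rescale f z0 (h : R) : 0 <= h -> N z0 + h <= 1 ->
  analytic_in_disc f ->
  analytic_in_disc (fun z => f (z0 + real_complex R h * z)).
Proof.
move=> h0 zh /analyticP af; apply/analyticP => z z1.
have := h0; rewrite le_eqVlt => /predU1P[<-|hp].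
  exists 0; rewrite (_ : (fun _ => _) = fun=> f z0); first exact: has_cderiv_cst.
  by apply/funext => w; rewrite rmorph0 mul0r addr0.
have [c hc] : exists c, has_cderiv f (z0 + real_complex R h * z) c.
  apply: af; apply: le_lt_trans (le_normcD _ _) _.
  rewrite normcM normc_real ger0_norm//; apply: lt_le_trans zh.
  by rewrite ltrD2l -[ltRHS]mulr1 ltr_pM2l.
exists (c * (0 + real_complex R h)).
apply: (has_cderiv_comp (f := fun w => z0 + real_complex R h * w)) => //.
by apply: has_cderivD; [exact: has_cderiv_cst|exact: has_cderiv_scale].
Qed.

Lemma analytic_rotate f u : N u = 1 -> analytic_in_disc f ->
  analytic_in_disc (fun z => f (u * z)).
Proof.
move=> u1 /analyticP af; apply/analyticP => z z1.
have [c hc] : exists c, has_cderiv f (u * z) c.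
  by apply: af; rewrite normcM u1 mul1r.
exists (c * u); apply: (has_cderiv_comp (f := fun w => u * w)) => //.
exact: has_cderiv_scale.
Qed.

End complex_derivative.
(** * Goursat's theorem and circle means *)

Section goursat.
Variable R : realType.
Local Notation C := R[i].
Local Notation N := (@normc R).
Local Notation leb := (@lebesgue_measure R).

Definition itg (a b : R) (phi : R -> R) : R := \int[leb]_(x in `[a, b]) phi x.

Definition continuous_on (a b : R) (phi : R -> R) : Prop :=
  forall x, a <= x <= b -> {for x, continuous phi}.

Lemma continuous_atP (phi : R -> R) x :
  (forall e, 0 < e -> exists2 d, 0 < d &
     forall y, `|y - x| < d -> `|phi y - phi x| < e) ->
  {for x, continuous phi}.
Proof.
move=> H; apply/cvgrPdist_lt => e /H[d d0 Hd].
by apply/nbhs_ballP; exists d => // y; rewrite /ball /= distrC => /Hd; rewrite distrC.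
Qed.

Lemma continuous_on_integrable a b phi : continuous_on a b phi ->
  leb.-integrable `[a, b] (EFin \o phi).
Proof.
move=> cp; apply: continuous_compact_integrable; first exact: segment_compact.
by apply: continuous_in_subspaceT => x; rewrite inE /= in_itv /=; exact: cp.
Qed.

Lemma continuous_on_cst a b k : continuous_on a b (fun=> k).
Proof. by move=> x _; exact: cvg_cst. Qed.

Lemma itgD a b phi psi : continuous_on a b phi -> continuous_on a b psi ->
  itg a b (fun x => phi x + psi x) = itg a b phi + itg a b psi.
Proof.
by move=> cp cq; rewrite /itg RintegralD//; exact: continuous_on_integrable.
Qed.

Lemma itgB a b phi psi : continuous_on a b phi -> continuous_on a b psi ->
  itg a b (fun x => phi x - psi x) = itg a b phi - itg a b psi.
Proof.
by move=> cp cq; rewrite /itg RintegralB//; exact: continuous_on_integrable.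
Qed.

Lemma itgZ a b k phi : continuous_on a b phi ->
  itg a b (fun x => k * phi x) = k * itg a b phi.
Proof.
by move=> cp; rewrite /itg RintegralZl//; exact: continuous_on_integrable.
Qed.

Lemma itg_cst a b k : a <= b -> itg a b (fun=> k) = k * (b - a).
Proof.
move=> ab; rewrite /itg Rintegral_cst//= lebesgue_measure_itv /= lte_fin.
by case: ltgtP ab => //= ->; rewrite subrr.
Qed.

Lemma itg_split a m b phi : a <= m -> m <= b -> continuous_on a b phi ->
  itg a b phi = itg a m phi + itg m b phi.
Proof.
move=> am mb cp; rewrite /itg.
have ii := continuous_on_integrable cp.
have := @Rintegral_itvB R phi (BLeft a) (BRight b) m ii.
rewrite !bnd_simp => /(_ am mb) /eqP; rewrite subr_eq => /eqP ->.
rewrite addrC; congr (_ + _).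
rewrite Rintegral_itv_obnd_cbnd//.
apply: integrableS ii => //.
by apply: subset_itvr; rewrite bnd_simp.
Qed.

Lemma itg_le a b phi psi : continuous_on a b phi -> continuous_on a b psi ->
  (forall x, a <= x <= b -> phi x <= psi x) -> itg a b phi <= itg a b psi.
Proof.
by move=> cp cq H; apply: le_Rintegral => //; exact: continuous_on_integrable.
Qed.

Lemma itg_approx a b phi k B : a <= b -> continuous_on a b phi ->
  (forall x, a <= x <= b -> `|phi x - k| <= B) ->
  `|itg a b phi - k * (b - a)| <= B * (b - a).
Proof.
move=> ab cp H; rewrite ler_distl; apply/andP; split.
  rewrite -mulrBl -itg_cst//; apply: itg_le => //.
    exact: continuous_on_cst.
  by move=> x /H; rewrite ler_distl => /andP[].
rewrite -mulrDl -itg_cst//; apply: itg_le => //.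
  exact: continuous_on_cst.
by move=> x /H; rewrite ler_distl => /andP[].
Qed.

(** The imaginary part of the contour integral of [H] over the boundary of the
    rectangle with sides [x1, x2] and [y1, y2]; the real part is recovered by
    applying everything to [i * H]. *)
Definition contour (H : C -> C) (x1 x2 y1 y2 : R) : R :=
  itg x1 x2 (fun x => complex.Im (H (Complex x y1)) - complex.Im (H (Complex x y2)))
  + itg y1 y2 (fun y => complex.Re (H (Complex x2 y)) - complex.Re (H (Complex x1 y))).

Section rectangle.
Variables (H : C -> C) (X1 X2 : R).
Hypothesis dH : forall w, X1 <= complex.Re w <= X2 -> exists c, has_cderiv H w c.

Lemma strip_continuous_hor (x y : R) : X1 <= x <= X2 ->
  {for x, continuous (fun x => complex.Im (H (Complex x y)))}.
Proof.
move=> xX; apply: continuous_atP => e e0.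
have [c /has_cderiv_cont/(_ _ e0)[d d0 hd]] := dH (w := Complex x y) xX.
exists d => // x' xd; rewrite -cImB; apply: le_lt_trans (Defs.normc_ge_Im _) _.
apply: hd; apply: le_lt_trans (normc_le_ReIm _) _ => /=.
by rewrite subrr normr0 addr0.
Qed.

Lemma strip_continuous_ver (x y : R) : X1 <= x <= X2 ->
  {for y, continuous (fun y => complex.Re (H (Complex x y)))}.
Proof.
move=> xX; apply: continuous_atP => e e0.
have [c /has_cderiv_cont/(_ _ e0)[d d0 hd]] := dH (w := Complex x y) xX.
exists d => // x' xd; rewrite -cReB; apply: le_lt_trans (Defs.normc_ge_Re _) _.
apply: hd; apply: le_lt_trans (normc_le_ReIm _) _ => /=.
by rewrite subrr normr0 add0r.
Qed.

Lemma contour_splitx x1 m x2 y1 y2 : X1 <= x1 -> x1 <= m -> m <= x2 ->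
  x2 <= X2 -> y1 <= y2 ->
  contour H x1 x2 y1 y2 = contour H x1 m y1 y2 + contour H m x2 y1 y2.
Proof.
move=> X1x x1m mx2 xX2 y12; rewrite /contour (@itg_split x1 m x2)//; last first.
  move=> x /andP[x1x xx2]; have xX : X1 <= x <= X2.
    by rewrite (le_trans X1x)// (le_trans xx2).
  by apply: cvgB; exact: strip_continuous_hor.
have c1 x : X1 <= x <= X2 -> continuous_on y1 y2 (fun y => complex.Re (H (Complex x y))).
  by move=> xX y _; exact: strip_continuous_ver.
have h1 : X1 <= x1 <= X2 by rewrite X1x (le_trans x1m)// (le_trans mx2).
have hm : X1 <= m <= X2 by rewrite (le_trans X1x)// (le_trans mx2).
have h2 : X1 <= x2 <= X2 by rewrite xX2 (le_trans X1x)// (le_trans x1m).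
rewrite (itgB (c1 _ h2) (c1 _ h1)) (itgB (c1 _ hm) (c1 _ h1)).
by rewrite (itgB (c1 _ h2) (c1 _ hm)); ring.
Qed.

Lemma contour_splity x1 x2 y1 m y2 : X1 <= x1 -> x1 <= x2 -> x2 <= X2 ->
  y1 <= m -> m <= y2 ->
  contour H x1 x2 y1 y2 = contour H x1 x2 y1 m + contour H x1 x2 m y2.
Proof.
move=> X1x x12 xX2 y1m my2.
have h1 : X1 <= x1 <= X2 by rewrite X1x (le_trans x12).
have h2 : X1 <= x2 <= X2 by rewrite xX2 (le_trans X1x).
rewrite /contour (@itg_split y1 m y2)//; last first.
  by move=> y _; apply: cvgB; exact: strip_continuous_ver.
have c1 y : continuous_on x1 x2 (fun x => complex.Im (H (Complex x y))).
  move=> x /andP[x1x xx2]; apply: strip_continuous_hor.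
  by rewrite (le_trans X1x)// (le_trans xx2).
rewrite (itgB (c1 y1) (c1 y2)) (itgB (c1 y1) (c1 m)) (itgB (c1 m) (c1 y2)).
by ring.
Qed.

(** Affine functions have zero contour integral, so near a point where [H] is
    differentiable only the remainder of its expansion contributes. *)
Lemma contour_small x1 x2 y1 y2 (w0 c : C) (e : R) :
  X1 <= x1 -> x1 <= x2 -> x2 <= X2 -> y1 <= y2 -> 0 <= e ->
  x1 <= complex.Re w0 <= x2 -> y1 <= complex.Im w0 <= y2 ->
  (forall w, N (w - w0) <= (x2 - x1) + (y2 - y1) ->
     N (H w - H w0 - c * (w - w0)) <= e * N (w - w0)) ->
  `|contour H x1 x2 y1 y2| <= 2 * e * ((x2 - x1) + (y2 - y1)) ^+ 2.
Proof.
move=> X1x x12 xX2 y12 e0 w0x w0y Hw; set l := (x2 - x1) + (y2 - y1).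
have near (x y : R) : x1 <= x <= x2 -> y1 <= y <= y2 ->
    N (H (Complex x y) - H w0 - c * (Complex x y - w0)) <= e * l.
  move=> /andP[? ?] /andP[? ?]; move: w0x w0y => /andP[? ?] /andP[? ?].
  have wl : N (Complex x y - w0) <= l.
    apply: le_trans (normc_le_ReIm _) _; rewrite cReB cImB /= /l.
    by apply: lerD; rewrite ler_norml; apply/andP; split; lra.
  by apply: le_trans (Hw _ wl) _; rewrite ler_wpM2l.
have h1 : X1 <= x1 <= X2 by rewrite X1x (le_trans x12).
have h2 : X1 <= x2 <= X2 by rewrite xX2 (le_trans X1x).
have A1 : `|itg x1 x2 (fun x => complex.Im (H (Complex x y1)) -
      complex.Im (H (Complex x y2))) - (complex.Re c * (y1 - y2)) * (x2 - x1)|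
    <= (2 * (e * l)) * (x2 - x1).
  apply: itg_approx => //.
    move=> x /andP[x1x xx2]; have xX : X1 <= x <= X2.
      by rewrite (le_trans X1x)// (le_trans xx2).
    by apply: cvgB; exact: strip_continuous_hor.
  move=> x xx; have := near x y1 xx ltac:(by rewrite lexx).
  have := near x y2 xx ltac:(by rewrite lexx y12).
  move=> /(le_trans (Defs.normc_ge_Im _)) n2 /(le_trans (Defs.normc_ge_Im _)) n1.
  move: n1 n2; rewrite !(cImB, cImM, cReB) /=.
  rewrite !ler_norml => /andP[n1 n1'] /andP[n2 n2'].
  by apply/andP; split; lra.
have A2 : `|itg y1 y2 (fun y => complex.Re (H (Complex x2 y)) -
      complex.Re (H (Complex x1 y))) - (complex.Re c * (x2 - x1)) * (y2 - y1)|
    <= (2 * (e * l)) * (y2 - y1).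
  apply: itg_approx => //.
    by move=> y _; apply: cvgB; exact: strip_continuous_ver.
  move=> y yy; have := near x1 y ltac:(by rewrite lexx) yy.
  have := near x2 y ltac:(by rewrite lexx x12) yy.
  move=> /(le_trans (Defs.normc_ge_Re _)) n2 /(le_trans (Defs.normc_ge_Re _)) n1.
  move: n1 n2; rewrite !(cReB, cReM, cImB) /=.
  rewrite !ler_norml => /andP[n1 n1'] /andP[n2 n2'].
  by apply/andP; split; lra.
have -> : 2 * e * l ^+ 2 = 2 * (e * l) * (x2 - x1) + 2 * (e * l) * (y2 - y1).
  by rewrite /l; ring.
move: A1 A2; rewrite /contour !ler_norml => /andP[a1 a1'] /andP[a2 a2'].
by apply/andP; split; lra.
Qed.

End rectangle.

(** Dependent choice for the bisection below. *)
Lemma dependent_choice_nat (T : Type) (P : nat -> T -> Prop)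
    (S : nat -> T -> T -> Prop) (t0 : T) : P 0%N t0 ->
  (forall n t, P n t -> exists t', P n.+1 t' /\ S n t t') ->
  exists u : nat -> T, [/\ u 0%N = t0, forall n, P n (u n) &
    forall n, S n (u n) (u n.+1)].
Proof.
move=> P0 next.
pose T' := {nt : nat * T | P nt.1 nt.2}.
have nx (x : T') : {y : T' | (sval y).1 = (sval x).1.+1 /\
    S (sval x).1 (sval x).2 (sval y).2}.
  case: x => -[n t] /= Pnt; apply: cid.
  have [t' [Pt' St']] := next n t Pnt.
  by exists (exist _ (n.+1, t') Pt').
pose v := fix v n : T' := if n is n'.+1 then sval (nx (v n')) else exist _ (0%N, t0) P0.
have v1 n : (sval (v n)).1 = n.
  by elim: n => //= n IH; case: (nx (v n)) => y [/= -> _]; rewrite IH.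
exists (fun n => (sval (v n)).2); split => // n.
  by have := svalP (v n); rewrite v1.
by rewrite /=; case: (nx (v n)) => y [_ /=]; rewrite v1.
Qed.

Lemma half_pow_lt (A e : R) : 0 < e -> exists n : nat, A / 2 ^+ n < e.
Proof.
move=> e0; have [m hm] : exists m : nat, `|A| / e < m%:R.
  by exists (Num.truncn (`|A| / e)).+1; rewrite truncnS_gt.
exists m; rewrite ltr_pdivrMr ?exprn_gt0//.
apply: le_lt_trans (ler_norm A) _; rewrite mulrC -ltr_pdivrMr//.
apply: lt_trans hm _; rewrite -natrX ltr_nat; exact: ltn_expl.
Qed.

(** Goursat's theorem, by bisection: a rectangle with a large contour integral
    would contain ever smaller ones with a contour integral that is large
    relative to their squared diameter, against differentiability at their
    common point. *)
Lemma goursat (H : C -> C) (x1 x2 y1 y2 : R) :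
  (forall w, x1 <= complex.Re w <= x2 -> exists c, has_cderiv H w c) ->
  x1 <= x2 -> y1 <= y2 -> contour H x1 x2 y1 y2 = 0.
Proof.
move=> dH x12 y12; apply/eqP; rewrite -normr_eq0 eq_le normr_ge0 andbT.
pose A := x2 - x1; pose B := y2 - y1; pose l := A + B.
have A0 : 0 <= A by rewrite subr_ge0.
have B0 : 0 <= B by rewrite subr_ge0.
apply/ler_addgt0Pl => e' e'0; rewrite addr0.
pose e := e' / (2 * (l ^+ 2 + 1)).
have l2 : 0 < l ^+ 2 + 1 by rewrite ltr_pwDr// sqr_ge0.
have e0 : 0 < e by rewrite divr_gt0// mulr_gt0.
suff : `|contour H x1 x2 y1 y2| <= 2 * e * l ^+ 2.
  move=> /le_trans; apply; rewrite /e.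
  rewrite (_ : 2 * _ * _ = e' * (l ^+ 2 / (l ^+ 2 + 1))); last first.
    by field; rewrite gt_eqF.
  by rewrite ler_piMr ?(ltW e'0)// ler_pdivrMr// mul1r lerDl.
rewrite leNgt; apply/negP => bad0.
pose h n : R := 2 ^+ n.
have h0 n : 0 < h n by rewrite /h exprn_gt0.
pose Q n (q : R * R) := [/\ x1 <= q.1, q.1 + A / h n <= x2, y1 <= q.2,
  q.2 + B / h n <= y2 &
  2 * e * (l / h n) ^+ 2 < `|contour H q.1 (q.1 + A / h n) q.2 (q.2 + B / h n)|].
pose S n (q q' : R * R) := [/\ q.1 <= q'.1, q'.1 + A / h n.+1 <= q.1 + A / h n,
  q.2 <= q'.2 & q'.2 + B / h n.+1 <= q.2 + B / h n].
have [|n q Qn|u [u0 uQ uS]] := @dependent_choice_nat _ Q S (x1, y1).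
- rewrite /Q /= /h expr0 !divr1 /A /B !(addrC _ (_ - _)) !subrK !lexx.
  by split.
- case: Qn => q1 q1' q2 q2' bad.
  have a0 : 0 <= A / h n.+1 by rewrite divr_ge0// ltW.
  have b0 : 0 <= B / h n.+1 by rewrite divr_ge0// ltW.
  have aE : A / h n = A / h n.+1 + A / h n.+1.
    by rewrite /h exprS; field; rewrite expf_neq0.
  have bE : B / h n = B / h n.+1 + B / h n.+1.
    by rewrite /h exprS; field; rewrite expf_neq0.
  have lE : l / h n = 2 * (l / h n.+1).
    by rewrite /h exprS; field; rewrite expf_neq0.
  move: bad q1' q2'; rewrite aE bE lE /S aE bE.
  set a := A / h n.+1 in a0 *; set b := B / h n.+1 in b0 *.
  set k := l / h n.+1; case: q q1 q2 => x y /= q1 q2 bad q1' q2'.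
  have spl : contour H x (x + (a + a)) y (y + (b + b)) =
      (contour H x (x + a) y (y + b) + contour H x (x + a) (y + b) (y + b + b)) +
      (contour H (x + a) (x + a + a) y (y + b) +
       contour H (x + a) (x + a + a) (y + b) (y + b + b)).
    rewrite (addrA x) (addrA y).
    rewrite (contour_splitx dH (m := x + a)); [|lra..].
    by congr (_ + _); apply: (contour_splity dH); lra.
  rewrite !addrA in q1' q2'.
  have mk q1'' q2'' : x <= q1'' <= x + a -> y <= q2'' <= y + b ->
      2 * e * k ^+ 2 < `|contour H q1'' (q1'' + a) q2'' (q2'' + b)| ->
      exists t', Q n.+1 t' /\ [/\ x <= t'.1, t'.1 + a <= x + (a + a),
        y <= t'.2 & t'.2 + b <= y + (b + b)].
    clear -q1 q2 q1' q2' => /andP[? ?] /andP[? ?] ?; exists (q1'', q2'').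
    by split; split; rewrite /= -/a -/b //; lra.
  have [g1|] := leP `|contour H x (x + a) y (y + b)| (2 * e * k ^+ 2); last first.
    by apply: mk; rewrite ?lexx ?lerDl ?a0 ?b0.
  have [g2|] := leP `|contour H x (x + a) (y + b) (y + b + b)| (2 * e * k ^+ 2); last first.
    by apply: mk; rewrite ?lexx ?lerDl ?a0 ?b0.
  have [g3|] := leP `|contour H (x + a) (x + a + a) y (y + b)| (2 * e * k ^+ 2); last first.
    by apply: mk; rewrite ?lexx ?lerDl ?a0 ?b0.
  have [g4|] := leP `|contour H (x + a) (x + a + a) (y + b) (y + b + b)| (2 * e * k ^+ 2); last first.
    by apply: mk; rewrite ?lexx ?lerDl ?a0 ?b0.
  exfalso; move: bad; apply/negP; rewrite -leNgt spl.
  apply: le_trans (ler_normD _ _) _.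
  apply: le_trans (lerD (ler_normD _ _) (ler_normD _ _)) _.
  rewrite exprMn; lra.
have mon i j : (i <= j)%N -> [/\ (u i).1 <= (u j).1,
    (u j).1 + A / h j <= (u i).1 + A / h i, (u i).2 <= (u j).2 &
    (u j).2 + B / h j <= (u i).2 + B / h i].
  move=> /subnK <-; elim: (j - i)%N => [|k [m1 m2 m3 m4]]; first by rewrite add0n !lexx.
  rewrite addSn; have [s1 s2 s3 s4] := uS (k + i)%N.
  by split; [apply: le_trans s1|apply: (le_trans s2)|apply: le_trans s3|apply: (le_trans s4)].
have cmp i j : (u i).1 <= (u j).1 + A / h j /\ (u i).2 <= (u j).2 + B / h j.
  have [ij|/ltnW ij] := leqP i j; have [m1 m2 m3 m4] := mon _ _ ij.
    by rewrite !(le_trans m1, le_trans m3) ?lerDl ?divr_ge0 ?(ltW (h0 _)).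
  split; first by apply: le_trans m2; rewrite lerDl divr_ge0 ?(ltW (h0 _)).
  by apply: le_trans m4; rewrite lerDl divr_ge0 ?(ltW (h0 _)).
pose SX := range (fun n => (u n).1); pose SY := range (fun n => (u n).2).
have hsx : has_sup SX.
  split; first by exists (u 0%N).1; exists 0%N.
  by exists ((u 0%N).1 + A / h 0%N) => _ [n _ <-]; have [] := cmp n 0%N.
have hsy : has_sup SY.
  split; first by exists (u 0%N).2; exists 0%N.
  by exists ((u 0%N).2 + B / h 0%N) => _ [n _ <-]; have [] := cmp n 0%N.
pose w0 : C := Complex (sup SX) (sup SY).
have w0x n : (u n).1 <= complex.Re w0 <= (u n).1 + A / h n.
  apply/andP; split; first by apply: ub_le_sup; [exact: hsx.2|exists n].
  by apply: ge_sup; [exact: hsx.1|move=> _ [m _ <-]; have [] := cmp m n].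
have w0y n : (u n).2 <= complex.Im w0 <= (u n).2 + B / h n.
  apply/andP; split; first by apply: ub_le_sup; [exact: hsy.2|exists n].
  by apply: ge_sup; [exact: hsy.1|move=> _ [m _ <-]; have [] := cmp m n].
have [c hc] : exists c, has_cderiv H w0 c.
  apply: dH; have /andP[lo hi] := w0x 0%N; have [q1 q2 _ _ _] := uQ 0%N.
  by rewrite (le_trans q1)//= (le_trans hi).
have [d d0 hd] := hc e e0.
have [n ln] := half_pow_lt l d0.
have [q1 q1' q2 q2' bad] := uQ n.
move: bad; apply/negP; rewrite -leNgt.
have hn := h0 n.
have xa : (u n).1 <= (u n).1 + A / h n by rewrite lerDl divr_ge0// ltW.
have yb : (u n).2 <= (u n).2 + B / h n by rewrite lerDl divr_ge0// ltW.
have := contour_small dH q1 xa q1' yb (ltW e0) (w0x n) (w0y n) (c := c).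
rewrite !(addrC _ (_ / h n)) !addrK -mulrDl; apply => w wl; apply: hd.
exact: le_lt_trans wl ln.
Qed.

End goursat.
(** ** Mean values over circles *)

Section circle_means.
Variable R : realType.
Local Notation C := R[i].
Local Notation N := (@normc R).
Local Notation Re := (@complex.Re R).
Implicit Types (f g : C -> C) (v : C -> R) (s : R).

Definition circle_mean v s : R :=
  (pi *+ 2)^-1 * itg 0 (pi *+ 2) (fun t => v (real_complex R s * cis t)).

Lemma pi2_gt0 : 0 < (pi *+ 2 : R).
Proof. by rewrite mulrn_wgt0// pi_gt0. Qed.

Lemma normc_circle s t : 0 <= s -> N (real_complex R s * cis t) = s.
Proof. by move=> s0; rewrite normcM normc_real normc_cis mulr1 ger0_norm. Qed.

Definition ccontinuous_at v (z : C) : Prop := forall e : R, 0 < e ->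
  exists2 d : R, 0 < d & forall w, N (w - z) < d -> `|v w - v z| < e.

Lemma circle_continuous v s a b : 0 <= s ->
  (forall z, N z = s -> ccontinuous_at v z) ->
  continuous_on a b (fun t => v (real_complex R s * cis t)).
Proof.
move=> s0 cv t _; apply: continuous_atP => e e0.
have [d d0 hd] := cv _ (normc_circle t s0) e e0.
have s1 : 0 < s + 1 by lra.
exists (d / (s + 1)); first by rewrite divr_gt0.
move=> t' tt'; apply: hd.
rewrite -mulrBr normcM normc_real ger0_norm//.
apply: le_lt_trans (ler_wpM2l s0 (normc_cis_sub_le _ _)) _.
apply: le_lt_trans (_ : (s + 1) * `|t' - t| < _).
  by rewrite ler_wpM2r// lerDl.
by rewrite mulrC -ltr_pdivlMr.
Qed.

Lemma ccontinuous_Re g z c : has_cderiv g z c -> ccontinuous_at (Re \o g) z.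
Proof.
move=> /has_cderiv_cont hg e /hg[d d0 hd]; exists d => // w /hd.
by rewrite /= -cReB; apply: le_lt_trans; exact: Defs.normc_ge_Re.
Qed.

Lemma circle_mean_le v1 v2 s : 0 <= s ->
  (forall z, N z = s -> ccontinuous_at v1 z) ->
  (forall z, N z = s -> ccontinuous_at v2 z) ->
  (forall z, N z = s -> v1 z <= v2 z) -> circle_mean v1 s <= circle_mean v2 s.
Proof.
move=> s0 c1 c2 v12; rewrite /circle_mean ler_wpM2l ?invr_ge0 ?(ltW pi2_gt0)//.
apply: itg_le; [exact: circle_continuous..|].
by move=> t _; apply: v12; exact: normc_circle.
Qed.

Lemma circle_mean_cst k s : circle_mean (fun=> k) s = k.
Proof.
rewrite /circle_mean itg_cst ?(ltW pi2_gt0)// subr0 mulrC mulfK//.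
by rewrite gt_eqF// pi2_gt0.
Qed.

Lemma circle_meanD v1 v2 s : 0 <= s ->
  (forall z, N z = s -> ccontinuous_at v1 z) ->
  (forall z, N z = s -> ccontinuous_at v2 z) ->
  circle_mean (fun z => v1 z + v2 z) s = circle_mean v1 s + circle_mean v2 s.
Proof.
by move=> s0 c1 c2; rewrite /circle_mean itgD ?mulrDr//; exact: circle_continuous.
Qed.

Lemma circle_meanZ k v s : 0 <= s ->
  (forall z, N z = s -> ccontinuous_at v z) ->
  circle_mean (fun z => k * v z) s = k * circle_mean v s.
Proof.
by move=> s0 c1; rewrite /circle_mean itgZ 1?mulrCA//; exact: circle_continuous.
Qed.

(** The form [g(z) dz / z] is closed: pulled back by the exponential, circles
    become the vertical sides of a rectangle of height [2 pi], and its
    horizontal sides cancel by periodicity. *)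
Lemma circle_mean_const g s1 s2 :
  (forall z, 0 < N z < 1 -> exists c, has_cderiv g z c) ->
  0 < s1 -> s1 <= s2 -> s2 < 1 ->
  circle_mean (Re \o g) s1 = circle_mean (Re \o g) s2.
Proof.
move=> dg s10 s12 s21.
have s20 : 0 < s2 by exact: lt_le_trans s12.
pose H := g \o @cexp R.
have cE (s t : R) : 0 < s -> cexp (Complex (ln s) t) = real_complex R s * cis t.
  by move=> s0; rewrite /cexp /= lnK.
have dH w : ln s1 <= Re w <= ln s2 -> exists c, has_cderiv H w c.
  move=> /andP[_ w2]; have [c hc] : exists c, has_cderiv g (cexp w) c.
    apply: dg; rewrite normc_cexp expR_gt0/=.
    by apply: le_lt_trans s21; rewrite -[leRHS]lnK// ler_expR.
  by exists (c * cexp w); exact: has_cderiv_comp (has_cderiv_cexp w) hc.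
have l12 : ln s1 <= ln s2 by rewrite ler_ln.
have := goursat dH l12 (ltW pi2_gt0); rewrite /contour.
rewrite (_ : (fun x => _ - _) = fun=> 0); last first.
  by apply/funext => x; rewrite /H /cexp /= -/(cis _) -/(cis _) cis2pi cis0 subrr.
rewrite itg_cst// mul0r add0r itgB; last 2 first.
- by move=> y _; apply: (strip_continuous_ver dH); rewrite l12 lexx.
- by move=> y _; apply: (strip_continuous_ver dH); rewrite l12 lexx.
move=> /eqP; rewrite subr_eq0 => /eqP E; rewrite /circle_mean; congr (_ * _).
have itE (s : R) : 0 < s -> (fun t => (Re \o g) (real_complex R s * cis t)) =
    (fun t => complex.Re (H (Complex (ln s) t))).
  by move=> s0; apply/funext => t; rewrite /H /= -cE.
rewrite (itE _ s10) (itE _ s20); exact: esym E.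
Qed.

(** The means do not depend on the radius, and small circles shrink to the
    center. Differentiability at the center is not assumed, with difference
    quotients in view. *)
Lemma circle_mean_center g s :
  (forall z, 0 < N z < 1 -> exists c, has_cderiv g z c) ->
  (forall e : R, 0 < e -> exists2 d : R, 0 < d &
     forall w, N w < d -> N (g w - g 0) < e) ->
  0 < s < 1 -> circle_mean (Re \o g) s = Re (g 0).
Proof.
move=> dg cg /andP[s0 s1]; apply/eqP; rewrite -subr_eq0 -normr_eq0 eq_le normr_ge0 andbT.
apply/ler_addgt0Pl => e e0; rewrite addr0.
have [d d0 hd] := cg e e0.
pose s' := Num.min s (d / 2).
have s'0 : 0 < s' by rewrite lt_min s0 divr_gt0.
have s'd : s' < d by rewrite gt_min; apply/orP; right; lra.
have s's : s' <= s by rewrite ge_min lexx.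
rewrite -(circle_mean_const dg s'0 s's s1).
have cm := @itg_approx R 0 (pi *+ 2) (fun t => (Re \o g) (real_complex R s' * cis t)) (Re (g 0)) e (ltW pi2_gt0).
rewrite /circle_mean -(@ler_pM2l _ (pi *+ 2)) ?pi2_gt0//.
rewrite -[X in X * `|_|](@gtr0_norm _ (pi *+ 2)) ?pi2_gt0//.
rewrite -normrM mulrBr mulrA mulfV ?gt_eqF ?pi2_gt0// mul1r.
move: cm; rewrite subr0 [X in _ -> `|_ - X| <= _]mulrC [X in _ -> _ <= X]mulrC; apply.
  apply: circle_continuous; first exact: ltW.
  move=> z zs; have [c hc] : exists c, has_cderiv g z c.
    by apply: dg; rewrite zs s'0 (le_lt_trans s's).
  exact: ccontinuous_Re hc.
move=> t _; rewrite /= -cReB; apply: le_trans (Defs.normc_ge_Re _) _.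
by apply: ltW; apply: hd; rewrite normc_circle// ltW.
Qed.

Lemma circle_mean_analytic f s : analytic_in_disc f -> 0 < s < 1 ->
  circle_mean (Re \o f) s = Re (f 0).
Proof.
move=> /analyticP af s01; apply: circle_mean_center => //.
  by move=> z /andP[_ /af].
have [c /has_cderiv_cont fc] : exists c, has_cderiv f 0 c.
  by apply: af; rewrite normc0.
by move=> e /fc[d d0 hd]; exists d => // w wd; apply: hd; rewrite subr0.
Qed.

(** Multiplication by such a factor turns bounds for real parts into bounds for
    the modulus. *)
Lemma phase (z : C) : exists2 u : C, N u = 1 & Re (u * z) = N z.
Proof.
have [->|z0] := eqVneq z 0; first by exists 1; rewrite ?normc1// mulr0 normc0.
have nz : 0 < N z by rewrite normc_gt0.
exists (conjc z * (real_complex R (N z))^-1).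
  by rewrite normcM normcV normc_real normc_conj ger0_norm ?ltW// mulfV// gt_eqF.
rewrite mulrAC -fmorphV/= cReM /= mulr0 subr0.
have -> : Re (conjc z * z) = N z ^+ 2.
  by rewrite normc_sqrE; case: z {z0 nz} => x y /=; ring.
by rewrite expr2 mulfK// gt_eqF.
Qed.

Lemma circle_max_center g s B :
  (forall z, 0 < N z < 1 -> exists c, has_cderiv g z c) ->
  (forall e : R, 0 < e -> exists2 d : R, 0 < d &
     forall w, N w < d -> N (g w - g 0) < e) ->
  0 < s < 1 -> (forall z, N z = s -> N (g z) <= B) -> N (g 0) <= B.
Proof.
move=> dg cg s01 gB; have [u u1 uE] := phase (g 0).
rewrite -uE -(@circle_mean_center (fun z => u * g z) s)//; last 2 first.
- by move=> z /dg[c hc]; exists (u * c); exact: has_cderivZ.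
- move=> e /cg[d d0 hd]; exists d => // w /hd.
  by rewrite -mulrBr normcM u1 mul1r.
rewrite -[leRHS](circle_mean_cst B s); have /andP[s0 s1] := s01.
apply: circle_mean_le; first exact: ltW.
- move=> z zs; have [c hc] : exists c, has_cderiv g z c by apply: dg; rewrite zs.
  exact: ccontinuous_Re (has_cderivZ u hc).
- by move=> z _ e e0; exists 1 => // w _; rewrite subrr normr0.
move=> z /gB; apply: le_trans; apply: le_trans (ler_Re_normc _) _.
by rewrite normcM u1 mul1r.
Qed.

(** The difference quotient at the origin, completed by the derivative, is
    analytic off the origin and continuous there; at the center it is at most
    its maximum over a circle. *)
Lemma cauchy_estimate f c s M : analytic_in_disc f -> has_cderiv f 0 c ->
  0 < s < 1 -> (forall z, N z < 1 -> N (f z) <= M) -> N c <= 2 * M / s.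
Proof.
move=> /analyticP af fc s01 fM; have /andP[s0 s1] := s01.
pose g z := if z == 0 then c else (f z - f 0) * z^-1.
have g0 : g 0 = c by rewrite /g eqxx.
rewrite -g0; apply: (circle_max_center (s := s)) => //.
- move=> z /andP[z0 z1]; have zn : z != 0 by rewrite -normc_gt0.
  have [c1 h1] := af z z1.
  have h2 : has_cderiv (fun w => f w - f 0) z (c1 + 0).
    by apply: has_cderivD h1 (has_cderiv_cst _ _).
  have h3 := has_cderivM h2 (has_cderiv_inv zn).
  eexists => e /h3[d d0 hd]; exists (Num.min d (N z)); first by rewrite lt_min d0.
  move=> w; rewrite lt_min => /andP[wd wz].
  have wn : w != 0.
    by apply: contraTneq wz => ->; rewrite sub0r normcN ltxx.
  by rewrite /g (negbTE zn) (negbTE wn); exact: hd.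
- move=> e e0; have e20 : 0 < e / 2 by rewrite divr_gt0.
  have [d d0 hd] := fc _ e20; exists d => // w wd.
  rewrite /g eqxx; case: eqVneq => [_|w0]; first by rewrite subrr normc0.
  have nw : 0 < N w by rewrite normc_gt0.
  have := hd w; rewrite subr0 => /(_ wd) h.
  have -> : (f w - f 0) * w^-1 - c = (f w - f 0 - c * w) * w^-1.
    by rewrite [RHS]mulrBl mulfK.
  rewrite normcM normcV ltr_pdivrMr//; apply: le_lt_trans h _.
  by rewrite ltr_pM2r//; lra.
- move=> z zs; have z0 : z != 0 by rewrite -normc_gt0 zs.
  rewrite /g (negbTE z0) normcM normcV zs ler_pM2r ?invr_gt0//.
  apply: le_trans (le_normcD _ _) _; rewrite normcN mulr_natl mulr2n.
  by apply: lerD; apply: fM; rewrite ?zs ?normc0.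
Qed.

Lemma real_is_derive (phi : R -> R) (t l : R) :
  (forall e, 0 < e -> exists2 d, 0 < d & forall t', `|t' - t| < d ->
    `|phi t' - phi t - l * (t' - t)| <= e * `|t' - t|) ->
  is_derive t 1 phi l.
Proof.
move=> H.
have cl : h^-1 *: ((phi \o shift t) (h *: 1) - phi t) @[h --> (0 : R)^'] --> l.
  apply/cvgrPdist_le => e /H[d d0 hd].
  rewrite near_withinE; apply/nbhs_ballP; exists d => // h.
  rewrite /ball /= sub0r normrN => hhd h0.
  have := hd (h + t); rewrite addrK => /(_ hhd).
  rewrite /= /shift /= [h%:A]mulr1.
  have -> : l - h^-1 *: (phi (h + t) - phi t) = - (phi (h + t) - phi t - l * h) * h^-1.
    rewrite mulNr mulrBl opprB mulfK//; congr (_ - _).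
    by rewrite -[_ *: _]/(_ * _) mulrC.
  by rewrite normrM normrN normfV ler_pdivrMr// normr_gt0.
apply: DeriveDef; first by apply/cvg_ex; exists l.
exact: (cvg_lim _ cl).
Qed.

(** After a rotation that makes the increment real, this is the mean value
    theorem for the real part along the segment. *)
Lemma mean_value_le f rho B z w :
  (forall x, N x <= rho -> exists2 c, has_cderiv f x c & N c <= B) ->
  N z <= rho -> N w <= rho -> N (f z - f w) <= B * N (z - w).
Proof.
move=> df zr wr; have [u u1 <-] := phase (f z - f w).
pose seg t := w + real_complex R t * (z - w).
have segr (t : R) : 0 <= t <= 1 -> N (seg t) <= rho.
  move=> /andP[t0 t1]; have -> : seg t = real_complex R (1 - t) * w + real_complex R t * z.
    by rewrite /seg rmorphB rmorph1; ring.
  apply: le_trans (le_normcD _ _) _; rewrite !normcM !normc_real.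
  rewrite !ger0_norm ?subr_ge0//; nra.
pose phi t := Re (u * f (seg t)).
have dphi (t : R) : 0 <= t <= 1 -> exists2 c, is_derive t 1 phi (Re (u * (c * (z - w)))) & N c <= B.
  move=> t01; have [c hc cB] := df _ (segr t t01); exists c => //.
  apply: real_is_derive => e e0.
  have n0 : 0 < N (z - w) + 1 by rewrite ltr_pwDr// normc_ge0.
  have [d d0 hd] := hc (e / (N (z - w) + 1)) ltac:(by rewrite divr_gt0).
  exists (d / (N (z - w) + 1)); first by rewrite divr_gt0.
  move=> t' tt'; have segB : seg t' - seg t = real_complex R (t' - t) * (z - w).
    by rewrite /seg rmorphB; ring.
  have nseg : N (seg t' - seg t) = `|t' - t| * N (z - w).
    by rewrite segB normcM normc_real.
  have sd : N (seg t' - seg t) < d.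
    rewrite nseg; apply: le_lt_trans (_ : `|t' - t| * (N (z - w) + 1) < _).
      by rewrite ler_wpM2l// lerDl.
    by rewrite -ltr_pdivlMr.
  have := hd _ sd; rewrite nseg => h.
  have -> : phi t' - phi t - Re (u * (c * (z - w))) * (t' - t) =
     Re (u * (f (seg t') - f (seg t) - c * (seg t' - seg t))).
    rewrite /phi segB -!cReB.
    have reZ (k : R) (x : C) : Re x * k = Re (x * real_complex R k).
      by rewrite cReM /= mulr0 subr0.
    by rewrite reZ -cReB; congr Re; ring.
  apply: le_trans (Defs.normc_ge_Re _) _; rewrite normcM u1 mul1r.
  apply: le_trans h _; move: n0; set n := N (z - w) => n0.
  have -> : e / (n + 1) * (`|t' - t| * n) = e * `|t' - t| * (n / (n + 1)) by ring.
  by rewrite ler_piMr ?mulr_ge0 ?(ltW e0)// ler_pdivrMr// mul1r lerDl ler01.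
pose dp (t : R) : R := xget 0 [set l : R | is_derive t 1 phi l /\ `|l| <= B * N (z - w)].
have dpP (t : R) : 0 <= t <= 1 -> is_derive t 1 phi (dp t) /\ `|dp t| <= B * N (z - w).
  move=> t01; rewrite /dp; case: xgetP => [l _ //|].
  have [c h cB] := dphi t t01 => /(_ (Re (u * (c * (z - w)))))[]; split => //.
  apply: le_trans (Defs.normc_ge_Re _) _; rewrite !normcM u1 mul1r.
  by rewrite ler_wpM2r// normc_ge0.
have := @MVT_segment R phi dp 0 1 ler01.
have i1 (t : R) : t \in `]0, 1[ -> is_derive t 1 phi (dp t).
  by rewrite in_itv/= => /andP[t0 t1]; have [] := dpP t ltac:(by rewrite !ltW).
have cphi : {within `[0, 1], continuous phi}.
  apply: continuous_in_subspaceT => t; rewrite inE/= in_itv/= => t01.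
  have [h _] := dpP t t01.
  exact/differentiable_continuous/derivable1_diffP/ex_derive.
move=> /(_ i1 cphi)[t]; rewrite in_itv /= => /dpP[_ hB]; rewrite subr0 mulr1.
have -> : phi 1 - phi 0 = Re (u * (f z - f w)).
  rewrite /phi /seg rmorph0 rmorph1 mul0r mul1r addr0 -cReB.
  by rewrite (addrC w) subrK mulrBr.
by move=> ->; exact: le_trans (ler_norm _) hB.
Qed.

Section bounded_analytic.
Variables (f : C -> C) (M : R).
Hypotheses (af : analytic_in_disc f) (fM : forall z, N z < 1 -> N (f z) <= M).

Lemma cderiv_bound z c : N z <= 1 / 2 -> has_cderiv f z c -> N c <= 8 * M.
Proof.
move=> z2 hc; pose g x := f (z + real_complex R (1 / 2) * x).
have ag : analytic_in_disc g by apply: analytic_rescale => //; lra.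
have hg : has_cderiv g 0 (c * (0 + real_complex R (1 / 2))).
  apply: (has_cderiv_comp (f := fun x => z + real_complex R (1 / 2) * x)).
    by apply: has_cderivD; [exact: has_cderiv_cst|exact: has_cderiv_scale].
  by rewrite mulr0 addr0.
have /(_ (1 / 2) M) := cauchy_estimate ag hg; rewrite add0r normcM normc_real ger0_norm; last lra.
move=> h; have : N c * (1 / 2) <= 2 * M / (1 / 2).
  apply: h; first by lra.
  move=> x x1; apply: fM; apply: le_lt_trans (le_normcD _ _) _.
  by rewrite normcM normc_real ger0_norm; lra.
lra.
Qed.

Lemma analytic_lip z w : N z <= 1 / 2 -> N w <= 1 / 2 ->
  N (f z - f w) <= 8 * M * N (z - w).
Proof.
apply: mean_value_le => x x2; have /analyticP/(_ x)[|c hc] := af; first lra.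
by exists c => //; exact: cderiv_bound hc.
Qed.

(** The Cauchy estimate for the difference of two rescaled translates of [f]. *)
Lemma cderiv_lip z c c0 : N z <= 1 / 4 -> has_cderiv f z c ->
  has_cderiv f 0 c0 -> N (c - c0) <= 128 * M * N z.
Proof.
move=> z4 hc hc0; pose k := real_complex R (1 / 4).
pose g x := f (z + k * x) + -1 * f (0 + k * x).
have k4 : N k = 1 / 4 by rewrite normc_real ger0_norm//; lra.
have ag : analytic_in_disc g.
  apply/analyticP => x x1.
  have h40 : 0 <= 1 / 4 :> R by lra.
  have z14 : N z + 1 / 4 <= 1 by lra.
  have z04 : N 0 + 1 / 4 <= 1 :> R by rewrite normc0; lra.
  have [c1 h1] := (analyticP _).1 (analytic_rescale h40 z14 af) x x1.
  have [c2 h2] := (analyticP _).1 (analytic_rescale h40 z04 af) x x1.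
  by exists (c1 + -1 * c2); apply: has_cderivD h1 (has_cderivZ (-1) h2).
have hg : has_cderiv g 0 (c * (0 + k) + -1 * (c0 * (0 + k))).
  apply: has_cderivD.
    apply: (has_cderiv_comp (f := fun x => z + k * x)).
      by apply: has_cderivD; [exact: has_cderiv_cst|exact: has_cderiv_scale].
    by rewrite mulr0 addr0.
  apply: has_cderivZ; apply: (has_cderiv_comp (f := fun x => 0 + k * x)).
    by apply: has_cderivD; [exact: has_cderiv_cst|exact: has_cderiv_scale].
  by rewrite mulr0 addr0.
have := cauchy_estimate (s := 1 / 2) (M := 8 * M * N z) ag hg.
have -> : c * (0 + k) + -1 * (c0 * (0 + k)) = (c - c0) * k by ring.
rewrite normcM k4 => h; have : N (c - c0) * (1 / 4) <= 2 * (8 * M * N z) / (1 / 2).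
  apply: h; first by lra.
  move=> x x1; rewrite /g mulN1r.
  have kx : N (k * x) <= 1 / 4 by rewrite normcM k4; lra.
  have -> : 8 * M * N z = 8 * M * N (z + k * x - (0 + k * x)).
    by congr (_ * N _); ring.
  apply: analytic_lip; last by rewrite add0r; lra.
  by apply: le_trans (le_normcD _ _) _; lra.
lra.
Qed.

(** Second order estimate with a constant depending only on a bound for [f]:
    it survives pointwise limits. *)
Lemma analytic_taylor1 c h : has_cderiv f 0 c -> N h <= 1 / 4 ->
  N (f h - f 0 - c * h) <= 128 * M * N h ^+ 2.
Proof.
move=> hc h4.
have M0 : 0 <= M by apply: le_trans (normc_ge0 (f 0)) _; apply: fM; rewrite normc0.
have df x : N x <= N h -> exists2 c', has_cderiv (fun y => f y + (- c) * y) x c'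
    & N c' <= 128 * M * N h.
  move=> xh; have /analyticP/(_ x)[|c' hc'] := af; first lra.
  exists (c' + - c).
    by apply: has_cderivD hc' (has_cderiv_scale _ _).
  apply: le_trans (cderiv_lip _ hc' hc) _; first lra.
  by rewrite ler_wpM2l// mulr_ge0.
have := mean_value_le df (lexx _) (_ : N 0 <= N h).
rewrite normc0 => /(_ (normc_ge0 h)); rewrite subr0 expr2 mulrA; apply: le_trans.
by rewrite le_eqVlt; apply/orP; left; apply/eqP; congr N; ring.
Qed.

End bounded_analytic.

End circle_means.
(** ** Compactness of closed discs *)

Section closed_discs.
Variable R : realType.
Local Notation C := R[i].
Local Notation N := (@normc R).

Definition cdisc (rho : R) : set C := [set z | N z <= rho].

Lemma ccontinuousP (v : C -> R) z : ccontinuous_at v z <-> {for z, continuous v}.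
Proof.
split => [cv|/cvgrPdist_lt cv e e0].
  apply/(@cvgrPdist_lt _ _ _ _ (nbhs_filter z)) => e /cv[d d0 hd].
  apply/nbhs_ballP; exists (real_complex R d) => /=; first by rewrite ltcR.
  by move=> w /ball_complexE; rewrite normc_distC => /hd; rewrite distrC.
have /nbhs_ballP[[d d'] /=] := cv e e0.
rewrite ltcE /= => /andP[/eqP -> d0] hd; exists d => // w wz.
by rewrite distrC; apply: hd; apply/ball_complexE; rewrite normc_distC.
Qed.

Lemma continuous_normc : continuous (N : C -> R).
Proof.
move=> z; apply/ccontinuousP => e e0; exists e => // w.
exact: le_lt_trans (normc_dist_abs _ _).
Qed.

Lemma closed_cdisc rho : closed (cdisc rho).
Proof.
rewrite (_ : cdisc rho = N @^-1` [set x | x <= rho]) //.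
by apply: closed_comp; [move=> z _; exact: continuous_normc|exact: closed_le].
Qed.

Lemma continuous_cplx : continuous (fun w : R * R => Complex w.1 w.2 : C).
Proof.
move=> [x y]; apply/cvgrPdist_lt => -[e e'].
rewrite ltcE /= => /andP[/eqP -> e0].
exists (ball x (e / 2), ball y (e / 2)) => /=.
  by split; apply: nbhsx_ballx; rewrite divr_gt0.
move=> [a b] [] /=; rewrite /ball /= => h1 h2.
rewrite norm_complexE ltcR; apply: le_lt_trans (normc_le_ReIm _) _ => /=.
by rewrite [ltRHS]splitr ltrD.
Qed.

Lemma compact_cdisc rho : compact (cdisc rho).
Proof.
have cr := @compact_setX _ _ _ _ (@segment_compact R (- rho) rho) (@segment_compact R (- rho) rho).
have ci := @continuous_compact _ C _ _ (@continuous_subspaceT _ _ _ _ continuous_cplx) cr.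
apply: (subclosed_compact _ ci); first exact: closed_cdisc.
move=> z zr; exists (complex.Re z, complex.Im z); last by case: z zr.
split => /=; rewrite in_itv /= -ler_norml.
  exact: le_trans (Defs.normc_ge_Re _) zr.
exact: le_trans (Defs.normc_ge_Im _) zr.
Qed.

Lemma heine_cdisc (v : C -> R) rho : (forall z, N z <= rho -> ccontinuous_at v z) ->
  forall e : R, 0 < e -> exists2 d : R, 0 < d &
    forall z w, N z <= rho -> N (w - z) < d -> `|v w - v z| < e.
Proof.
move=> cv e e0.
have /compact_near_coveringP/near_covering_withinP nc := @compact_cdisc rho.
pose P (d : R) (z : C) := forall w, N (w - z) < d -> `|v w - v z| < e.
have : \forall d \near (0 : R)^'+, cdisc rho `<=` P d.
  apply: (compact_near_coveringP _).1; first exact: compact_cdisc.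
  move=> x xr; have e2 : 0 < e / 2 by rewrite divr_gt0.
  have [d d0 hd] := cv x xr _ e2.
  exists (ball x (real_complex R (d / 2)), [set t : R | t < d / 2]).
    split => /=; last by apply: nbhs_right_lt; rewrite divr_gt0.
    by apply: nbhsx_ballx; rewrite ltcR divr_gt0.
  move=> [z t] /= [/ball_complexE xz td] w wz.
  have zx : `|v z - v x| < e / 2.
    by apply: hd; rewrite normc_distC; apply: lt_trans xz _; lra.
  have wx : `|v w - v x| < e / 2.
    by apply: hd; apply: le_lt_trans (normc_triang _ z _) _; rewrite (normc_distC z); lra.
  have -> : v w - v z = (v w - v x) - (v z - v x) by ring.
  by apply: le_lt_trans (ler_normB _ _) _; rewrite [ltRHS]splitr ltrD.
move=> H; have [d [hd d0]] : exists d, (cdisc rho `<=` P d) /\ 0 < d.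
  apply: (@filter_ex _ ((0 : R)^'+)); apply: filterI => //.
  exact: nbhs_right_gt.
by exists d => // z w zr; exact: hd.
Qed.

Lemma cdisc_max (v : C -> R) rho : 0 <= rho ->
  (forall z, N z <= rho -> ccontinuous_at v z) ->
  exists2 z0, N z0 <= rho & forall z, N z <= rho -> v z <= v z0.
Proof.
move=> rho0 cv; have [||z0 z0r h] := @compact_EVT_max C R v (cdisc rho) _ (@compact_cdisc rho).
- by exists (0 : C); rewrite /cdisc /mkset normc0.
- by apply: continuous_in_subspaceT => z; rewrite inE => /cv /ccontinuousP.
exists z0; first by move: z0r; rewrite inE.
by move=> z zr; apply: h; rewrite inE.
Qed.

End closed_discs.

(** * Subharmonicity of powers of the modulus *)

Section subharmonic.
Variable R : realType.
Local Notation C := R[i].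
Local Notation N := (@normc R).
Local Notation Re := (@complex.Re R).

Lemma powR_continuous (p : R) x : 0 < p -> 0 <= x ->
  forall e : R, 0 < e -> exists2 d : R, 0 < d &
    forall y, 0 <= y -> `|y - x| < d -> `|y `^ p - x `^ p| < e.
Proof.
move=> p0; rewrite le_eqVlt => /predU1P[<-|x0] e e0.
  exists (e `^ p^-1); first by rewrite powR_gt0.
  move=> y y0; rewrite subr0 powR0 ?gt_eqF// subr0 ger0_norm// => ye.
  rewrite ger0_norm ?powR_ge0//.
  have -> : e = (e `^ p^-1) `^ p by rewrite -powRrM mulVf ?gt_eqF// powRr1// ltW.
  by rewrite gt0_ltr_powR// nnegrE ?powR_ge0.
have dp := @derivable_powR R 1 p x; have xp : x \in `]0, +oo[ by rewrite in_itv/= x0.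
have /differentiable_continuous := (derivable1_diffP _ _).1 (dp xp).
move=> /cvgrPdist_lt/(_ e e0)/nbhs_ballP[d /= d0 hd]; exists d => // y y0 yx.
by rewrite distrC; apply: hd; rewrite /ball /= distrC.
Qed.

Lemma ccontinuous_powR (f : C -> C) (p : R) z : 0 < p ->
  (forall e : R, 0 < e -> exists2 d : R, 0 < d &
     forall w, N (w - z) < d -> N (f w - f z) < e) ->
  ccontinuous_at (fun w => N (f w) `^ p) z.
Proof.
move=> p0 cf e e0.
have [d d0 hd] := powR_continuous p0 (normc_ge0 (f z)) e0.
have [d' d'0 hd'] := cf d d0; exists d' => // w /hd' h.
by apply: hd; [exact: normc_ge0|exact: le_lt_trans (normc_dist_abs _ _) h].
Qed.

Lemma ccontinuousD (v1 v2 : C -> R) z : ccontinuous_at v1 z ->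
  ccontinuous_at v2 z -> ccontinuous_at (fun w => v1 w + v2 w) z.
Proof.
move=> /ccontinuousP c1 /ccontinuousP c2; apply/ccontinuousP.
exact: cvgD c1 c2.
Qed.

Lemma ccontinuous_cst k (z : C) : ccontinuous_at (fun=> k : R) z.
Proof. by move=> e e0; exists 1 => // w _; rewrite subrr normr0. Qed.

Lemma ccontinuousZ k (v : C -> R) z : ccontinuous_at v z ->
  ccontinuous_at (fun w => k * v w) z.
Proof.
by move=> /ccontinuousP c; apply/ccontinuousP; apply: cvgM c; exact: cvg_cst.
Qed.

Lemma ccontinuous_sum n (v : nat -> C -> R) z :
  (forall j, (j < n)%N -> ccontinuous_at (v j) z) ->
  ccontinuous_at (fun w => \sum_(j < n) v j w) z.
Proof.
elim: n => [|n IH] cv.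
  by rewrite (_ : (fun _ => _) = fun=> 0); [exact: ccontinuous_cst|apply/funext => w; rewrite big_ord0].
rewrite (_ : (fun _ => _) = fun w => \sum_(j < n) v j w + v n w); last first.
  by apply/funext => w; rewrite big_ord_recr.
by apply: ccontinuousD; [apply: IH => j jn; apply: cv; exact: ltnW|exact: cv].
Qed.

(** The logarithm dominates its second order Taylor polynomial up to a cubic
    error: the derivative of the difference is [t^2 / (1 + t)]. *)
Lemma ln1D_taylor2 (t : R) : - (1 / 2) <= t ->
  t - t ^+ 2 / 2 - 2 * `|t| ^+ 3 <= ln (1 + t).
Proof.
move=> t2; pose g (x : R) := ln (1 + x) - x + 2^-1 * x ^+ 2.
have dg (x : R) : - (1 / 2) <= x -> is_derive x 1 g (x ^+ 2 / (1 + x)).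
  move=> x2; have x1 : 0 < 1 + x by lra.
  have d1 : is_derive x 1 (fun y : R => ln (1 + y)) ((1 + x)^-1).
    have := @is_derive1_comp R (@ln R) (fun y => 1 + y) x _ 1 (is_derive1_ln x1).
    rewrite mulr1 => H; apply: H; apply: real_is_derive => e e0.
    exists 1 => // y _; rewrite (_ : 1 + y - (1 + x) - 1 * (y - x) = 0); last by ring.
    by rewrite normr0 mulr_ge0// ltW.
  have d2 : is_derive x 1 (fun y : R => 2^-1 * y ^+ 2) x.
    apply: real_is_derive => e e0; exists e => // y ye.
    have -> : 2^-1 * y ^+ 2 - 2^-1 * x ^+ 2 - x * (y - x) = 2^-1 * (y - x) * (y - x).
      by field.
    rewrite normrM ler_wpM2r// normrM ger0_norm ?invr_ge0//.
    by have := normr_ge0 (y - x); lra.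
  apply: is_derive_eq; field; rewrite gt_eqF//.
have g0 : g 0 = 0 by rewrite /g addr0 ln1 expr0n /= mulr0 subr0 addr0.
suff : - (2 * `|t| ^+ 3) <= g t by rewrite /g; lra.
have cg a b : - (1 / 2) <= a -> {within `[a, b], continuous g}.
  move=> a2; apply: continuous_in_subspaceT => x; rewrite inE /= in_itv /= => /andP[ax _].
  apply: differentiable_continuous; apply/derivable1_diffP.
  by have [] := dg x (le_trans a2 ax).
have [t0|t0] := leP 0 t.
  have z2 : - (1 / 2) <= 0 :> R by lra.
  have [|c] := @MVT_segment R g (fun x => x ^+ 2 / (1 + x)) 0 t t0 _ (cg 0 t z2).
    by move=> x; rewrite in_itv /= => /andP[x0 _]; apply: dg; lra.
  rewrite in_itv /= g0 !subr0 => /andP[c0 ct] ->.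
  apply: le_trans (_ : 0 <= _); first by rewrite oppr_le0 mulr_ge0// exprn_ge0.
  by rewrite mulr_ge0// divr_ge0 ?sqr_ge0//; lra.
have [|c] := @MVT_segment R g (fun x => x ^+ 2 / (1 + x)) t 0 (ltW t0) _ (cg t 0 t2).
  by move=> x; rewrite in_itv /= => /andP[x0 _]; apply: dg; lra.
rewrite in_itv /= g0 !sub0r => /andP[tc c0] /eqP; rewrite eqr_oppLR => /eqP ->.
rewrite lerN2 ltr0_norm//.
have -> : c ^+ 2 / (1 + c) * - t = (- t * c ^+ 2) / (1 + c) by ring.
rewrite ler_pdivrMr; last by lra.
have ct2 : c ^+ 2 <= t ^+ 2 by nra.
have -> : (- t) ^+ 3 = - t * t ^+ 2 by ring.
have t2' : 0 <= - t * t ^+ 2 by rewrite mulr_ge0 ?sqr_ge0//; lra.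
apply: le_trans (_ : - t * t ^+ 2 <= _); first by rewrite ler_wpM2l//; lra.
by move: t2'; move: (- t * t ^+ 2) => k k0; nra.
Qed.

(** Since [exp x >= 1 + x], it is enough that [log|1 + w|] exceeds
    [Re(w - w^2/2)] up to a cubic error. The real part of an analytic function of
    [w] appears, whose circle means are known. *)
Lemma normc1D_powR_ge (p : R) (w : C) : 0 < p -> N w <= 1 / 8 ->
  1 + p * Re (w + (- (1 / 2)%:C%C) * (w * w)) - 40 * p * N w ^+ 3 <=
  N (1 + w) `^ p.
Proof.
move=> p0 w8; set n := N w in w8 *.
have n0 : 0 <= n by exact: normc_ge0.
have r0 := Defs.normc_ge_Re w; have i0 := Defs.normc_ge_Im w.
have w1 : 0 < N (1 + w).
  have := normc_subD 1 (- w); rewrite opprK normc1 normcN -/n; lra.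
rewrite /powR gt_eqF//; apply: le_trans (expR_ge1Dx _).
rewrite -addrA lerD2l -mulrA (mulrCA 40) -mulrBr ler_wpM2l ?(ltW p0)//.
have sq : N (1 + w) ^+ 2 = 1 + (2 * Re w + n ^+ 2).
  rewrite /n !normc_sqrE; case: (w) => x y /=; ring.
have ln2 : ln (N (1 + w)) = ln (1 + (2 * Re w + n ^+ 2)) / 2.
  by rewrite -sq lnXn// -[_ *+ 2]mulr_natr mulfK.
have nn : n ^+ 2 = Re w ^+ 2 + complex.Im w ^+ 2 by rewrite /n normc_sqrE.
rewrite ln2 cReD cReM cReM /=; move: nn r0 i0 {ln2 sq w1}.
rewrite -/n; move: (Re w) (complex.Im w) => x y nn r0 i0.
have n2 : n ^+ 2 <= n / 8 by rewrite expr2; nra.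
set t := 2 * x + n ^+ 2.
move: r0 i0; rewrite !ler_norml => /andP[x1 x2] /andP[y1 y2].
have t2 : - (1 / 2) <= t by rewrite /t; have := sqr_ge0 n; lra.
have := ln1D_taylor2 t2.
have tn : `|t| <= 3 * n.
  by have := sqr_ge0 n; rewrite ler_norml /t => ?; apply/andP; split; lra.
have t3 : `|t| ^+ 3 <= 27 * n ^+ 3.
  have -> : 27 * n ^+ 3 = (3 * n) ^+ 3 by ring.
  by apply: lerXn2r; rewrite ?nnegrE ?mulr_ge0.
move: (ln (1 + t)) => L hL.
suff : 2 * x - x ^+ 2 + y ^+ 2 - 80 * n ^+ 3 <= L by lra.
apply: le_trans hL.
have -> : t - t ^+ 2 / 2 = 2 * x - x ^+ 2 + y ^+ 2 + (n ^+ 2 - x ^+ 2 - y ^+ 2)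
   - 2 * x * n ^+ 2 - n ^+ 2 * n ^+ 2 / 2 by rewrite /t; field.
have h1 : x * n ^+ 2 <= n ^+ 3 by rewrite (exprS n 2) ler_wpM2r ?sqr_ge0.
have h2 : n ^+ 2 * n ^+ 2 <= n ^+ 3.
  have -> : n ^+ 3 = n * n ^+ 2 by ring.
  by rewrite ler_wpM2r ?sqr_ge0//; lra.
have n30 : 0 <= n ^+ 3 by rewrite exprn_ge0.
lra.
Qed.

End subharmonic.
Section max_principle.
Variable R : realType.
Local Notation C := R[i].
Local Notation N := (@normc R).
Local Notation Re := (@complex.Re R).

Lemma analytic_continuous (f : C -> C) z : analytic_in_disc f -> N z < 1 ->
  forall e : R, 0 < e -> exists2 d : R, 0 < d &
    forall w, N (w - z) < d -> N (f w - f z) < e.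
Proof. by move=> /analyticP af /af[c]; exact: has_cderiv_cont. Qed.

Lemma ccontinuous_abspow (f : C -> C) (p : R) z : 0 < p ->
  analytic_in_disc f -> N z < 1 -> ccontinuous_at (fun w => N (f w) `^ p) z.
Proof.
by move=> p0 af z1; apply: ccontinuous_powR p0 _; exact: analytic_continuous.
Qed.

(** If [f(0) = 1] and [w = f - 1], then [Re(w - w^2/2)] has mean zero over
    circles and differs from [log|f|] by a cubic error. *)
Lemma submean_abspow0 (f : C -> C) (p : R) : 0 < p -> analytic_in_disc f ->
  exists K s0 : R, [/\ 0 <= K, 0 < s0, s0 < 1 & forall s, 0 < s -> s <= s0 ->
    N (f 0) `^ p - K * s ^+ 3 <= circle_mean (fun z => N (f z) `^ p) s].
Proof.
move=> p0 af.
have cf s : 0 < s < 1 -> forall z, N z = s -> ccontinuous_at (fun w => N (f w) `^ p) z.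
  by move=> /andP[_ s1] z zs; apply: ccontinuous_abspow => //; rewrite zs.
have [f0|f0] := eqVneq (f 0) 0.
  exists 0, (1 / 2); split => //; try lra.
  move=> s s0 s2; rewrite f0 normc0 powR0 ?gt_eqF// mul0r subr0.
  rewrite -(circle_mean_cst 0 s); apply: circle_mean_le; first exact: ltW.
  - by move=> z _; exact: ccontinuous_cst.
  - by apply: cf; rewrite s0/=; lra.
  - by move=> z _; exact: powR_ge0.
have nf : 0 < N (f 0) by rewrite normc_gt0.
pose w z := (f 0)^-1 * f z + -1.
have fw z : f z = f 0 * (1 + w z).
  by rewrite /w; field.
have aw : analytic_in_disc w.
  apply/analyticP => z z1; have [c hc] := (analyticP _).1 af z z1.
  eexists; apply: has_cderivD; [exact: has_cderivZ hc|exact: has_cderiv_cst].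
have w0 : w 0 = 0 by rewrite /w mulVf// subrr.
have [c hc] : exists c, has_cderiv w 0 c by apply: (analyticP _).1; rewrite ?normc0.
have [d d0 hd] := has_cderiv_lip hc; set L := N c + 1 in hd.
have L0 : 0 < L by rewrite /L ltr_pwDr// normc_ge0.
pose h z := w z + (- (1 / 2)%:C%C) * (w z * w z).
have ah : analytic_in_disc h.
  apply/analyticP => z z1; have [c' hc'] := (analyticP _).1 aw z z1.
  eexists; apply: has_cderivD; first exact: hc'.
  exact: has_cderivZ (has_cderivM hc' hc').
have h0 : h 0 = 0 by rewrite /h w0 !mulr0 addr0.
pose s0 := Num.min (Num.min (1 / 2) (d / 2)) (1 / (8 * L)).
have s00 : 0 < s0 by rewrite !lt_min !divr_gt0 ?mulr_gt0.
have s0' : s0 <= 1 / 2 /\ s0 <= d / 2 by split; rewrite !ge_min lexx ?orbT.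
exists (N (f 0) `^ p * (40 * p * L ^+ 3)), s0; split => //.
- by rewrite mulr_ge0 ?powR_ge0// mulr_ge0 ?exprn_ge0 ?(ltW L0)// mulr_ge0// ltW.
- by case: s0' => s0'; lra.
move=> s sp ss0; have s1 : 0 < s < 1 by case: s0' => s0'; rewrite sp/=; lra.
have cRh z : N z = s -> ccontinuous_at (Re \o h) z.
  move=> zs; have [c' hc'] : exists c', has_cderiv h z c'.
    by apply: (analyticP _).1 => //; rewrite zs; case/andP: s1.
  exact: ccontinuous_Re hc'.
have := circle_mean_analytic ah s1; rewrite h0 /= => m0.
pose k1 := N (f 0) `^ p * (1 - 40 * p * (L * s) ^+ 3).
pose k2 := N (f 0) `^ p * p.
have -> : N (f 0) `^ p - N (f 0) `^ p * (40 * p * L ^+ 3) * s ^+ 3 =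
    circle_mean (fun z => k1 + k2 * (Re \o h) z) s.
  rewrite circle_meanD ?(ltW sp)//; last 2 first.
  - by move=> z _; exact: ccontinuous_cst.
  - by move=> z /cRh; exact: (@ccontinuousZ _ k2 (Re \o h)).
  rewrite circle_mean_cst (@circle_meanZ _ k2 (Re \o h)) ?(ltW sp)// m0.
  by rewrite mulr0 addr0 /k1; ring.
apply: circle_mean_le; first exact: ltW.
- move=> z /cRh ch; apply: ccontinuousD; first exact: ccontinuous_cst.
  exact: (@ccontinuousZ _ k2 (Re \o h)).
- exact: (cf s s1).
move=> z zs; rewrite fw normcM powRM ?normc_ge0//.
have wL : N (w z) <= L * s.
  have := hd z; rewrite subr0 zs w0 subr0; apply; case: s0' => s0'; lra.
have w8 : N (w z) <= 1 / 8.
  apply: le_trans wL _; rewrite mulrC -ler_pdivlMr//; apply: le_trans ss0 _.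
  rewrite !ge_min; apply/orP; right.
  by rewrite le_eqVlt; apply/orP; left; apply/eqP; field; rewrite gt_eqF.
have := normc1D_powR_ge p0 w8; rewrite -/(h z) => hp.
have -> : k1 + k2 * (Re \o h) z =
    N (f 0) `^ p * (1 - 40 * p * (L * s) ^+ 3 + p * Re (h z)).
  by rewrite /k1 /k2 /=; ring.
rewrite ler_wpM2l ?powR_ge0//; apply: le_trans hp.
have h3 : N (w z) ^+ 3 <= (L * s) ^+ 3.
  by rewrite lerXn2r// nnegrE ?normc_ge0// mulr_ge0// ltW.
have : 40 * p * N (w z) ^+ 3 <= 40 * p * (L * s) ^+ 3.
  by rewrite ler_wpM2l// mulr_ge0// ltW.
lra.
Qed.

(** Rescaling moves the center of the circle to the origin. *)
Lemma submean_abspow (f : C -> C) (p : R) z0 : 0 < p -> analytic_in_disc f ->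
  N z0 < 1 ->
  exists K s0 : R, [/\ 0 <= K, 0 < s0, s0 < 1 - N z0 & forall s, 0 < s -> s <= s0 ->
    N (f z0) `^ p - K * s ^+ 3 <= circle_mean (fun z => N (f (z0 + z)) `^ p) s].
Proof.
move=> p0 af z1; pose h := 1 - N z0; have h0 : 0 < h by rewrite subr_gt0.
have ag : analytic_in_disc (fun z => f (z0 + real_complex R h * z)).
  by apply: analytic_rescale => //; rewrite /h; lra.
have [K [s0 [K0 s00 s01 H]]] := submean_abspow0 p0 ag.
exists (K / h ^+ 3), (s0 * h); split.
- by rewrite divr_ge0// exprn_ge0// ltW.
- by rewrite mulr_gt0.
- by rewrite -/h gtr_pMl.
move=> s sp ss; have := H (s / h); rewrite divr_gt0// ler_pdivrMr// mulr0 addr0.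
move=> /(_ isT ss); rewrite expr_div_n mulrA mulrAC => /le_trans; apply.
rewrite le_eqVlt; apply/orP; left; apply/eqP; rewrite /circle_mean; congr (_ * itg _ _ _).
apply/funext => t; congr (N (f (z0 + _)) `^ _).
by rewrite mulrA -rmorphM/= [h * _]mulrC divfK// gt_eqF.
Qed.

Lemma submean_sum n (f : nat -> C -> C) (p : R) z0 : 0 < p ->
  (forall j, analytic_in_disc (f j)) -> N z0 < 1 ->
  exists K s0 : R, [/\ 0 <= K, 0 < s0, s0 < 1 - N z0 & forall s, 0 < s -> s <= s0 ->
    \sum_(j < n) N (f j z0) `^ p - K * s ^+ 3 <=
      circle_mean (fun z => \sum_(j < n) N (f j (z0 + z)) `^ p) s].
Proof.
move=> p0 af z1.
have cv j z (s : R) : s < 1 - N z0 -> N z = s ->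
    ccontinuous_at (fun z => N (f j (z0 + z)) `^ p) z.
  move=> s1 zs; have zz : N (z0 + z) < 1.
    by apply: le_lt_trans (le_normcD _ _) _; rewrite zs; lra.
  move=> e e0; have [d d0 hd] := ccontinuous_abspow p0 (af j) zz e0.
  exists d => // w wz; apply: hd; apply: le_lt_trans wz.
  by rewrite opprD addrACA subrr add0r.
elim: n => [|n [K [s0 [K0 s00 s01 H]]]].
  exists 0, ((1 - N z0) / 2); split; try lra.
  move=> s sp ss; rewrite big_ord0 mul0r subr0.
  rewrite (_ : (fun _ => _) = fun=> 0) ?circle_mean_cst//.
  by apply/funext => z; rewrite big_ord0.
have [K' [s0' [K0' s00' s01' H']]] := submean_abspow p0 (af n) z1.
exists (K + K'), (Num.min s0 s0'); split.
- exact: addr_ge0.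
- by rewrite lt_min s00.
- by rewrite gt_min s01.
move=> s sp; rewrite le_min => /andP[ss ss'].
have s1 : s < 1 - N z0 by exact: le_lt_trans s01.
rewrite big_ord_recr /= (_ : (fun z => _) = fun z =>
  \sum_(j < n) N (f j (z0 + z)) `^ p + N (f n (z0 + z)) `^ p); last first.
  by apply/funext => z; rewrite big_ord_recr.
rewrite circle_meanD ?(ltW sp)//; last 2 first.
- move=> z zs; apply: (@ccontinuous_sum _ n (fun j w => N (f j (z0 + w)) `^ p)) => j _.
  exact: (cv j z s).
- by move=> z zs; exact: (cv n z s).
by rewrite mulrDl opprD addrACA; apply: lerD; [exact: H|exact: H'].
Qed.

(** Maximum principle. The perturbation [eta |z|^2] has mean excess
    [eta s^2] over a circle of radius [s], which beats the cubic error. *)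
Lemma max_principle n (f : nat -> C -> C) (p rho M : R) : 0 < p ->
  (forall j, analytic_in_disc (f j)) -> 0 <= rho < 1 ->
  (forall w, N w = rho -> \sum_(j < n) N (f j w) `^ p <= M) ->
  forall z, N z <= rho -> \sum_(j < n) N (f j z) `^ p <= M.
Proof.
move=> p0 af /andP[rho0 rho1] bM z1 z1r; rewrite leNgt; apply/negP => Mz1.
pose v z := \sum_(j < n) N (f j z) `^ p.
pose eta := (v z1 - M) / 2.
have eta0 : 0 < eta by rewrite divr_gt0// subr_gt0.
have etaE : v z1 = M + 2 * eta by rewrite /eta; field.
pose v' z := v z + eta * N z ^+ 2.
have cv z : N z < 1 -> ccontinuous_at v z.
  move=> z1'; apply: (@ccontinuous_sum _ n (fun j w => N (f j w) `^ p)) => j _.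
  exact: ccontinuous_abspow.
have csq (z : C) : ccontinuous_at (fun z => N z ^+ 2) z.
  apply/ccontinuousP; have h := @continuous_normc R z.
  exact: (cvgM h h).
have [|z0 z0r hmax] := @cdisc_max R v' rho rho0.
  move=> z zr; apply: ccontinuousD; first by apply: cv; lra.
  exact: ccontinuousZ.
have z0rho : N z0 < rho.
  rewrite lt_neqAle z0r andbT; apply/negP => /eqP z0E.
  have := hmax z1 z1r; have := bM z0 z0E; rewrite /v' -/(v z0).
  have : eta * N z0 ^+ 2 <= eta by rewrite ler_piMr ?(ltW eta0)// expr_le1// ?normc_ge0// ltW// z0E.
  have : 0 <= eta * N z1 ^+ 2 by rewrite mulr_ge0 ?sqr_ge0// ltW.
  by move: etaE; clearbody eta v; lra.
have [|K [s0 [K0 s00 s01 H]]] := @submean_sum n f p z0 p0 af; first lra.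
pose s := Num.min (Num.min s0 (rho - N z0)) (eta / (2 * (K + 1))).
have K1 : 0 < 2 * (K + 1) by lra.
have sp : 0 < s by rewrite !lt_min s00 subr_gt0 z0rho divr_gt0.
have [ss0 srho] : s <= s0 /\ s <= rho - N z0 by split; rewrite !ge_min lexx ?orbT.
have sK : s * (2 * (K + 1)) <= eta by rewrite -ler_pdivlMr// !ge_min lexx orbT.
have {}H := H s sp ss0.
have zz z : N z = s -> N (z0 + z) <= rho.
  by move=> zs; apply: le_trans (le_normcD _ _) _; rewrite zs; lra.
pose l z := 2 * conjc z0 * z.
have al : analytic_in_disc l.
  by apply/analyticP => z _; exists (2 * conjc z0); exact: has_cderiv_scale.
have s1 : 0 < s < 1 by rewrite sp/=; have := normc_ge0 z0; lra.
have cl z : ccontinuous_at (Re \o l) z.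
  exact: ccontinuous_Re (has_cderiv_scale _ _).
have sqE z : N z = s -> N (z0 + z) ^+ 2 = N z0 ^+ 2 + s ^+ 2 + (Re \o l) z.
  move=> zs; rewrite -zs /l /= !normc_sqrE.
  by case: (z0) => a b; case: (z) => x y /=; ring.
have cvz z : N z = s -> ccontinuous_at (fun z => v (z0 + z)) z.
  move=> zs; have z2 : N (z0 + z) < 1 by apply: le_lt_trans (zz z zs) _.
  move=> e e0; have [d d0 hd] := cv _ z2 e e0.
  exists d => // w wz; apply: hd; apply: le_lt_trans wz.
  by rewrite opprD addrACA subrr add0r.
have : circle_mean (fun z => v (z0 + z) + (eta * (N z0 ^+ 2 + s ^+ 2) + eta * (Re \o l) z)) s <= v' z0.
  rewrite -[leRHS](circle_mean_cst _ s); apply: circle_mean_le; first exact: ltW.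
  - move=> z zs; apply: ccontinuousD; first exact: cvz.
    by apply: ccontinuousD; [exact: ccontinuous_cst|apply: ccontinuousZ].
  - by move=> z _; exact: ccontinuous_cst.
  move=> z zs; have := hmax _ (zz z zs); rewrite /v' sqE//; lra.
rewrite circle_meanD ?(ltW sp)//; last first.
  move=> z zs; apply: ccontinuousD; first exact: ccontinuous_cst.
  exact: ccontinuousZ.
rewrite circle_meanD ?(ltW sp)//; last 2 first.
- by move=> z _; exact: ccontinuous_cst.
- by move=> z _; exact: ccontinuousZ.
rewrite circle_mean_cst circle_meanZ ?(ltW sp)// circle_mean_analytic//.
rewrite /l mulr0 /= mulr0 addr0 /v'.
have s3 : K * s ^+ 3 <= eta * s ^+ 2 / 2.
  have -> : K * s ^+ 3 = (s * K) * s ^+ 2 by ring.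
  have -> : eta * s ^+ 2 / 2 = (eta / 2) * s ^+ 2 by ring.
  rewrite ler_wpM2r ?sqr_ge0//; lra.
have : 0 < eta * s ^+ 2 by rewrite mulr_gt0// exprn_gt0.
move: H; rewrite -/(v z0); set m := circle_mean _ s; rewrite mulrDr; lra.
Qed.

End max_principle.
(** ** Averages over rotations *)

Section rotation_means.
Variable R : realType.
Local Notation C := R[i].
Local Notation N := (@normc R).
Variables (f : C -> C) (p : R).
Hypotheses (p0 : 0 < p) (af : analytic_in_disc f).

Definition rot_angle (n : nat) : R := pi *+ 2 / n%:R.

(** Finite averages replace the integral means over circles: they keep the
    maximum principle without an interchange of integrals. *)
Definition rot_mean (n : nat) (z : C) : R :=
  n%:R^-1 * \sum_(j < n) N (f (cis (rot_angle n *+ j) * z)) `^ p.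

Lemma cis_rot_angle n : (0 < n)%N -> cis (rot_angle n *+ n) = 1.
Proof.
by move=> n0; rewrite -mulr_natr divfK ?cis2pi// pnatr_eq0 -lt0n.
Qed.

Lemma rot_mean_rot n k z : (0 < n)%N ->
  rot_mean n (cis (rot_angle n *+ k) * z) = rot_mean n z.
Proof.
move=> n0; elim: k z => [|k IH] z; first by rewrite mulr0n cis0 mul1r.
rewrite mulrS cisD -mulrA (_ : _ * (_ * z) = cis (rot_angle n *+ k) * (cis (rot_angle n) * z)); last first.
  by rewrite mulrCA.
rewrite IH /rot_mean; congr (_ * _).
pose g j := N (f (cis (rot_angle n *+ j) * z)) `^ p.
have e1 : \sum_(j < n.+1) g j = g 0%N + \sum_(j < n) g j.+1 by rewrite big_ord_recl.
have e2 : \sum_(j < n.+1) g j = \sum_(j < n) g j + g n by rewrite big_ord_recr.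
have gn : g n = g 0%N by rewrite /g cis_rot_angle// mulr0n cis0.
transitivity (\sum_(j < n) g j.+1).
  by apply: eq_bigr => j _; rewrite /g mulrA -cisD -mulrSr.
by apply: (addrI (g 0%N)); rewrite -e1 e2 gn addrC.
Qed.

(** The maximum principle bounds the value at [z] by the maximum over the circle
    through [w]. The mean is invariant under rotation by [rot_angle n], and
    rotation by less changes it by at most [e], so on that circle it is constant
    up to [e]. *)
Lemma rot_mean_max rho (e : R) : 0 <= rho < 1 -> 0 < e ->
  exists2 n : nat, (0 < n)%N &
    forall z w, N z <= N w -> N w <= rho -> rot_mean n z <= rot_mean n w + e.
Proof.
move=> /andP[rho0 rho1] e0.
have [|d d0 hd] := @heine_cdisc R (fun z => N (f z) `^ p) rho _ e e0.
  by move=> z zr; apply: ccontinuous_abspow => //; exact: le_lt_trans rho1.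
pose n := (Num.truncn (pi *+ 2 / d)).+1.
have nd : pi *+ 2 / d < n%:R by exact: truncnS_gt.
have n0 : 0 < n%:R :> R by rewrite ltr0n.
have th0 : 0 < rot_angle n by rewrite divr_gt0// pi2_gt0.
have thd : rot_angle n < d by rewrite /rot_angle ltr_pdivrMr// mulrC -ltr_pdivrMr.
exists n => // z w zw wr.
have key w' : N w' = N w -> rot_mean n w' <= rot_mean n w + e.
  move=> w'w; have [w0|w0] := eqVneq w 0.
    by move: w'w; rewrite w0 normc0 => /eq0_normc ->; rewrite lerDl ltW.
  have nw : 0 < N w by rewrite normc_gt0.
  have [phi /andP[phi0 phi1] phiE] : exists2 t, 0 <= t <= pi *+ 2 & w' / w = cis t.
    by apply: unit_cis; rewrite normcM normcV w'w mulfV// gt_eqF.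
  pose k := Num.truncn (phi / rot_angle n).
  pose psi := phi - rot_angle n *+ k.
  have psi_itv : 0 <= psi < rot_angle n.
    have := @truncn_itv R (phi / rot_angle n); rewrite divr_ge0 ?(ltW th0)// => /(_ isT).
    rewrite -/k ler_pdivlMr// ltr_pdivrMr// /psi => /andP[k1 k2].
    rewrite -mulr_natl; move: k2; rewrite -natr1 => k2.
    by apply/andP; split; lra.
  have -> : w' = cis (rot_angle n *+ k) * (cis psi * w).
    by rewrite mulrA -cisD /psi addrC subrK -phiE divfK.
  rewrite rot_mean_rot// /rot_mean.
  have -> : e = n%:R^-1 * \sum_(j < n) e.
    by rewrite sumr_const card_ord -[e *+ n]mulr_natr mulrCA mulVf ?mulr1// gt_eqF.
  rewrite -mulrDr ler_wpM2l ?invr_ge0 ?(ltW n0)// -big_split /=.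
  apply: ler_sum => j _; rewrite -lerBlDl; apply: ltW; apply: le_lt_trans (ler_norm _) _.
  apply: hd; first by rewrite normcM normc_cis mul1r.
  have -> : cis (rot_angle n *+ j) * (cis psi * w) - cis (rot_angle n *+ j) * w =
    cis (rot_angle n *+ j) * ((cis psi - cis 0) * w) by rewrite cis0; ring.
  rewrite !normcM normc_cis mul1r.
  have /andP[psi0 psi1] := psi_itv.
  apply: le_lt_trans (_ : psi * 1 < _); last by rewrite mulr1; exact: lt_trans thd.
  apply: ler_pM; rewrite ?normc_ge0//; last by apply: ltW; exact: le_lt_trans rho1.
  by apply: le_trans (normc_cis_sub_le _ _) _; rewrite subr0 ger0_norm.
have := @max_principle R n (fun j z => f (cis (rot_angle n *+ j) * z)) p (N w)
  (n%:R * (rot_mean n w + e)) p0 _ _ _ z zw.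
have nK v : n%:R * rot_mean n v = \sum_(j < n) N (f (cis (rot_angle n *+ j) * v)) `^ p.
  by rewrite /rot_mean mulrA mulfV ?mul1r// gt_eqF.
rewrite -(nK z) ler_pM2l//; apply.
- by move=> j; apply: analytic_rotate => //; exact: normc_cis.
- by rewrite normc_ge0/=; exact: le_lt_trans rho1.
- by move=> w' /key h; rewrite -nK ler_pM2l.
Qed.

End rotation_means.
(** * Invariances of the area measure *)

Section area_measure.
Variable R : realType.
Local Notation C := R[i].
Local Notation N := (@normc R).
Local Notation leb := (@lebesgue_measure R).
Local Notation plane := (measurableTypeR R * measurableTypeR R)%type.
Local Notation leb2 := ((leb \x leb)%E : set plane -> \bar R).

Lemma measurable_open (U : set C) : open U -> measurable U.
Proof. by move=> oU; exact: sub_sigma_algebra. Qed.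

Lemma measurable_closed (U : set C) : closed U -> measurable U.
Proof.
by move=> cU; rewrite -[U]setCK; apply: measurableC; apply: measurable_open; exact: closed_openC.
Qed.

Lemma openP (U : set C) : (forall z, U z -> exists2 d : R, 0 < d &
  forall w, N (w - z) < d -> U w) -> open U.
Proof.
move=> H; rewrite openE => z /H[d d0 hd]; apply/nbhs_ballP.
exists (real_complex R d) => /=; first by rewrite ltcR.
by move=> w /ball_complexE; rewrite normc_distC; exact: hd.
Qed.

Lemma open_near (U : set C) z : open U -> U z ->
  exists2 d : R, 0 < d & forall w, N (w - z) < d -> U w.
Proof.
move=> oU Uz; have /nbhs_ballP[[d d'] /=] : nbhs z U by exact: open_nbhs_nbhs.
rewrite ltcE /= => /andP[/eqP -> d0] hd; exists d => // w wz.
by apply: hd; apply/ball_complexE; rewrite normc_distC.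
Qed.

Lemma open_disc : open (@disc R).
Proof.
apply: openP => z z1; exists (1 - N z); first by rewrite subr_gt0.
move=> w wz; rewrite /disc /=; have := normc_triang w z 0; rewrite !subr0.
by move/le_lt_trans; apply; rewrite -ltrBrDr.
Qed.

Lemma continuous_measurableC (U : set C) (f : C -> C) : open U ->
  (forall z, U z -> forall e : R, 0 < e -> exists2 d : R, 0 < d &
     forall w, N (w - z) < d -> N (f w - f z) < e) ->
  measurable_fun U f.
Proof.
move=> oU cf; apply: measurability; first by reflexivity.
move=> _ [V oV <-]; apply: measurable_open; apply: openP => z [Uz Vz].
have [e e0 he] := open_near oV Vz; have [d d0 hd] := cf z Uz e e0.
have [d' d'0 hd'] := open_near oU Uz; exists (Num.min d d').
  by rewrite lt_min d0.
by move=> w; rewrite lt_min => /andP[/hd/he ? /hd'].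
Qed.

Lemma analytic_measurable (f : C -> C) : analytic_in_disc f ->
  measurable_fun (@disc R) f.
Proof.
move=> af; apply: continuous_measurableC; first exact: open_disc.
by move=> z z1; exact: analytic_continuous.
Qed.

Lemma lipschitz_measurableC (f : C -> C) (L : R) :
  (forall z w, N (f z - f w) <= L * N (z - w)) -> measurable_fun setT f.
Proof.
move=> Lf; apply: continuous_measurableC; first exact: openT.
move=> z _ e e0; have L1 : 0 < `|L| + 1 by rewrite ltr_pwDr.
exists (e / (`|L| + 1)); first by rewrite divr_gt0.
move=> w wz; apply: le_lt_trans (Lf _ _) _.
apply: le_lt_trans (_ : (`|L| + 1) * N (w - z) < _); last by rewrite mulrC -ltr_pdivlMr.
rewrite ler_wpM2r ?normc_ge0//; apply: le_trans (ler_norm L) _.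
by rewrite lerDl.
Qed.

(** The pushforward with its measure structure, as uniqueness theorems expect it. *)
Definition push_measure d d' (X : measurableType d) (Y : measurableType d')
    (m : {measure set X -> \bar R}) (f : X -> Y) (mf : measurable_fun setT f) :
    {measure set Y -> \bar R} :=
  measure_function_pushforward__canonical__measure_function_Measure m mf.

Definition affine1 (t c : R) (x : measurableTypeR R) : measurableTypeR R :=
  t * x + c.

Definition affine2 (t a b : R) (w : plane) : plane :=
  (t * w.1 + a, t * w.2 + b).

Definition shear (b : R) (w : plane) : plane := (w.1, w.2 + b * w.1).

Definition shear' (b : R) (w : plane) : plane := (w.1 + b * w.2, w.2).

Definition plane_swap (w : plane) : plane := (w.2, w.1).

Lemma measurable_affine1 t c : measurable_fun setT (affine1 t c).
Proof. by apply: measurable_funD => //; exact: measurable_funM. Qed.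

Lemma leb_affine (t c : R) (E : set (measurableTypeR R)) : 0 < t -> measurable E ->
  leb E = (t%:E * leb (affine1 t c @^-1` E))%E.
Proof.
move=> t0 mE; have mphi := measurable_affine1 t c.
have tnng : 0 <= t by exact: ltW.
pose m := mscale (NngNum tnng) (push_measure leb mphi).
apply: (@lebesgue_measure_unique R m) => // _ [[a b] _ <-].
transitivity (t%:E * leb (affine1 t c @^-1` `]a, b]))%E; last by [].
have -> : affine1 t c @^-1` `]a, b] = `](a - c) / t, (b - c) / t]%classic.
  apply/seteqP; split => x; rewrite /= !in_itv /= /affine1 ltr_pdivrMr// ler_pdivlMr//;
    by rewrite ltrBlDr lerBrDr (mulrC x).
rewrite !lebesgue_measure_itv /= !lte_fin ltr_pM2r ?invr_gt0// ltrD2r.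
case: ifP => _; last by rewrite mule0.
by rewrite -!EFinB -EFinM; congr EFin; field; rewrite gt_eqF.
Qed.

Lemma leb2_affine (t a b : R) (E : set plane) : 0 < t -> measurable E ->
  leb2 E = ((t ^+ 2)%:E * leb2 (affine2 t a b @^-1` E))%E.
Proof.
move=> t0 mE; have mphi : measurable_fun setT (affine2 t a b).
  by apply: measurable_fun_pair; apply: measurable_funD => //; exact: measurable_funM.
have t2 : 0 <= t ^+ 2 by exact: sqr_ge0.
pose m := mscale (NngNum t2) (push_measure (leb \x leb)%E mphi).
apply: (@product_measure_unique _ _ _ _ R leb leb m) => // A B mA mB.
transitivity ((t ^+ 2)%:E * leb2 (affine2 t a b @^-1` (A `*` B)))%E; first by [].
have -> : affine2 t a b @^-1` (A `*` B) = (affine1 t a @^-1` A) `*` (affine1 t b @^-1` B).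
  by [].
have mpre c (S : set (measurableTypeR R)) : measurable S ->
    measurable (affine1 t c @^-1` S).
  by move=> mS; rewrite -[X in measurable X]setTI; exact: measurable_affine1.
rewrite product_measure1E; [|exact: mpre..].
rewrite expr2 EFinM muleACA.
by congr (_ * _)%E; apply/esym; [exact: (leb_affine a t0 mA)|exact: (leb_affine b t0 mB)].
Qed.

(** On each vertical line a shear is a translation. *)
Lemma leb2_shear (b : R) (E : set plane) : measurable E ->
  leb2 (shear b @^-1` E) = leb2 E.
Proof.
move=> mE; rewrite /product_measure1; apply: eq_integral => x _ /=.
have /= := leb_affine (b * x) ltr01 (measurable_xsection x mE).
rewrite mul1e => ->; congr (leb _); apply/seteqP.
by split => y; rewrite /xsection /= !inE /affine1 /shear /= mul1r.
Qed.

Lemma leb2_swap (E : set plane) : measurable E ->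
  leb2 (plane_swap @^-1` E) = leb2 E.
Proof.
move=> mE; have ms : measurable_fun setT plane_swap.
  exact: measurable_swap.
apply/esym; apply: (@product_measure_unique _ _ _ _ R leb leb (push_measure (leb \x leb)%E ms)) => // A B mA mB.
rewrite /= /pushforward.
have -> : plane_swap @^-1` (A `*` B) = B `*` A.
  by apply/seteqP; split => w [].
by rewrite product_measure1E// muleC.
Qed.

Lemma measurable_shear (b : R) :
  measurable_fun setT (shear b).
Proof.
apply: measurable_fun_pair; first exact: measurable_fst.
apply: measurable_funD; first exact: measurable_snd.
by apply: measurable_funM => //; exact: measurable_fst.
Qed.

Lemma leb2_shear' (b : R) (E : set plane) : measurable E ->
  leb2 (shear' b @^-1` E) = leb2 E.
Proof.
move=> mE.
have msw : measurable_fun setT plane_swap by exact: measurable_swap.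
have m1 : measurable (plane_swap @^-1` E).
  by rewrite -[X in measurable X]setTI; exact: msw.
have m2 : measurable (shear b @^-1` (plane_swap @^-1` E)).
  by rewrite -[X in measurable X]setTI; exact: measurable_shear.
by rewrite -(leb2_swap mE) -(leb2_shear b m1) -(leb2_swap m2).
Qed.

Lemma areaE (E : set C) : area R E = ((pi^-1)%:E * leb2 (@cplx R @^-1` E))%E.
Proof. by []. Qed.

Lemma measurable_cplx_preimage (E : set C) : measurable E ->
  measurable (@cplx R @^-1` E).
Proof. by move=> mE; rewrite -[X in measurable X]setTI; exact: measurable_cplx. Qed.

Lemma area_affine (t : R) (z0 : C) (E : set C) : 0 < t -> measurable E ->
  area R ((fun z => real_complex R t * z + z0)%R @^-1` E) = ((t ^+ 2)^-1%:E * area R E)%E.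
Proof.
move=> t0 mE; rewrite !areaE.
have t20 : 0 < t ^+ 2 by rewrite exprn_gt0.
rewrite [in RHS](leb2_affine (complex.Re z0) (complex.Im z0) t0 (measurable_cplx_preimage mE)).
rewrite (muleCA (t ^- 2)%:E) (muleA (t ^- 2)%:E) -EFinM mulVf ?gt_eqF// mul1e.
have E2 (w : plane) : real_complex R t * cplx w + z0 =
    cplx (affine2 t (complex.Re z0) (complex.Im z0) w).
  rewrite /cplx /affine2; case: (z0) => a b; apply/eqP.
  by rewrite eq_complex /= !mul0r subr0 addr0 !eqxx.
by congr (_ * leb2 _)%E; apply/seteqP; split => w /=; rewrite E2.
Qed.

(** A rotation other than by [pi] is a product of three shears, and the rotation
    by [pi] is the square of a rotation by [pi / 2]. *)
Lemma area_rotate (u : C) (E : set C) : N u = 1 -> measurable E ->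
  area R ((fun z => u * z)%R @^-1` E) = area R E.
Proof.
have aux (v : C) (F : set C) : N v = 1 -> complex.Re v != -1 -> measurable F ->
    area R ((fun z => v * z) @^-1` F) = area R F.
  case: v => c s v1 /= c1 mF; rewrite !areaE; congr (_ * _)%E.
  have cs : c ^+ 2 + s ^+ 2 = 1.
    by have := normc_sqrE (Complex c s); rewrite v1 expr1n /= => ->.
  have c10 : 1 + c != 0 by rewrite addrC addr_eq0.
  pose al := - s / (1 + c).
  have mG := measurable_cplx_preimage mF.
  pose s1 := shear' al; pose s2 := shear s.
  have ms1 : measurable_fun setT s1.
    apply: measurable_fun_pair; last exact: measurable_snd.
    apply: measurable_funD; first exact: measurable_fst.
    by apply: measurable_funM => //; exact: measurable_snd.
  have m1 : measurable (s1 @^-1` (@cplx R @^-1` F)).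
    by rewrite -[X in measurable X]setTI; exact: ms1.
  have m2 : measurable (s2 @^-1` (s1 @^-1` (@cplx R @^-1` F))).
    by rewrite -[X in measurable X]setTI; exact: measurable_shear.
  rewrite -[RHS](leb2_shear' al mG) -[RHS](leb2_shear s m1) -[RHS](leb2_shear' al m2).
  congr (leb2 _).
  have E2 (w : plane) : Complex c s * cplx w = cplx (s1 (s2 (s1 w))).
    rewrite /cplx /s1 /s2 /shear /shear' /al /=.
    have s2E : s ^+ 2 = (1 + c) * (1 - c) by rewrite -[LHS](addKr (c ^+ 2)) cs; ring.
    apply/eqP; rewrite eq_complex /=; apply/andP; split; apply/eqP.
      transitivity ((1 - s ^+ 2 / (1 + c)) * w.1 + - s * (2 - s ^+ 2 / (1 + c)) / (1 + c) * w.2).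
        by rewrite s2E; field.
      by field.
    transitivity (s * w.1 + (1 - s ^+ 2 / (1 + c)) * w.2).
      by rewrite s2E; field.
    by field.
  by apply/seteqP; split => w /=; rewrite E2.
move=> u1 mE; have [re|re] := eqVneq (complex.Re u) (-1); last exact: aux.
have uE : u = 'i%C * 'i%C.
  have := normc_sqrE u; rewrite u1 expr1n re sqrrN expr1n.
  rewrite -[X in X = _]addr0 => /addrI /esym /eqP; rewrite sqrf_eq0 => /eqP im.
  case: u u1 re im => a b /= _ -> ->.
  by apply/eqP; rewrite eq_complex /= !mul0r !mulr0 mulr1 sub0r addr0 !eqxx.
have i1 : N ('i%C : C) = 1 by rewrite /= expr0n add0r expr1n sqrtr1.
have ir : complex.Re ('i%C : C) != -1 by rewrite /= eq_sym oppr_eq0 oner_eq0.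
rewrite -(aux 'i%C E i1 ir mE).
have mi : measurable ((fun z : C => 'i%C * z) @^-1` E).
  rewrite -[X in measurable X]setTI; apply: (@lipschitz_measurableC _ 1) => //.
  by move=> z w; rewrite -mulrBr normcM i1 !mul1r.
rewrite -[RHS](aux 'i%C _ i1 ir mi); congr (area R _).
by apply/seteqP; split => z /=; rewrite uE mulrA.
Qed.

Lemma integral_area_map (T : C -> C) (k : R) (D : set C) (g : C -> \bar R) :
  measurable_fun setT T -> 0 <= k ->
  (forall E, measurable E -> area R (T @^-1` E) = (k%:E * area R E)%E) ->
  measurable D -> measurable_fun D g -> (forall z, D z -> 0 <= g z)%E ->
  (\int[area R]_(z in T @^-1` D) g (T z) = k%:E * \int[area R]_(z in D) g z)%E.
Proof.
move=> mT k0 H mD mg g0.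
have := @ge0_integral_pushforward _ _ _ _ _ _ mT (area R) D g mD mg.
move=> <-; last by move=> z; rewrite inE; exact: g0.
rewrite -(@ge0_integral_mscale _ _ _ (area R) D mD (NngNum k0))//.
by apply: (@eq_measure_integral _ _ _ _ (mscale (NngNum k0) (area R)) (push_measure (area R) mT)) => A mA _; exact: H.
Qed.

Lemma integral_rotate (u : C) (D : set C) (g : C -> \bar R) : N u = 1 ->
  measurable D -> measurable_fun D g -> (forall z, D z -> 0 <= g z)%E ->
  (forall z, D (u * z) <-> D z) ->
  (\int[area R]_(z in D) g (u * z)%R = \int[area R]_(z in D) g z)%E.
Proof.
move=> u1 mD mg g0 Du.
have mT : measurable_fun setT (fun z : C => u * z).
  by apply: (@lipschitz_measurableC _ 1) => z w; rewrite -mulrBr normcM u1.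
have := integral_area_map mT ler01 _ mD mg g0.
rewrite mul1e => <-; last by move=> E mE; rewrite mul1e; exact: area_rotate.
by congr (integral _ _ _); apply/seteqP; split => z /Du.
Qed.

End area_measure.
(** ** Mass of radial sets *)

Section radial_density.
Variable R : realType.
Local Notation C := R[i].
Local Notation N := (@normc R).
Local Notation leb := (@lebesgue_measure R).

Definition annulus (s t : R) : set C := [set z | s <= N z < t].

Lemma measurable_annulus s t : measurable (annulus s t).
Proof.
have -> : annulus s t = setT `&` N @^-1` `[s, t[.
  by apply/seteqP; split => [z /= ?|z [_]]; rewrite /annulus /= in_itv.
by apply: measurable_normc => //; exact: measurable_itv.
Qed.

(** Kept as an abstract constant: squares inside and around the disc show that it
    is positive and finite, and no double integral has to be evaluated. *)
Definition unit_area : R := fine (area R (@cdisc R 1)).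

Lemma measurable_cdisc t : measurable (@cdisc R t).
Proof. by apply: measurable_closed; exact: closed_cdisc. Qed.

Lemma area_unit_disc : area R (@cdisc R 1) = unit_area%:E /\ 0 < unit_area.
Proof.
have pi0 : 0 < (pi : R)^-1 by rewrite invr_gt0 pi_gt0.
have box (a : R) : 0 < a -> (leb \x leb)%E (`[- a, a]%classic `*` `[- a, a]%classic) = ((a + a) * (a + a))%:E.
  move=> a0; rewrite product_measure1E//= lebesgue_measure_itv /= lte_fin.
  have -> : - a < a by lra.
  by rewrite -EFinB -EFinM opprK.
have up : (area R (@cdisc R 1) <= ((pi : R)^-1 * 4)%:E)%E.
  rewrite areaE EFinM; apply: lee_pmul => //; first by rewrite lee_fin ltW.
  have -> : 4%:E = ((1 + 1) * (1 + 1) : R)%:E by congr EFin; ring.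
  rewrite -box//; apply: le_measure; rewrite ?inE.
  - exact: measurable_cplx_preimage (measurable_cdisc 1).
  - by apply: measurableX; exact: measurable_itv.
  move=> [x y] /= xy; split => /=; rewrite in_itv /= -ler_norml.
    exact: le_trans (Defs.normc_ge_Re (cplx (x, y))) xy.
  exact: le_trans (Defs.normc_ge_Im (cplx (x, y))) xy.
have lo : ((pi : R)^-1%:E * ((1 / 2 + 1 / 2) * (1 / 2 + 1 / 2) : R)%:E <= area R (@cdisc R 1))%E.
  rewrite areaE; apply: lee_pmul => //; try by rewrite lee_fin; lra.
  rewrite -box; last by lra.
  apply: le_measure; rewrite ?inE.
  - by apply: measurableX; exact: measurable_itv.
  - exact: measurable_cplx_preimage (measurable_cdisc 1).
  move=> [x y] [] /=; rewrite !in_itv /= -!ler_norml => x2 y2.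
  by apply: le_trans (normc_le_ReIm (cplx (x, y))) _ => /=; lra.
have fin : area R (@cdisc R 1) \is a fin_num.
  by rewrite ge0_fin_numE//; apply: le_lt_trans up _; rewrite ltry.
split; first by rewrite /unit_area fineK.
rewrite -lte_fin /unit_area fineK//; apply: lt_le_trans lo.
by rewrite -EFinM lte_fin; apply: mulr_gt0 => //; lra.
Qed.

(** Homotheties scale the area by the square of their ratio. *)
Lemma area_cdisc t : 0 <= t -> area R (@cdisc R t) = (unit_area * t ^+ 2)%:E.
Proof.
have [aE a0] := area_unit_disc.
have pos (u : R) : 0 < u -> area R (@cdisc R u) = (unit_area * u ^+ 2)%:E.
  move=> u0; have ui : 0 < u^-1 by rewrite invr_gt0.
  have -> : @cdisc R u = (fun z => real_complex R u^-1 * z + 0) @^-1` (@cdisc R 1).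
    apply/seteqP; split => z; rewrite /cdisc /= addr0 -/(normc _) normcM normc_real ger0_norm ?(ltW ui)//;
      by rewrite ler_pdivrMl// mulr1.
  rewrite (area_affine 0 ui (measurable_cdisc 1)) aE -EFinM exprVn invrK.
  by rewrite mulrC.
rewrite le_eqVlt => /predU1P[<-|]; last exact: pos.
rewrite expr0n mulr0; apply/eqP; rewrite eq_le measure_ge0 andbT.
apply/lee_addgt0Pr => e e0; rewrite add0e.
pose u := Num.min 1 (e / unit_area).
have u0 : 0 < u by rewrite lt_min ltr01 divr_gt0.
apply: le_trans (_ : area R (@cdisc R u) <= _)%E.
  apply: le_measure; rewrite ?inE; [exact: measurable_cdisc..|].
  by move=> z; rewrite /cdisc /= => /le_trans; apply; exact: ltW.
rewrite pos// lee_fin -ler_pdivlMl// mulrC.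
have u1 : u <= 1 by rewrite ge_min lexx.
apply: le_trans (_ : u * 1 <= _); first by rewrite expr2 ler_wpM2l// ltW.
by rewrite mulr1 ge_min lexx orbT.
Qed.

(** The image of the area measure under the modulus is [2 k r dr]. *)
Definition radial_measure (E : set (measurableTypeR R)) : \bar R :=
  (\int[leb]_(x in E) (2 * unit_area * Num.max x 0)%:E)%E.

Lemma radial_density_ge0 (x : R) : (0 <= (2 * unit_area * Num.max x 0)%:E)%E.
Proof.
have [_ a0] := area_unit_disc.
by rewrite lee_fin mulr_ge0 ?mulr_ge0 ?(ltW a0)// le_max lexx orbT.
Qed.

Lemma measurable_radial_density (E : set (measurableTypeR R)) :
  measurable_fun E (fun x : measurableTypeR R => (2 * unit_area * Num.max x 0)%:E).
Proof.
apply: measurable_funTS; apply/measurable_EFinP; apply: measurable_funM => //.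
by apply: measurable_maxr => //; exact: measurable_id.
Qed.

Let radial_measure0 : radial_measure set0 = 0%E.
Proof. by rewrite /radial_measure integral_set0. Qed.

Let radial_measure_ge0 E : (0 <= radial_measure E)%E.
Proof. by apply: integral_ge0 => x _; exact: radial_density_ge0. Qed.

Let radial_measure_sigma_additive : semi_sigma_additive radial_measure.
Proof.
move=> F mF tF mUF; rewrite /radial_measure ge0_integral_bigcup//.
- by apply: is_cvg_ereal_nneg_natsum_cond => n _ _; exact: radial_measure_ge0.
- exact: measurable_radial_density.
- by move=> x _; exact: radial_density_ge0.
Qed.

HB.instance Definition _ := isMeasure.Build _ _ _ radial_measure
  radial_measure0 radial_measure_ge0 radial_measure_sigma_additive.

Lemma sqr_max_derive (x : R) :
  is_derive x 1 (fun y : R => unit_area * Num.max y 0 ^+ 2) (2 * unit_area * Num.max x 0).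
Proof.
have [_ a0] := area_unit_disc.
apply: real_is_derive => e e0; exists (e / unit_area); first by rewrite divr_gt0.
move=> y ye.
have h : `|Num.max y 0 ^+ 2 - Num.max x 0 ^+ 2 - 2 * Num.max x 0 * (y - x)| <= `|y - x| * `|y - x|.
  rewrite -normrM ler_norml (ger0_norm (_ : 0 <= (y - x) * (y - x))) -?expr2 ?sqr_ge0//.
  have d2 := sqr_ge0 (y - x); have x2 := sqr_ge0 x; have y2 := sqr_ge0 y.
  have [x0|x0] := leP 0 x; have [y0|y0] := leP 0 y; apply/andP; split; try lra.
    by have := mulr_ge0_le0 x0 (ltW y0); lra.
  by have := mulr_le0_ge0 (ltW x0) y0; lra.
have -> : unit_area * Num.max y 0 ^+ 2 - unit_area * Num.max x 0 ^+ 2 -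
   2 * unit_area * Num.max x 0 * (y - x) =
   unit_area * (Num.max y 0 ^+ 2 - Num.max x 0 ^+ 2 - 2 * Num.max x 0 * (y - x)) by ring.
rewrite normrM (gtr0_norm a0).
apply: le_trans (ler_wpM2l (ltW a0) h) _; rewrite mulrA ler_wpM2r//.
by move: ye; rewrite ltr_pdivlMr// mulrC => /ltW.
Qed.

Lemma radial_measure_itv (a b : R) : a < b ->
  radial_measure `]a, b] =
    (unit_area * Num.max b 0 ^+ 2 - unit_area * Num.max a 0 ^+ 2)%:E.
Proof.
move=> ab; rewrite /radial_measure integral_itv_obnd_cbnd; last exact: measurable_radial_density.
have dF x := sqr_max_derive x.
have cF : continuous (fun y : R => unit_area * Num.max y 0 ^+ 2).
  move=> x; apply: differentiable_continuous; apply/derivable1_diffP.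
  by have [] := dF x.
rewrite (@continuous_FTC2 _ _ (fun y : R => unit_area * Num.max y 0 ^+ 2))//.
- apply: continuous_subspaceT => x; apply: cvgM; first exact: cvg_cst.
  by apply: continuous_max; [exact: cvg_id|exact: cvg_cst].
- split.
  + by move=> x _; have [] := dF x.
  + by apply: cvg_at_right_filter; exact: cF.
  + by apply: cvg_at_left_filter; exact: cF.
- by move=> x _; rewrite derive1E; have [_ ->] := dF x.
Qed.

Lemma area_annulus_oc (a b : R) : a < b ->
  area R (N @^-1` `]a, b]) =
  (unit_area * Num.max b 0 ^+ 2 - unit_area * Num.max a 0 ^+ 2)%:E.
Proof.
move=> ab; have [a0|a0] := leP 0 a.
  have b0 : 0 <= b by apply: le_trans a0 (ltW ab).
  have -> : N @^-1` `]a, b] = @cdisc R b `\` @cdisc R a.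
    apply/seteqP; split => z; rewrite /cdisc /= in_itv /=.
      by move=> /andP[az zb]; split => //; apply/negP; rewrite -ltNge.
    by move=> [zb /negP]; rewrite -ltNge => ->.
  rewrite measureD/=; [|exact: measurable_cdisc..|].
    rewrite setIidr; last by move=> z; rewrite /cdisc /= => /le_trans; apply; exact: ltW.
    by rewrite !area_cdisc// EFinB (max_l b0).
  by rewrite area_cdisc// ltry.
have [b0|b0] := leP 0 b.
  have -> : N @^-1` `]a, b] = @cdisc R b.
    apply/seteqP; split => z; rewrite /cdisc /= in_itv /=; first by case/andP.
    by move=> ->; rewrite andbT; apply: lt_le_trans a0 (normc_ge0 z).
  by rewrite area_cdisc// expr0n mulr0 subr0.
have -> : N @^-1` `]a, b] = set0.
  apply/seteqP; split => z //=; rewrite in_itv /= => /andP[_ zb].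
  by have := le_lt_trans (normc_ge0 z) (le_lt_trans zb b0); rewrite ltxx.
by rewrite measure0 subrr.
Qed.

Lemma area_radial (E : set (measurableTypeR R)) : measurable E ->
  area R (N @^-1` E) = radial_measure E.
Proof.
move=> mE.
have mN : measurable_fun setT (N : C -> measurableTypeR R) by exact: measurable_normc.
pose m := push_measure (area R) mN.
pose G : set (set (measurableTypeR R)) := @ocitv R.
apply: (@measure_unique _ R (measurableTypeR R) G
  (fun n => `](- n%:R : R), (n%:R : R)]%classic) _ _ _ _ m) => //.
- exact: ocitvI.
- by move=> n; exact: is_ocitv.
- apply/seteqP; split => // x _; exists (Num.truncn `|x|).+1 => //=.
  have := truncnS_gt `|x|; rewrite in_itv /= ltr_norml => /andP[-> /ltW ->] //.
- move=> X /ocitvP[->|[[a b] /= ab ->]]; first by rewrite !measure0.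
  by rewrite radial_measure_itv//; exact: area_annulus_oc.
- move=> n; have [n0|n0] := leP (n%:R : R) (- n%:R).
    by rewrite set_itv_ge ?bnd_simp -?leNgt// measure0 ltry.
  rewrite (_ : m _ = area R (N @^-1` `](- n%:R), n%:R])) // area_annulus_oc//.
  by rewrite ltry.
Qed.

Section radial_integral.
Variables (om : R -> R) (s t : R).
Hypotheses (s0 : 0 <= s) (t1 : t <= 1)
  (om0 : forall x, s <= x < t -> 0 <= om x)
  (mom : measurable_fun (`[s, t[ : set (measurableTypeR R)) om).

Let D : set (measurableTypeR R) := `[s, t[.

Let mD : measurable D. Proof. exact: measurable_itv. Qed.

Let omD : {in D, forall x, (0 <= (om x)%:E)%E}.
Proof. by move=> x; rewrite inE /D /= in_itv /= lee_fin; exact: om0. Qed.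

Lemma integral_annulus :
  (\int[area R]_(z in annulus s t) (om (N z))%:E =
   \int[radial_measure]_(x in D) (om x)%:E)%E.
Proof.
have mN : measurable_fun setT (N : C -> measurableTypeR R) by exact: measurable_normc.
have mo : measurable_fun D (EFin \o om) by apply/measurable_EFinP.
have := ge0_integral_pushforward mN (area R) mD mo omD.
have -> : N @^-1` D = annulus s t.
  by apply/seteqP; split => z; rewrite /annulus /D /= in_itv.
move=> <-; apply: (@eq_measure_integral _ _ _ _ radial_measure (push_measure (area R) mN)) => A mA _.
exact: area_radial.
Qed.

Let om' := (EFin \o om) \_ D.

Let om'0 x : (0 <= om' x)%E.
Proof.
by rewrite /om' patchE; case: ifPn => [xD|//]; exact: omD.
Qed.

Let mom' : measurable_fun setT om'.
Proof. by apply/(measurable_restrictT _ mD); exact/measurable_EFinP. Qed.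

Let om'E (m : {measure set (measurableTypeR R) -> \bar R}) :
  (\int[m]_(x in D) (om x)%:E = \int[m]_(x in D) om' x)%E.
Proof. by apply: eq_integral => x xD; rewrite /om' patchE xD. Qed.

Lemma integral_annulus_le : (\int[area R]_(z in annulus s t) (om (N z))%:E <=
  (2 * unit_area)%:E * \int[leb]_(x in D) (om x)%:E)%E.
Proof.
have [_ a0] := area_unit_disc.
have k0 : 0 <= 2 * unit_area by rewrite mulr_ge0// ltW.
rewrite integral_annulus -(@ge0_integral_mscale _ _ _ leb D mD (NngNum k0)); last 2 first.
- by apply/measurable_EFinP.
- by move=> x xD; apply: omD; rewrite inE.
rewrite !om'E.
pose m1 : {measure set (measurableTypeR R) -> \bar R} := mrestr radial_measure mD.
rewrite (@eq_measure_integral _ _ _ _ m1 radial_measure); last first.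
  by move=> A mA AD; transitivity (radial_measure (A `&` D)); [rewrite setIidl|].
apply: ge0_le_measure_integral => // A mA.
rewrite [X in (X <= _)%E](_ : _ = radial_measure (A `&` D)) //.
apply: (@le_trans _ _ ((2 * unit_area)%:E * leb (A `&` D))%E); last first.
  rewrite [X in (_ <= X)%E](_ : _ = (2 * unit_area)%:E * leb A)%E//.
  have h : (leb (A `&` D) <= leb A)%E.
    by apply: le_measure; rewrite ?inE; [exact: measurableI|exact: mA|exact: subIsetl].
  by apply: lee_pmul => //; rewrite lee_fin.
have mAD : measurable (A `&` D) by exact: measurableI.
rewrite /radial_measure -integral_cst//; apply: ge0_le_integral => //.
- by move=> x _; exact: radial_density_ge0.
- exact: measurable_radial_density.
- move=> x [_]; rewrite /D /= in_itv /= => /andP[sx xt].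
  rewrite lee_fin ler_piMr//; rewrite ge_max ler01 andbT.
  by apply: ltW; exact: lt_le_trans xt t1.
Qed.

Lemma integral_annulus_ge : 1 / 2 <= s ->
  (unit_area%:E * \int[leb]_(x in D) (om x)%:E <=
   \int[area R]_(z in annulus s t) (om (N z))%:E)%E.
Proof.
move=> s2; have [_ a0] := area_unit_disc.
have k0 : 0 <= unit_area by rewrite ltW.
rewrite integral_annulus -(@ge0_integral_mscale _ _ _ leb D mD (NngNum k0)); last 2 first.
- by apply/measurable_EFinP.
- by move=> x xD; apply: omD; rewrite inE.
rewrite !om'E.
pose m2 : {measure set (measurableTypeR R) -> \bar R} := mscale (NngNum k0) leb.
pose m1 : {measure set (measurableTypeR R) -> \bar R} := mrestr m2 mD.
rewrite (@eq_measure_integral _ _ _ _ m1 m2); last first.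
  by move=> A mA AD; transitivity (m2 (A `&` D)); [rewrite setIidl|].
apply: ge0_le_measure_integral => // A mA.
rewrite [X in (X <= _)%E](_ : _ = unit_area%:E * leb (A `&` D))%E //.
have mAD : measurable (A `&` D) by exact: measurableI.
apply: (@le_trans _ _ (radial_measure (A `&` D))); last first.
  by apply: le_measure; rewrite ?inE//; exact: subIsetl.
rewrite /radial_measure -integral_cst//; apply: ge0_le_integral => //.
- exact: measurable_radial_density.
- move=> x [_]; rewrite /D /= in_itv /= => /andP[sx xt].
  have x0 : 0 <= x by exact: le_trans sx.
  by rewrite lee_fin (max_l x0); nra.
Qed.

End radial_integral.

End radial_density.
(** * Averages of subharmonic functions over annuli *)

Section mean_values.
Variable R : realType.
Local Notation C := R[i].
Local Notation N := (@normc R).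

Lemma annulus_disc s t : t <= 1 -> annulus s t `<=` @disc R.
Proof. by move=> t1 z /andP[_ /lt_le_trans]; exact. Qed.

Lemma annulus_rot s t (u z : C) : N u = 1 -> annulus s t (u * z) <-> annulus s t z.
Proof. by move=> u1; rewrite /annulus /= -!/(normc _) normcM u1 mul1r. Qed.

Lemma measurable_abspow (f : C -> C) (p : R) : analytic_in_disc f ->
  measurable_fun (@disc R) (fun z => N (f z) `^ p).
Proof.
move=> af; apply: (measurableT_comp (measurable_powR p)).
apply: (measurableT_comp (@measurable_normc R)).
exact: analytic_measurable.
Qed.

Section rotation_invariance.
Variables (f : C -> C) (p : R) (phi : R -> R) (D : set C).
Hypotheses (p0 : 0 < p) (af : analytic_in_disc f) (mD : measurable D)
  (D1 : D `<=` @disc R) (Drot : forall u z : C, N u = 1 -> D (u * z) <-> D z)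
  (phi0 : forall z, D z -> 0 <= phi (N z))
  (mphi : measurable_fun D (fun z => phi (N z))).

Let term_rot (u : C) := fun z => (N (f (u * z)) `^ p * phi (N z))%:E.

Lemma measurable_rot_term (u : C) : N u = 1 -> measurable_fun D (term_rot u).
Proof.
move=> u1; apply/measurable_EFinP; apply: measurable_funM => //.
apply: (measurable_funS (@measurable_disc R)) => //.
exact: (measurable_abspow p (analytic_rotate u1 af)).
Qed.

Lemma integral_rot_term (u : C) : N u = 1 ->
  (\int[area R]_(z in D) (N (f (u * z)%R) `^ p * phi (N z))%:E =
   \int[area R]_(z in D) (N (f z) `^ p * phi (N z))%:E)%E.
Proof.
move=> u1; pose g z := (N (f z) `^ p * phi (N z))%:E.
have mg : measurable_fun D g.
  have := measurable_rot_term (normc1 R).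
  by congr measurable_fun; apply/funext => z; rewrite /term_rot mul1r.
have g0 z : D z -> (0 <= g z)%E.
  by move=> /phi0 h; rewrite lee_fin mulr_ge0 ?powR_ge0.
rewrite -[RHS](integral_rotate u1 mD mg g0 (fun z => Drot z u1)).
by apply: eq_integral => z _; rewrite /g normcM u1 mul1r.
Qed.

Lemma measurable_rot_mean n : measurable_fun D (fun z => (rot_mean f p n z * phi (N z))%:E).
Proof.
apply/measurable_EFinP; apply: measurable_funM => //; apply: measurable_funM => //.
apply: (measurable_funS (@measurable_disc R)) => //.
apply: measurable_sum => j; apply: (measurable_abspow p).
by apply: analytic_rotate => //; exact: normc_cis.
Qed.

Lemma integral_rot_mean n : (0 < n)%N ->
  (\int[area R]_(z in D) (rot_mean f p n z * phi (N z))%:E =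
   \int[area R]_(z in D) (N (f z) `^ p * phi (N z))%:E)%E.
Proof.
move=> n0; have n0' : 0 < n%:R :> R by rewrite ltr0n.
set I := RHS.
transitivity (\int[area R]_(z in D) ((n%:R^-1)%:E *
    \sum_(j < n) term_rot (cis (rot_angle R n *+ j)) z))%E.
  apply: eq_integral => z _; rewrite /rot_mean /term_rot sumEFin -EFinM.
  by congr EFin; rewrite -mulr_suml mulrA.
have t0 (j : 'I_n) z : D z -> (0 <= term_rot (cis (rot_angle R n *+ j)) z)%E.
  by move=> /phi0 h; rewrite lee_fin mulr_ge0 ?powR_ge0.
rewrite ge0_integralZl_EFin//; last 2 first.
- by move=> z Dz; apply: sume_ge0 => j _; exact: t0.
- by apply: emeasurable_sum => j; apply: measurable_rot_term; exact: normc_cis.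
rewrite ge0_integral_sum//; last by move=> j; apply: measurable_rot_term; exact: normc_cis.
rewrite (eq_bigr (fun=> I)); last by move=> j _; apply: integral_rot_term; exact: normc_cis.
have : (0 <= I)%E.
  by apply: integral_ge0 => z /phi0 h; rewrite lee_fin mulr_ge0 ?powR_ge0.
case: I => [r| |] // _.
  rewrite sumEFin sumr_const card_ord -EFinM -[r *+ n]mulr_natr mulrCA mulVf ?mulr1//.
  by rewrite gt_eqF.
have -> : (\sum_(i < n) +oo = +oo :> \bar R)%E.
  case: n n0 {n0' t0} => // n _; apply/eqP; rewrite -leye_eq big_ord_recl.
  by apply: leeDl; apply: sume_ge0.
by rewrite gt0_muley// lte_fin invr_gt0.
Qed.

End rotation_invariance.

(** Value at a point against an average over an outer annulus, up to a
    rotation of the point and an arbitrarily small error. *)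
Lemma rot_mean_le_annulus (f : C -> C) (p : R) (phi : R -> R) (s t w F e : R) :
  0 < p -> analytic_in_disc f -> 0 <= t < 1 -> 0 < e ->
  (forall x, s <= x < t -> 0 <= phi x) ->
  measurable_fun (annulus s t) (fun z => phi (N z)) ->
  (\int[area R]_(z in annulus s t) (phi (N z))%:E = w%:E)%E ->
  (\int[area R]_(z in annulus s t) (N (f z) `^ p * phi (N z))%:E <= F%:E)%E ->
  exists2 n : nat, (0 < n)%N &
    forall z, N z <= s -> rot_mean f p n z * w <= F + e * w.
Proof.
move=> p0 af t01 e0 phi0 mphi wE FE.
have [n n0 hn] := rot_mean_max p0 af t01 e0; exists n => // z zs.
have /andP[t0 t1] := t01.
have mA := @measurable_annulus R s t.
have pz z' : annulus s t z' -> 0 <= phi (N z') by exact: phi0.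
have An1 : annulus s t `<=` @disc R by apply: annulus_disc; exact: ltW.
have Ar := fun u z => @annulus_rot s t u z.
have mean0 z' : 0 <= rot_mean f p n z'.
  by rewrite /rot_mean mulr_ge0 ?invr_ge0//; apply: sumr_ge0 => j _; exact: powR_ge0.
rewrite -lee_fin EFinM -wE -ge0_integralZl_EFin//; last by apply/measurable_EFinP.
apply: (@le_trans _ _ (\int[area R]_(z' in annulus s t)
    ((rot_mean f p n z' * phi (N z'))%:E + e%:E * (phi (N z'))%:E))%E).
  apply: ge0_le_integral => //.
  - by move=> z' /pz h; rewrite -EFinM lee_fin mulr_ge0.
  - by apply: measurable_funeM; apply/measurable_EFinP.
  - apply: emeasurable_funD; last by apply: measurable_funeM; apply/measurable_EFinP.
    exact: measurable_rot_mean.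
  - move=> z' Az'; rewrite -!EFinM -EFinD lee_fin -mulrDl ler_wpM2r ?pz//.
    by have /andP[sz zt] := Az'; apply: hn; [exact: le_trans sz|exact: ltW].
rewrite ge0_integralD//; last 4 first.
- by move=> z' /pz h; rewrite lee_fin mulr_ge0.
- exact: measurable_rot_mean.
- by move=> z' /pz h; rewrite -EFinM lee_fin mulr_ge0// ltW.
- by apply: measurable_funeM; apply/measurable_EFinP.
rewrite integral_rot_mean// EFinD leeD//.
rewrite ge0_integralZl_EFin// ?wE -?EFinM//.
- by apply/measurable_EFinP.
- exact: ltW.
Qed.

(** Integrating [rot_mean_le_annulus] over a rotation invariant set removes the
    rotations from both sides. *)
Lemma average_le_annulus (f : C -> C) (p : R) (phi : R -> R) (A : set C)
    (al s t w F : R) :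
  0 < p -> analytic_in_disc f -> 0 <= t < 1 -> 0 < w ->
  (forall x, s <= x < t -> 0 <= phi x) ->
  measurable_fun (annulus s t) (fun z => phi (N z)) ->
  (\int[area R]_(z in annulus s t) (phi (N z))%:E = w%:E)%E ->
  (\int[area R]_(z in annulus s t) (N (f z) `^ p * phi (N z))%:E <= F%:E)%E ->
  measurable A -> A `<=` @disc R ->
  (forall z, A z -> N z <= s) ->
  (forall u z : C, N u = 1 -> A (u * z) <-> A z) ->
  (area R A <= al%:E)%E ->
  (\int[area R]_(z in A) (N (f z) `^ p)%:E <= (al * (F / w))%:E)%E.
Proof.
move=> p0 af t01 w0 phi0 mphi wE FE mA A1 As Arot Aal.
have al0 : 0 <= al by rewrite -lee_fin; apply: le_trans Aal.
have F0 : 0 <= F.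
  rewrite -lee_fin; apply: le_trans FE; apply: integral_ge0 => z Az.
  by rewrite lee_fin mulr_ge0 ?powR_ge0// phi0.
apply/lee_addgt0Pr => e e0; rewrite -EFinD.
have e1 : 0 < e / (al + 1) by rewrite divr_gt0// ltr_pwDr.
have [n n0 hn] := rot_mean_le_annulus p0 af t01 e1 phi0 mphi wE FE.
have -> : (\int[area R]_(z in A) (N (f z) `^ p)%:E =
   \int[area R]_(z in A) (rot_mean f p n z * (fun=> 1) (N z))%:E)%E.
  rewrite (@integral_rot_mean f p (fun=> 1))//.
  by apply: eq_integral => z _; rewrite mulr1.
apply: (@le_trans _ _ (\int[area R]_(z in A) (F / w + e / (al + 1))%:E)%E).
  apply: ge0_le_integral => //.
  - move=> z _; rewrite lee_fin mulr1 /rot_mean mulr_ge0 ?invr_ge0//.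
    by apply: sumr_ge0 => j _; exact: powR_ge0.
  - by apply: (@measurable_rot_mean f p (fun=> 1)).
  - move=> z Az; rewrite lee_fin mulr1.
    have := hn z (As z Az); rewrite -ler_pdivlMr//.
    by rewrite mulrDl mulfK// gt_eqF.
rewrite integral_cst// muleC.
apply: (@le_trans _ _ (al%:E * (F / w + e / (al + 1))%:E)%E).
  rewrite lee_wpmul2r// lee_fin addr_ge0//; last exact: ltW.
  by rewrite divr_ge0// ltW.
rewrite -EFinM lee_fin mulrDr lerD2l mulrCA ler_piMr ?(ltW e0)//.
by rewrite ler_pdivrMr ?mul1r ?lerDl// ltr_pwDr.
Qed.

(** [rot_mean_le_annulus] at the center of a rescaled disc, where all the rotated
    values coincide. *)
Lemma local_mean (f : C -> C) (p : R) z0 (h F : R) :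
  0 < p -> analytic_in_disc f -> 0 < h -> N z0 + 2 * h <= 1 ->
  (\int[area R]_(z in [set z | (N (z - z0) < h)%R]) (N (f z) `^ p)%:E <= F%:E)%E ->
  N (f z0) `^ p * (unit_area R / 4 * h ^+ 2) <= F.
Proof.
move=> p0 af h0 zh FE.
have h20 : 0 < 2 * h by rewrite mulr_gt0.
have ag := analytic_rescale (ltW h20) zh af.
set g := (fun z => _) in ag.
have [_ k0] := area_unit_disc R.
have t01 : (0 <= (1 / 2 : R)) && ((1 / 2 : R) < 1) by apply/andP; split; lra.
have mA := @measurable_annulus R 0 (1 / 2).
have [w [wE w0]] : exists w, area R (annulus 0 (1 / 2)) = w%:E /\ unit_area R / 16 <= w.
  have up : (area R (annulus 0 (1 / 2)) <= (unit_area R * (1 / 2) ^+ 2)%:E)%E.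
    rewrite -area_cdisc//; apply: le_measure; rewrite ?inE//; first exact: measurable_cdisc.
    by move=> z /andP[_ /ltW].
  have lo : ((unit_area R * (1 / 4) ^+ 2)%:E <= area R (annulus 0 (1 / 2)))%E.
    rewrite -area_cdisc//; apply: le_measure; rewrite ?inE//; first exact: measurable_cdisc.
    by move=> z zr; rewrite /annulus /mkset normc_ge0 /=; apply: le_lt_trans zr _; lra.
  have fin : area R (annulus 0 (1 / 2)) \is a fin_num.
    by rewrite ge0_fin_numE//; apply: le_lt_trans up _; rewrite ltry.
  exists (fine (area R (annulus 0 (1 / 2)))); rewrite fineK//; split => //.
  by rewrite -lee_fin fineK//; apply: le_trans lo; rewrite lee_fin; lra.
have w0' : 0 < w by apply: lt_le_trans w0; rewrite divr_gt0.
pose D := [set z : C | N (z - z0) < h].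
have mD : measurable D.
  apply: measurable_open; apply: openP => z zD; exists (h - N (z - z0)); first by rewrite subr_gt0.
  by move=> v vz; rewrite /D /=; apply: le_lt_trans (normc_triang v z z0) _; rewrite -ltrBrDr.
have D1 : D `<=` @disc R.
  move=> z zD; rewrite /disc /=; have := normc_subD z z0; rewrite /D /= in zD.
  move=> q; have nz := normc_ge0 z0; lra.
pose T z := real_complex R (2 * h) * z + z0.
have mT : measurable_fun setT T.
  apply: (@lipschitz_measurableC _ _ (2 * h)) => z v.
  rewrite /T opprD addrACA subrr addr0 -mulrBr normcM normc_real ger0_norm//.
  exact: ltW.
have TD : T @^-1` D = annulus 0 (1 / 2).
  apply/seteqP; split => z; rewrite /D /annulus /T /mkset /preimage /= addrK.
    rewrite -!/(normc _) normcM normc_real gtr0_norm// normc_ge0/=.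
    by move=> q; rewrite -(ltr_pM2l h20); lra.
  rewrite -!/(normc _) normcM normc_real gtr0_norm// => /andP[_].
  by rewrite -(ltr_pM2l h20); lra.
have i0 : 0 <= ((2 * h) ^+ 2)^-1 by rewrite invr_ge0 sqr_ge0.
have mf : measurable_fun D (fun z => (N (f z) `^ p)%:E).
  apply/measurable_EFinP; apply: (measurable_funS (@measurable_disc R)) => //.
  exact: measurable_abspow.
have := integral_area_map mT i0 (fun E mE => area_affine z0 h20 mE) mD mf.
rewrite TD => gE; have {}gE := gE (fun z _ => powR_ge0 _ _).
have F0 : 0 <= F.
  by rewrite -lee_fin; apply: le_trans FE; apply: integral_ge0 => z _; rewrite lee_fin powR_ge0.
have gF : (\int[area R]_(z in annulus 0 (1 / 2)) (N (g z) `^ p * (fun=> 1) (N z))%:E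
    <= (((2 * h) ^+ 2)^-1 * F)%:E)%E.
  under eq_integral => z _ do rewrite mulr1 /g addrC -/(T z).
  by rewrite gE EFinM lee_wpmul2l// lee_fin.
have wE' : (\int[area R]_(z in annulus 0 (1 / 2)) ((fun=> 1) (N z))%:E = w%:E)%E.
  by rewrite integral_cst// mul1e.
suff main : N (f z0) `^ p * w <= ((2 * h) ^+ 2)^-1 * F.
  have := le_trans (ler_wpM2l (powR_ge0 _ _) w0) main.
  rewrite mulrC ler_pdivlMl ?exprn_gt0//; apply: le_trans.
  by rewrite le_eqVlt; apply/orP; left; apply/eqP; field.
apply/ler_addgt0Pr => e e0.
have e1 : 0 < e / w by rewrite divr_gt0.
have c1 : measurable_fun (annulus 0 (1 / 2)) (fun z : C => (fun=> 1 : R) (N z)) by [].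
have [n n0 hn] := @rot_mean_le_annulus g p (fun=> 1) 0 (1 / 2) w _ (e / w)
  p0 ag t01 e1 (fun _ _ => ler01) c1 wE' gF.
have := hn 0; rewrite normc0 divfK ?gt_eqF// => /(_ (lexx 0)).
congr (_ * _ <= _); rewrite /rot_mean.
under eq_bigr => j _ do rewrite mulr0 /g mulr0 addr0.
by rewrite sumr_const card_ord -[N (f z0) `^ p *+ n]mulr_natr mulrCA mulVf ?mulr1// pnatr_eq0 -lt0n.
Qed.

End mean_values.
(** * Radial weights and their masses on sectors *)

Section counting.
Context d (T : measurableType d) (R : realType) (nu : {measure set T -> \bar R}).
Variables (I : finType) (D : set T) (F : I -> set T) (g : T -> \bar R).
Hypotheses (mD : measurable D) (mF : forall i, measurable (F i))
  (mg : measurable_fun D g) (g0 : forall z, D z -> (0 <= g z)%E).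

(** Sum over pieces, as one integral against the number of pieces at a point. *)
Lemma sum_integral_pieces :
  (\sum_i \int[nu]_(z in D `&` F i) g z =
   \int[nu]_(z in D) \sum_i (g z * (\1_(F i) z)%:E))%E.
Proof.
rewrite ge0_integral_sum//.
- apply: eq_bigr => i _; rewrite integral_mkcondr; apply: eq_integral => z _.
  by rewrite patchE indicE; case: (z \in F i); rewrite ?mule1 ?mule0.
- move=> i; apply: emeasurable_funM => //; apply/measurable_EFinP.
  exact: measurable_indic.
- by move=> i z Dz; rewrite mule_ge0 ?g0// lee_fin.
Qed.

Let sum_count z : (\sum_i (z \in F i : nat))%N%:R = \sum_i \1_(F i) z :> R.
Proof. by rewrite natr_sum; apply: eq_bigr => i _; rewrite indicE. Qed.

Let mcount : measurable_fun D (fun z => \sum_i (g z * (\1_(F i) z)%:E))%E.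
Proof.
apply: emeasurable_sum => i; apply: emeasurable_funM => //; apply/measurable_EFinP.
exact: measurable_indic.
Qed.

Lemma integral_le_cover : (forall z, D z -> exists i, F i z) ->
  (\int[nu]_(z in D) g z <= \sum_i \int[nu]_(z in D `&` F i) g z)%E.
Proof.
move=> cov; rewrite sum_integral_pieces; apply: ge0_le_integral => //.
move=> z Dz; have [i Fi] := cov z Dz; rewrite (bigD1 i)//= indicE mem_set//= mule1.
by apply: leeDl; apply: sume_ge0 => j _; rewrite mule_ge0 ?g0// lee_fin.
Qed.

Lemma sum_integral_le_count (M : nat) :
  (forall z, D z -> (\sum_i (z \in F i : nat) <= M)%N) ->
  (\sum_i \int[nu]_(z in D `&` F i) g z <= M%:R%:E * \int[nu]_(z in D) g z)%E.
Proof.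
move=> cM; rewrite sum_integral_pieces -ge0_integralZl_EFin//.
apply: ge0_le_integral => //.
- by move=> z Dz; apply: sume_ge0 => j _; rewrite mule_ge0 ?g0// lee_fin.
- by apply: measurable_funeM.
move=> z Dz; rewrite -ge0_sume_distrr => [|i _]; last by rewrite lee_fin.
rewrite sumEFin -sum_count muleC lee_wpmul2r ?g0//.
by rewrite lee_fin ler_nat; exact: cM.
Qed.

End counting.

Section radial_weights.
Variables (R : realType) (omega : R -> R).
Hypothesis rw : radial_weight omega.
Local Notation C := R[i].
Local Notation N := (@normc R).
Local Notation leb := (@lebesgue_measure R).
Local Notation what := (omega_hat omega).
Local Notation mass := (weight_mass omega).
Local Notation kappa := (unit_area R).

Lemma omega_ge0 x : 0 <= x < 1 -> 0 <= omega x.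
Proof. by case: rw => + _ _; exact. Qed.

Lemma omega_integrable s t : 0 <= s -> t <= 1 ->
  leb.-integrable `[s, t[ (EFin \o omega).
Proof.
move=> s0 t1; case: rw => _ iom _; apply: integrableS iom => //.
by apply: subset_itv; rewrite bnd_simp.
Qed.

Lemma measurable_omega s t : 0 <= s -> t <= 1 ->
  measurable_fun (`[s, t[%classic : set (measurableTypeR R)) omega.
Proof.
move=> s0 t1; apply/measurable_EFinP.
exact: (measurable_int leb (omega_integrable s0 t1)).
Qed.

Lemma measurable_omega_disc : measurable_fun (@disc R) (fun z => omega (N z)).
Proof.
apply: (@measurable_comp _ _ _ _ _ _ (`[0, 1[%classic : set (measurableTypeR R))) => //.
- by move=> _ [z z1 <-]; rewrite /= in_itv /= normc_ge0.
- exact: measurable_omega.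
- exact: measurable_funTS (@measurable_normc R).
Qed.

Lemma integral_omega s : 0 <= s ->
  (\int[leb]_(x in `[s, 1%R[) (omega x)%:E = (what s)%:E)%E.
Proof.
move=> s0; rewrite /omega_hat /Rintegral fineK//.
exact: (integrable_fin_num _ (omega_integrable s0 (lexx 1))).
Qed.

Lemma integral_omega_sub s t : 0 <= s -> s <= t -> t <= 1 ->
  (\int[leb]_(x in `[s, t[) (omega x)%:E = (what s - what t)%:E)%E.
Proof.
move=> s0 st t1; have t0 : 0 <= t by exact: le_trans st.
have := integral_omega s0; rewrite (@itv_bndbnd_setU _ _ _ (BLeft t)) ?bnd_simp//.
rewrite ge0_integral_setU//=.
- rewrite integral_omega// EFinB => <-; rewrite addeK//.
- by rewrite -itv_bndbnd_setU ?bnd_simp//; apply/measurable_EFinP; exact: measurable_omega.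
- move=> x [] /=; rewrite in_itv /= => /andP[sx x1]; rewrite lee_fin; apply: omega_ge0.
    by rewrite (le_trans s0)//= (lt_le_trans x1).
  by rewrite x1 (le_trans t0).
- apply/disj_setPS => x [] /=; rewrite !in_itv /= => /andP[_ xt] /andP[tx _].
  by have := lt_le_trans xt tx; rewrite ltxx.
Qed.

Lemma what_mono s t : 0 <= s -> s <= t -> t <= 1 -> what t <= what s.
Proof.
move=> s0 st t1; rewrite -subr_ge0 -lee_fin -integral_omega_sub//.
apply: integral_ge0 => x; rewrite /= in_itv /= => /andP[sx xt].
by rewrite lee_fin; apply: omega_ge0; rewrite (le_trans s0)//= (lt_le_trans xt).
Qed.

Lemma what_gt0 r : 0 <= r < 1 -> 0 < what r.
Proof. by case: rw => _ _; exact. Qed.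

Lemma what1 : what 1 = 0.
Proof. by rewrite /omega_hat set_itv_ge ?bnd_simp ?ltxx// Rintegral_set0. Qed.

Lemma annulus_mass_le s t : 0 <= s -> s <= t -> t <= 1 ->
  (mass (annulus s t) <= (2 * kappa * (what s - what t))%:E)%E.
Proof.
move=> s0 st t1; rewrite EFinM -integral_omega_sub//; apply: integral_annulus_le => //.
  by move=> x /andP[sx xt]; apply: omega_ge0; rewrite (le_trans s0)//= (lt_le_trans xt).
exact: measurable_omega.
Qed.

Lemma annulus_mass_ge s t : 1 / 2 <= s -> s <= t -> t <= 1 ->
  ((kappa * (what s - what t))%:E <= mass (annulus s t))%E.
Proof.
move=> s2 st t1; have s0 : 0 <= s by lra.
rewrite EFinM -integral_omega_sub//; apply: integral_annulus_ge => //.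
  by move=> x /andP[sx xt]; apply: omega_ge0; rewrite (le_trans s0)//= (lt_le_trans xt).
exact: measurable_omega.
Qed.

Lemma mass_subset (A B : set C) : measurable A -> measurable B ->
  B `<=` @disc R -> A `<=` B -> (mass A <= mass B)%E.
Proof.
move=> mA mB B1 AB; apply: ge0_subset_integral => //.
  apply/measurable_EFinP; apply: measurable_funS measurable_omega_disc => //.
  exact: measurable_disc.
by move=> z /B1 z1; rewrite lee_fin omega_ge0// normc_ge0.
Qed.

Lemma mass_ge0 (A : set C) : A `<=` @disc R -> (0 <= mass A)%E.
Proof.
by move=> A1; apply: integral_ge0 => z /A1 z1; rewrite lee_fin omega_ge0// normc_ge0.
Qed.

(** ** Sectors *)

Definition sector (dl : R) (u : C) : set C :=
  [set z | N (z - real_complex R (N z) * u) < dl * N z].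

Lemma measurable_sector dl u : measurable (sector dl u).
Proof.
pose h z := z - real_complex R (N z) * u.
have -> : sector dl u = setT `&` (fun z => dl * N z - N (h z)) @^-1` `]0, +oo[.
  apply/seteqP; split => z; rewrite /sector /= in_itv /= andbT subr_gt0 //.
  by case.
have mh : measurable_fun setT h.
  apply: (@lipschitz_measurableC _ _ (1 + N u)) => z w.
  have -> : h z - h w = (z - w) - real_complex R (N z - N w) * u.
    by rewrite /h rmorphB; ring.
  apply: le_trans (le_normcD _ _) _; rewrite normcN normcM normc_real mulrDl mul1r.
  by rewrite lerD2l mulrC ler_wpM2l ?normc_ge0// normc_dist_abs.
have mf : measurable_fun setT (fun z : C => dl * N z - N (h z)).
  apply: measurable_funB; first by apply: measurable_funM => //; exact: measurable_normc.
  exact: (measurableT_comp (@measurable_normc R) mh).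
by apply: mf => //; exact: measurable_itv.
Qed.

Lemma sector_rot dl u v z : N v = 1 -> sector dl (v * u) (v * z) <-> sector dl u z.
Proof.
move=> v1; rewrite /sector /mkset.
have -> : v * z - real_complex R (N (v * z)) * (v * u) =
    v * (z - real_complex R (N z) * u) by rewrite normcM v1 mul1r; ring.
by rewrite !normcM v1 !mul1r.
Qed.

Lemma sector_mass_rot dl u v s t : N v = 1 -> t <= 1 ->
  mass (annulus s t `&` sector dl (v * u)) = mass (annulus s t `&` sector dl u).
Proof.
move=> v1 t1; have mA := @measurable_annulus R s t.
have mS := measurable_sector dl (v * u).
have A1 : annulus s t `&` sector dl (v * u) `<=` @disc R.
  by move=> z [Az _]; apply: annulus_disc Az.
have mT : measurable_fun setT (fun z : C => v * z).
  by apply: (@lipschitz_measurableC _ _ 1) => z w; rewrite -mulrBr normcM v1.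
have := @integral_area_map R (fun z => v * z) 1 (annulus s t `&` sector dl (v * u))
  (fun z => (omega (N z))%:E) mT ler01.
rewrite mul1e /weight_mass => <-.
- have -> : (fun z => v * z) @^-1` (annulus s t `&` sector dl (v * u)) =
      annulus s t `&` sector dl u.
    by apply/seteqP; split => z [] /(annulus_rot s t z v1) ? /(sector_rot dl u z v1).
  by apply: eq_integral => z _; rewrite normcM v1 mul1r.
- by move=> E mE; rewrite mul1e; exact: area_rotate.
- exact: measurableI.
- apply/measurable_EFinP; apply: measurable_funS measurable_omega_disc => //.
  exact: measurable_disc.
- by move=> z /A1 z1; rewrite lee_fin omega_ge0// normc_ge0.
Qed.

Lemma mass_annulus_fin s t : 0 <= s -> s <= t -> t <= 1 ->
  mass (annulus s t) \is a fin_num.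
Proof.
move=> s0 st t1; rewrite ge0_fin_numE; last by apply: mass_ge0; exact: annulus_disc.
by apply: le_lt_trans (annulus_mass_le s0 st t1) _; rewrite ltry.
Qed.

(** About [1 / dl] rotates of a sector of aperture [dl] are disjoint. *)
Lemma sector_mass_le dl u s t : 0 < dl -> N u = 1 -> t <= 1 ->
  (mass (annulus s t `&` sector dl u) <= (8 * dl)%:E * mass (annulus s t))%E.
Proof.
move=> dl0 u1 t1; set A := annulus s t; set S := A `&` _.
have mA : measurable A := @measurable_annulus R s t.
have A1 : A `<=` @disc R by exact: annulus_disc.
have mS : measurable S by apply: measurableI => //; exact: measurable_sector.
have SA : (mass S <= mass A)%E by apply: mass_subset => // z [].
have S0 : (0 <= mass S)%E by apply: mass_ge0 => z [/A1].
have A0 : (0 <= mass A)%E by exact: mass_ge0.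
have dl4 : 0 < 1 / (4 * dl) by rewrite divr_gt0// mulr_gt0.
pose n := Num.truncn (1 / (4 * dl)).
have /andP[n1 n2] : n%:R <= 1 / (4 * dl) < n.+1%:R.
  by apply: truncn_itv; exact: ltW.
case: (posnP n) => [n0|n0].
  apply: le_trans SA _; rewrite -[leLHS]mul1e lee_wpmul2r// lee_fin.
  by move: n2; rewrite n0 ltr_pdivrMr ?mulr_gt0// mul1r; lra.
pose th := 4 * dl; have th0 : 0 < th by rewrite mulr_gt0.
pose F (j : 'I_n) := sector dl (cis (th * j%:R) * u).
have E : (\sum_(j < n) mass (A `&` F j) = n%:R%:E * mass S)%E.
  rewrite (eq_bigr (fun=> mass S)); last first.
    by move=> j _; rewrite /F sector_mass_rot// normc_cis.
  by rewrite sumr_const card_ord mule_natl.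
have le1 : (n%:R%:E * mass S <= 1%:R%:E * mass A)%E.
  rewrite -E; apply: sum_integral_le_count => //.
  - by move=> j; exact: measurable_sector.
  - apply/measurable_EFinP; apply: measurable_funS measurable_omega_disc => //.
    exact: measurable_disc.
  - by move=> z /A1 z1; rewrite lee_fin omega_ge0// normc_ge0.
  move=> z _; rewrite leqNgt; apply/negP => two.
  have [j [k [jk Fj Fk]]] : exists j k : 'I_n, [/\ (j < k)%N, F j z & F k z].
    have : (1 < #|[pred i | z \in F i]|)%N.
      have -> : #|[pred i | z \in F i]| = (\sum_i (z \in F i : nat))%N.
        rewrite -sum1_card big_mkcond /=; apply: eq_bigr => i _.
        by rewrite inE; case: (z \in F i).
      exact: two.
    move=> /card_gt1P[j [k [jF kF jk]]]; rewrite !inE in jF kF.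
    case: (ltngtP j k) => [lt|gt|/val_inj jk']; last by rewrite jk' eqxx in jk.
      by exists j, k.
    by exists k, j.
  have kn : th * k%:R <= 1.
    apply: le_trans (_ : th * n%:R <= _); first by rewrite ler_wpM2l ?(ltW th0)// ler_nat ltnW.
    by rewrite mulrC -ler_pdivlMr.
  have nz : 0 < N z.
    rewrite lt_neqAle normc_ge0 andbT eq_sym; apply/negP => /eqP z0.
    by move: Fj; rewrite /F /sector /= -/(normc _) z0 mulr0 => /lt_le_trans/(_ (lexx _)); rewrite ltNge normc_ge0.
  have jk1 : `|th * j%:R - th * k%:R| = th * (k%:R - j%:R).
    rewrite -mulrBr normrM gtr0_norm// distrC ger0_norm// subr_ge0 ler_nat ltnW//.
  have jk2 : 1 <= k%:R - j%:R :> R.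
    by rewrite lerBrDr addrC natr1 ler_nat.
  have := @normc_cis_sub_ge R (th * j%:R) (th * k%:R); rewrite jk1.
  have j0 : 0 <= j%:R :> R by [].
  have le1 : th * (k%:R - j%:R) <= 1 by rewrite mulrBr; have := mulr_ge0 (ltW th0) j0; lra.
  move=> /(_ le1) low.
  have up : N z * N (cis (th * j%:R) - cis (th * k%:R)) < N z * (2 * dl).
    have -> : N z * N (cis (th * j%:R) - cis (th * k%:R)) =
      N (real_complex R (N z) * (cis (th * j%:R) * u) - real_complex R (N z) * (cis (th * k%:R) * u)).
      rewrite -mulrBr -mulrBl !normcM u1 mulr1 normc_real ger0_norm//.
      exact: ltW.
    apply: le_lt_trans (normc_triang _ z _) _; rewrite normc_distC.
    have := ltrD Fj Fk; rewrite /sector /mkset; lra.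
  move: up; rewrite ltr_pM2l// ltNge => /negP; apply; apply: le_trans low.
  by rewrite /th; have := mulr_ge0 (ltW dl0) (_ : 0 <= k%:R - j%:R - 1 :> R); rewrite subr_ge0 => /(_ jk2); lra.
rewrite mul1e in le1.
have nd : 1 <= 8 * dl * n%:R.
  move: n2; rewrite ltr_pdivrMr ?mulr_gt0// -natr1 => n2.
  have : 1 <= n%:R :> R by rewrite ler1n.
  nra.
apply: (@le_trans _ _ ((8 * dl * n%:R)%:E * mass S)%E).
  by rewrite -[leLHS]mul1e lee_wpmul2r// lee_fin.
by rewrite EFinM -muleA lee_wpmul2l// lee_fin mulr_ge0// ltW.
Qed.

(** About [1 / dl] rotates of a sector of aperture [dl] cover everything. *)
Lemma sector_mass_ge dl u s t : 0 < dl <= 1 -> N u = 1 -> 0 < s -> t <= 1 ->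
  ((dl / 9)%:E * mass (annulus s t) <= mass (annulus s t `&` sector dl u))%E.
Proof.
move=> /andP[dl0 dl1] u1 s0 t1; set A := annulus s t; set S := A `&` _.
have mA : measurable A := @measurable_annulus R s t.
have A1 : A `<=` @disc R by exact: annulus_disc.
have mS : measurable S by apply: measurableI => //; exact: measurable_sector.
have S0 : (0 <= mass S)%E by apply: mass_ge0 => z [/A1].
pose n := (Num.truncn (8 / dl)).+1.
have n1 : 8 / dl < n%:R by exact: truncnS_gt.
have n2 : n%:R <= 9 / dl.
  rewrite /n -natr1.
  have /andP[h _] : (Num.truncn (8 / dl))%:R <= 8 / dl < (Num.truncn (8 / dl)).+1%:R.
    by apply: truncn_itv; rewrite divr_ge0// ltW.
  apply: le_trans (lerD h (lexx 1)) _.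
  have -> : 9 / dl = 8 / dl + 1 / dl by rewrite -mulrDl; congr (_ / _); ring.
  by rewrite lerD2l ler_pdivlMr// mul1r.
have n0 : 0 < n%:R :> R by rewrite ltr0n.
pose F (j : 'I_n) := sector dl (cis (rot_angle R n * j%:R) * u).
have E : (\sum_(j < n) mass (A `&` F j) = n%:R%:E * mass S)%E.
  rewrite (eq_bigr (fun=> mass S)); last first.
    by move=> j _; rewrite /F sector_mass_rot// normc_cis.
  by rewrite sumr_const card_ord mule_natl.
have th0 : 0 < rot_angle R n by rewrite divr_gt0// pi2_gt0.
have thd : rot_angle R n < dl.
  rewrite /rot_angle ltr_pdivrMr// mulrC -ltr_pdivrMr//; apply: lt_trans n1.
  by rewrite ltr_pM2r ?invr_gt0// mulr2n; have := @pihalf_lt2 R; lra.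
have le1 : (mass A <= n%:R%:E * mass S)%E.
  rewrite -E; apply: integral_le_cover => //.
  - by move=> j; exact: measurable_sector.
  - apply/measurable_EFinP; apply: measurable_funS measurable_omega_disc => //.
    exact: measurable_disc.
  - by move=> z /A1 z1; rewrite lee_fin omega_ge0// normc_ge0.
  move=> z /andP[sz zt]; have nz : 0 < N z by exact: lt_le_trans sz.
  have z0 : z != 0 by rewrite -normc_gt0.
  have u0 : u != 0 by rewrite -normc_gt0 u1.
  have [phi /andP[phi0 phi1] phiE] : exists2 t, 0 <= t < pi *+ 2 & z = real_complex R (N z) * (cis t * u).
    have nz' : real_complex R (N z) != 0.
      by apply/eqP => /(congr1 (@complex.Re R)) /= h; rewrite h ltxx in nz.
    have [t' /andP[t0 tp] tE] : exists2 t, 0 <= t <= pi *+ 2 & z / real_complex R (N z) / u = cis t.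
      apply: unit_cis; rewrite !normcM !normcV u1 invr1 mulr1 normc_real gtr0_norm//.
      by rewrite mulfV// gt_eqF.
    have zE t'' : cis t'' = cis t' -> z = real_complex R (N z) * (cis t'' * u).
      by move=> ->; rewrite -tE divfK// mulrC divfK.
    move: tp; rewrite le_eqVlt => /predU1P[tp|tp]; last by exists t'; [rewrite t0|exact: zE].
    by exists 0; [rewrite lexx pi2_gt0|apply: zE; rewrite tp cis0 cis2pi].
  pose k := Num.truncn (phi / rot_angle R n).
  have /andP[k1 k2] : k%:R <= phi / rot_angle R n < k.+1%:R.
    by apply: truncn_itv; rewrite divr_ge0// ltW.
  have kn : (k < n)%N.
    rewrite -(ltr_nat R); apply: le_lt_trans k1 _; rewrite ltr_pdivrMr//.
    by rewrite /rot_angle mulrC divfK// gt_eqF.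
  exists (Ordinal kn); rewrite /F /sector /mkset {1}phiE -mulrBr -mulrBl !normcM u1 mulr1.
  rewrite normc_real gtr0_norm// mulrC ltr_pM2r//.
  apply: le_lt_trans (normc_cis_sub_le _ _) _; apply: le_lt_trans thd => /=.
  move: k1 k2; rewrite ler_pdivlMr// ltr_pdivrMr// -natr1 => k1 k2.
  by rewrite ger0_norm; lra.
apply: (@le_trans _ _ ((dl / 9)%:E * (n%:R%:E * mass S))%E).
  by rewrite lee_wpmul2l// lee_fin divr_ge0// ltW.
rewrite muleA -EFinM -[leRHS]mul1e lee_wpmul2r// lee_fin.
apply: le_trans (ler_wpM2l _ n2) _; first by rewrite divr_ge0// ltW.
by rewrite le_eqVlt; apply/orP; left; apply/eqP; field; rewrite gt_eqF.
Qed.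

End radial_weights.
(** * Pseudohyperbolic discs and doubling weights *)

Section pseudohyperbolic_discs.
Variable R : realType.
Local Notation C := R[i].
Local Notation N := (@normc R).
Implicit Types a z : C.

Lemma one_sub_conj_identity a z : N (1 - conjc a * z) ^+ 2 - N (a - z) ^+ 2 =
  (1 - N a ^+ 2) * (1 - N z ^+ 2).
Proof. by rewrite !normc_sqrE; case: a => x y; case: z => b c /=; ring. Qed.

Lemma normc_one_sub_conj_ge a z : 1 - N a * N z <= N (1 - conjc a * z).
Proof. by have := normc_subD 1 (conjc a * z); rewrite normc1 normcM normc_conj. Qed.

Lemma normc_one_sub_conj_gt0 a z : N a < 1 -> N z < 1 -> 0 < N (1 - conjc a * z).
Proof.
move=> a1 z1; apply: lt_le_trans (normc_one_sub_conj_ge a z).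
have := normc_ge0 a; have := normc_ge0 z; nra.
Qed.

Lemma DeltaP a (r : R) z : N a < 1 -> N z < 1 ->
  (Delta a r z <-> N (a - z) < r * N (1 - conjc a * z)).
Proof.
move=> a1 z1; have d0 := normc_one_sub_conj_gt0 a1 z1.
rewrite /Delta /pseudohyperbolic /mkset normcM normcV ltr_pdivrMr//.
by split => [[]|].
Qed.

Lemma measurable_one_sub_conj a : measurable_fun setT (fun z => N (1 - conjc a * z)).
Proof.
apply: (measurableT_comp (@measurable_normc R)); apply: (@lipschitz_measurableC _ _ (N a)) => z w.
by rewrite opprB addrC addrA subrK -mulrBr normcM normc_conj normc_distC.
Qed.

(** The points of the disc at distance less than [d |a|^-1] from the reflection
    of [a] in the unit circle. *)
Definition box a (d : R) : set C := [set z | disc z /\ N (1 - conjc a * z) < d].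

Lemma measurable_box a d : measurable (box a d).
Proof.
rewrite (_ : box a d = @disc R `&` (fun z => N (1 - conjc a * z)) @^-1` `]-oo, d[); last first.
  by apply/seteqP; split => z []; rewrite /= in_itv.
apply: measurableI; first exact: measurable_disc.
rewrite -[X in measurable X]setTI; apply: measurable_one_sub_conj => //; exact: measurable_itv.
Qed.

Lemma measurable_Delta a (r : R) : N a < 1 -> measurable (Delta a r).
Proof.
move=> a1; pose h z := r * N (1 - conjc a * z) - N (a - z).
have -> : Delta a r = @disc R `&` h @^-1` `]0, +oo[.
  apply/seteqP; split => z.
    move=> Dz; have z1 : N z < 1 by case: Dz.
    by split => //; rewrite /h /= in_itv /= andbT subr_gt0; exact/(DeltaP r a1 z1).
  move=> [z1]; rewrite /h /= in_itv /= andbT subr_gt0 => hz.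
  exact/(DeltaP r a1 z1).
apply: measurableI; first exact: measurable_disc.
rewrite -[X in measurable X]setTI.
have m2 : measurable_fun setT (fun z => a - z).
  apply: (@lipschitz_measurableC _ _ 1) => z w.
  by rewrite opprB addrC addrA subrK mul1r normc_distC.
have mh : measurable_fun setT h.
  apply: measurable_funB.
    by apply: measurable_funM => //; exact: measurable_one_sub_conj.
  exact: (measurableT_comp (@measurable_normc R) m2).
by apply: mh => //; exact: measurable_itv.
Qed.

(** A Whitney region at [a] of vertical extent [1 / k] lies in a
    pseudohyperbolic disc whose radius depends on [k] only. *)
Lemma whitney_sub_Delta a z (k : R) : 1 <= k -> N a < 1 -> N (z - a) <= 2 * (1 - N a) ->
  (1 - N a) / (2 * k) <= 1 - N z -> Delta a (1 - (128 * k)^-1) z.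
Proof.
move=> k1 a1 za zk; have k0 : 0 < k by lra.
have b0 : 0 < 1 - N a by lra.
have z1 : N z < 1.
  rewrite -subr_gt0; apply: lt_le_trans zk; apply: divr_gt0 => //; lra.
apply/(DeltaP _ a1 z1).
have d0 := normc_one_sub_conj_gt0 a1 z1.
have na := normc_ge0 a; have nz := normc_ge0 z.
have up : N (1 - conjc a * z) <= 4 * (1 - N a).
  have -> : 1 - conjc a * z = (1 - conjc a * a) + conjc a * (a - z) by ring.
  apply: le_trans (le_normcD _ _) _; rewrite normcM normc_conj (normc_distC a).
  have -> : N (1 - conjc a * a) = 1 - N a ^+ 2.
    have -> : 1 - conjc a * a = real_complex R (1 - N a ^+ 2).
      rewrite normc_sqrE; apply/eqP; rewrite eq_complex; case: (a) => x y /=.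
      by apply/andP; split; apply/eqP; ring.
    by rewrite normc_real ger0_norm//; nra.
  by nra.
set d := N (1 - conjc a * z) in d0 up *.
have i128 : 0 < (128 * k)^-1 by rewrite invr_gt0 mulr_gt0.
have i1 : (128 * k)^-1 <= 1 by rewrite invf_le1 ?mulr_gt0//; lra.
rewrite -(@ltr_pXn2r _ 2) ?nnegrE ?normc_ge0 ?mulr_ge0 ?(ltW d0)//; last by rewrite subr_ge0.
have := one_sub_conj_identity a z; rewrite -/d => id.
have -> : N (a - z) ^+ 2 = d ^+ 2 - (1 - N a ^+ 2) * (1 - N z ^+ 2) by rewrite -id; ring.
set e := (128 * k)^-1 in i128 i1 *.
have kE : (2 * k)^-1 = 64 * e by rewrite /e; field; rewrite gt_eqF.
have low : 64 * e * (1 - N a) ^+ 2 <= (1 - N a ^+ 2) * (1 - N z ^+ 2).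
  rewrite kE in zk; have z2 : (1 - N a) * (64 * e) <= 1 - N z ^+ 2 by nra.
  have a2 : 1 - N a <= 1 - N a ^+ 2 by nra.
  have -> : 64 * e * (1 - N a) ^+ 2 = (1 - N a) * ((1 - N a) * (64 * e)) by ring.
  by apply: ler_pM => //; rewrite ?mulr_ge0// ltW.
have d2 : d ^+ 2 <= 16 * (1 - N a) ^+ 2.
  have -> : 16 * (1 - N a) ^+ 2 = (4 * (1 - N a)) ^+ 2 by ring.
  by rewrite ler_pXn2r ?nnegrE ?mulr_ge0 ?(ltW d0)// ltW.
rewrite exprMn.
have e2 : (1 - 2 * e) * d ^+ 2 <= (1 - e) ^+ 2 * d ^+ 2.
  by rewrite ler_wpM2r ?sqr_ge0//; have := sqr_ge0 e; lra.
apply: lt_le_trans e2.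
have : e * d ^+ 2 <= e * (16 * (1 - N a) ^+ 2) by rewrite ler_wpM2l// ltW.
have : 0 < e * d ^+ 2 by rewrite mulr_gt0// exprn_gt0.
lra.
Qed.

Lemma Delta_one_sub_conj a z (r : R) : 0 < r < 1 -> N a < 1 -> Delta a r z ->
  N (1 - conjc a * z) <= 4 / (1 - r ^+ 2) * (1 - N a).
Proof.
move=> /andP[r0 r1] a1 Dz; have z1 : N z < 1 by case: Dz.
have d0 := normc_one_sub_conj_gt0 a1 z1.
have := (DeltaP r a1 z1).1 Dz; set d := N (1 - conjc a * z) in d0 *.
rewrite -(@ltr_pXn2r _ 2) ?nnegrE ?normc_ge0 ?mulr_ge0 ?(ltW d0) ?(ltW r0)//.
have := one_sub_conj_identity a z; rewrite -/d => id.
have -> : N (a - z) ^+ 2 = d ^+ 2 - (1 - N a ^+ 2) * (1 - N z ^+ 2) by rewrite -id; ring.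
rewrite exprMn => h.
have r2 : 0 < 1 - r ^+ 2 by nra.
have na := normc_ge0 a; have nz := normc_ge0 z.
have low := normc_one_sub_conj_ge a z; rewrite -/d in low.
have zd : 1 - N z <= d by nra.
have p1 : 1 - N a ^+ 2 <= 2 * (1 - N a) by nra.
have p2 : 1 - N z ^+ 2 <= 2 * d by nra.
have p3 : (1 - N a ^+ 2) * (1 - N z ^+ 2) <= 2 * (1 - N a) * (2 * d).
  by apply: ler_pM => //; nra.
rewrite mulrAC ler_pdivlMr//.
have : d * (d * (1 - r ^+ 2)) <= d * (4 * (1 - N a)).
  have -> : d * (d * (1 - r ^+ 2)) = d ^+ 2 - r ^+ 2 * d ^+ 2 by ring.
  have -> : d * (4 * (1 - N a)) = 2 * (1 - N a) * (2 * d) by ring.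
  lra.
by rewrite ler_pM2l.
Qed.

Lemma polar_dir a : exists2 u : C, N u = 1 & a = real_complex R (N a) * u.
Proof.
have [->|a0] := eqVneq a 0.
  by exists 1; rewrite ?normc1// normc0 rmorph0 mul0r.
have na : 0 < N a by rewrite normc_gt0.
exists (a / real_complex R (N a)).
  by rewrite normcM normcV normc_real gtr0_norm// mulfV// gt_eqF.
rewrite mulrC divfK//; apply/eqP => /(congr1 (@complex.Re R)) /= h.
by rewrite h ltxx in na.
Qed.

End pseudohyperbolic_discs.

(** ** Weights in the class D *)

(** The two doubling conditions with explicit constants; the radius of the
    lower condition is taken to be a power of two. *)
Definition doubling_weight (R : realType) (omega : R -> R) (C1 : R) (m : nat) (C2 : R) : Prop :=
  [/\ radial_weight omega, 1 <= C1, 1 < C2,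
    (forall r, 0 <= r < 1 -> omega_hat omega r <= C1 * omega_hat omega ((1 + r) / 2)) &
    (forall r, 0 <= r < 1 -> C2 * omega_hat omega (1 - (1 - r) / 2 ^+ m) <= omega_hat omega r)].

Lemma D_class_doubling (R : realType) (omega : R -> R) : D_class omega ->
  exists C1 m C2, doubling_weight omega C1 m C2.
Proof.
move=> [[rw [C1 C11 H1]] [_ [K [C2 [K1 C21 H2]]]]].
pose m := Num.truncn K; exists C1, m.+1, C2; split => // r r01.
have Km : K <= 2 ^+ m.+1.
  apply: le_trans (ltW (truncnS_gt K)) _; rewrite -natrX ler_nat.
  by apply: ltnW; exact: ltn_expl.
have K0 : 0 < K by lra.
apply: le_trans (H2 r r01); have /andP[r0 r1] := r01.
rewrite ler_wpM2l//; first by lra.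
have p0 : 0 < 2 ^+ m.+1 :> R by rewrite exprn_gt0.
apply: (what_mono rw).
- rewrite subr_ge0 ler_pdivrMr// mul1r; lra.
- by rewrite lerD2l lerN2 ler_wpM2l ?lef_pV2 ?posrE// subr_ge0 ltW.
- by rewrite lerBlDr lerDl divr_ge0 ?(ltW p0)// subr_ge0 ltW.
Qed.

Section doubling_weights.
Variables (R : realType) (omega : R -> R) (C1 : R) (m : nat) (C2 : R).
Hypothesis dw : doubling_weight omega C1 m C2.
Local Notation C := R[i].
Local Notation N := (@normc R).
Local Notation what := (omega_hat omega).
Local Notation mass := (weight_mass omega).
Local Notation kappa := (unit_area R).

Let rw : radial_weight omega. Proof. by case: dw. Qed.
Let C11 : 1 <= C1. Proof. by case: dw. Qed.
Let C21 : 1 < C2. Proof. by case: dw. Qed.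
Let C10 : 0 < C1. Proof. exact: lt_le_trans ltr01 C11. Qed.
Let kappa0 : 0 < kappa. Proof. by case: (area_unit_disc R). Qed.

Lemma what_doubling n x y : 0 <= x < 1 -> 0 <= y < 1 -> 1 - x <= 2 ^+ n * (1 - y) ->
  what x <= C1 ^+ n * what y.
Proof.
elim: n x => [|n IH] x x01 y01.
  rewrite !expr0 !mul1r => xy; case/andP: x01 y01 => x0 x1 /andP[y0 y1].
  by apply: (what_mono rw) => //; lra.
rewrite exprS => xy; case: dw => _ _ _ H _; apply: le_trans (H x x01) _.
rewrite exprS -mulrA ler_wpM2l ?(ltW C10)//; case/andP: x01 => x0 x1.
by apply: IH => //; [apply/andP; split|]; lra.
Qed.

Definition gap_const : R := (1 - C2^-1) / C1.

Lemma gap_const_gt0 : 0 < gap_const.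
Proof.
rewrite /gap_const divr_gt0// subr_gt0 invf_lt1//.
exact: lt_trans ltr01 C21.
Qed.

(** The reverse doubling condition puts a fixed proportion of the tail mass in
    one annulus. *)
Lemma what_gap r : 0 <= r < 1 ->
  gap_const * what r <= what ((1 + r) / 2) - what (1 - (1 - r) / (2 * 2 ^+ m)).
Proof.
move=> r01; case: dw => _ _ _ H1 H2; have /andP[r0 r1] := r01.
have r'01 : 0 <= (1 + r) / 2 < 1 by apply/andP; split; lra.
have := H2 _ r'01; have := H1 _ r01.
have p0 : 0 < 2 ^+ m :> R by rewrite exprn_gt0.
have -> : 1 - (1 - (1 + r) / 2) / 2 ^+ m = 1 - (1 - r) / (2 * 2 ^+ m).
  by field; rewrite gt_eqF.
set w1 := what r; set w2 := what _; set w3 := what _ => h1 h2.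
have c20 : 0 < C2 by exact: lt_trans ltr01 C21.
have h3 : w3 <= C2^-1 * w2 by rewrite ler_pdivlMl.
rewrite /gap_const mulrAC ler_pdivrMr//.
have c2i : 0 < 1 - C2^-1 by rewrite subr_gt0 invf_lt1.
apply: le_trans (_ : (1 - C2^-1) * (C1 * w2) <= _); first by rewrite ler_wpM2l// ltW.
have -> : (1 - C2^-1) * (C1 * w2) = C1 * (w2 - C2^-1 * w2) by ring.
by rewrite [leRHS]mulrC ler_wpM2l ?(ltW C10)//; lra.
Qed.

(** Up to constants, the mass of the pseudohyperbolic disc about [a]. *)
Definition tau (a : C) : R := (1 - N a) * what (N a).

Lemma tau_gt0 a : N a < 1 -> 0 < tau a.
Proof. by move=> a1; rewrite mulr_gt0 ?subr_gt0// what_gt0// normc_ge0. Qed.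

(** Close enough to one for the disc about [a] to reach across the annulus that
    [what_gap] provides for [r = |a|]; see [whitney_sub_Delta]. *)
Definition Delta_radius : R := 1 - (128 * 2 ^+ m)^-1.

Lemma Delta_radius01 : 0 < Delta_radius < 1.
Proof.
have p1 : 1 <= 2 ^+ m :> R by rewrite exprn_ege1// ler1n.
have p0 : 0 < 128 * 2 ^+ m :> R by lra.
rewrite /Delta_radius; apply/andP; split.
  by rewrite subr_gt0 invf_lt1//; lra.
by rewrite gtrBl invr_gt0.
Qed.

(** The disc contains the part in a sector of an annulus that carries a fixed
    proportion of the tail of the weight. *)
Lemma Delta_mass_ge a : N a < 1 ->
  ((gap_const * kappa / 9 * tau a)%:E <= mass (Delta a Delta_radius))%E.
Proof.
move=> a1; have na := normc_ge0 a; have b0 : 0 < 1 - N a by lra.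
have [u u1 aE] := polar_dir a.
pose s := (1 + N a) / 2; pose t := 1 - (1 - N a) / (2 * 2 ^+ m).
have p1 : 1 <= 2 ^+ m :> R by rewrite exprn_ege1// ler1n.
have st : s <= t.
  have : (1 - N a) / (2 * 2 ^+ m) <= (1 - N a) / 2.
    by rewrite ler_wpM2l ?(ltW b0)// lef_pV2 ?posrE; lra.
  by rewrite /s /t; lra.
have t1 : t <= 1 by rewrite /t lerBlDr lerDl divr_ge0//; lra.
have s2 : 1 / 2 <= s by rewrite /s; lra.
have s0 : 0 < s by lra.
have dl01 : 0 < 1 - N a <= 1 by rewrite b0/=; lra.
apply: (@le_trans _ _ (mass (annulus s t `&` sector (1 - N a) u))); last first.
  apply: (mass_subset rw).
  - by apply: measurableI; [exact: measurable_annulus|exact: measurable_sector].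
  - exact: measurable_Delta.
  - by move=> z [].
  move=> z [/andP[sz zt] zu]; apply: whitney_sub_Delta => //; last first.
    by move: zt; rewrite /t; lra.
  apply: le_trans (normc_triang z (real_complex R (N z) * u) a) _.
  have -> : real_complex R (N z) * u - a = real_complex R (N z - N a) * u.
    by rewrite rmorphB mulrBl -aE.
  rewrite normcM u1 mulr1 normc_real.
  have z1 : N z < 1 by exact: lt_le_trans zt t1.
  have -> : `|N z - N a| = N z - N a by rewrite ger0_norm//; rewrite /s in sz; lra.
  move: zu; rewrite /sector /mkset => zu.
  have : (1 - N a) * N z <= 1 - N a by rewrite ler_piMr// ltW.
  lra.
apply: le_trans (sector_mass_ge rw dl01 u1 s0 t1).
apply: (@le_trans _ _ (((1 - N a) / 9)%:E * (kappa * (what s - what t))%:E)%E); last first.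
  by rewrite lee_wpmul2l ?annulus_mass_ge// lee_fin divr_ge0// ltW.
rewrite -EFinM lee_fin.
have -> : gap_const * kappa / 9 * tau a = (1 - N a) / 9 * (kappa * (gap_const * what (N a))).
  by rewrite /tau; ring.
rewrite ler_wpM2l ?divr_ge0 ?(ltW b0)// ler_wpM2l ?(ltW kappa0)//.
by apply: what_gap; rewrite na.
Qed.

(** A small box lies in a sector of an annulus that reaches the boundary: the
    aperture gives the factor [2 ^ n] and doubling the factor [C1 ^ n]. A large box
    is compared with the whole disc. *)
Lemma carleson_box_mass a n : N a < 1 ->
  (mass (box a (2 ^+ n * (1 - N a))) <=
    (64 * kappa * C1 ^+ 2 * (2 * C1) ^+ n * tau a)%:E)%E.
Proof.
move=> a1; set E := (X in mass X); have na := normc_ge0 a.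
have b0 : 0 < 1 - N a by lra.
pose dl := 2 ^+ n * (1 - N a).
have dl0 : 0 < dl by rewrite mulr_gt0// exprn_gt0.
have E1 : E `<=` @disc R by move=> z [].
have mE : measurable E by exact: measurable_box.
have w0 := what_gt0 rw (_ : 0 <= N a < 1); rewrite na a1 in w0.
have {}w0 := w0 isT.
have c1n : 0 < C1 ^+ n by rewrite exprn_gt0.
have tE : (2 * C1) ^+ n * tau a = dl * (C1 ^+ n * what (N a)).
  by rewrite /tau /dl exprMn; ring.
have k0 : 0 <= dl * (C1 ^+ n * what (N a)) by rewrite !mulr_ge0// ltW.
have c2 : 1 <= C1 ^+ 2 by rewrite exprn_ege1.
have [dl4|dl4] := leP dl (1 / 4).
  have [u u1 aE] := polar_dir a.
  apply: (@le_trans _ _ (mass (annulus (1 - dl) 1 `&` sector (4 * dl) u))).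
    apply: (mass_subset rw) => //.
    - by apply: measurableI; [exact: measurable_annulus|exact: measurable_sector].
    - by move=> z [Az _]; apply: annulus_disc Az.
    move=> z [z1 zE]; have nz := normc_ge0 z; rewrite /disc /mkset in z1.
    have low := normc_one_sub_conj_ge a z.
    have z1' : 1 - N z < dl by rewrite /dl; nra.
    split; first by apply/andP; split => //; lra.
    rewrite /sector /mkset.
    have uu : conjc u * u = 1.
      apply/eqP; rewrite eq_complex.
      have := normc_sqrE u; rewrite u1 expr1n; case: (u) => x y /= h.
      by apply/andP; split; apply/eqP; [rewrite h|]; ring.
    have -> : N (z - real_complex R (N z) * u) = N (conjc u * z - real_complex R (N z)).
      have -> : conjc u * z - real_complex R (N z) = conjc u * (z - real_complex R (N z) * u).
        by rewrite mulrBr mulrCA uu mulr1.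
      by rewrite normcM normc_conj u1 mul1r.
    have t1 : N (conjc u * z - 1) <= 2 * dl.
      have -> : conjc u * z - 1 = - (1 - conjc a * z) + real_complex R (1 - N a) * (conjc u * z).
        have -> : conjc a = real_complex R (N a) * conjc u.
          rewrite {1}aE; case: (u) => x y; apply/eqP; rewrite eq_complex /=.
          by apply/andP; split; apply/eqP; ring.
        by rewrite rmorphB rmorph1; ring.
      apply: le_trans (le_normcD _ _) _; rewrite normcN !normcM normc_conj u1 mul1r normc_real gtr0_norm//.
      have : (1 - N a) * N z <= 1 - N a by rewrite ler_piMr// ltW.
      have : 1 - N a <= dl by rewrite /dl ler_peMl ?(ltW b0)// exprn_ege1// ler1n.
      by rewrite /dl in zE *; lra.
    apply: le_lt_trans (normc_triang _ 1 _) _.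
    have -> : N (1 - real_complex R (N z)) = 1 - N z.
      have -> : 1 - real_complex R (N z) = real_complex R (1 - N z) by rewrite rmorphB rmorph1.
      by rewrite normc_real ger0_norm// subr_ge0 ltW.
    have z34 : 3 / 4 <= N z by lra.
    have : dl * (3 / 4) <= dl * N z by rewrite ler_wpM2l// ltW.
    lra.
  have dl40 : 0 < 4 * dl by rewrite mulr_gt0.
  apply: le_trans (sector_mass_le rw _ dl40 u1 (lexx 1)) _.
  apply: (@le_trans _ _ ((8 * (4 * dl))%:E * (2 * kappa * (what (1 - dl) - what 1))%:E)%E).
    apply: lee_wpmul2l; first by rewrite lee_fin mulr_ge0// ltW.
    by apply: (annulus_mass_le rw) => //; lra.
  rewrite what1 subr0 -EFinM lee_fin.
  have dd : what (1 - dl) <= C1 ^+ n * what (N a).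
    apply: what_doubling; rewrite ?na//; first by apply/andP; split; lra.
    by rewrite opprB addrC subrK.
  have -> : 64 * kappa * C1 ^+ 2 * (2 * C1) ^+ n * tau a =
    64 * kappa * C1 ^+ 2 * (dl * (C1 ^+ n * what (N a))) by rewrite -tE; ring.
  have : dl * what (1 - dl) <= dl * (C1 ^+ n * what (N a)) by rewrite ler_wpM2l// ltW.
  move=> h; apply: le_trans (_ : 64 * kappa * (dl * (C1 ^+ n * what (N a))) <= _).
    have -> : 8 * (4 * dl) * (2 * kappa * what (1 - dl)) = 64 * kappa * (dl * what (1 - dl)) by ring.
    by rewrite ler_wpM2l// mulr_ge0// ltW.
  rewrite ler_wpM2r// ler_peMr// mulr_ge0// ltW//.
apply: (@le_trans _ _ (mass (annulus 0 1))).
  apply: (mass_subset rw) => //; first exact: measurable_annulus.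
    exact: annulus_disc.
  by move=> z [z1 _]; apply/andP; rewrite normc_ge0.
apply: le_trans (annulus_mass_le rw (lexx 0) ler01 (lexx 1)) _.
rewrite what1 subr0 lee_fin.
have dd : what 0 <= C1 ^+ n.+2 * what (N a).
  apply: what_doubling; rewrite ?na ?lexx ?ltr01//.
  by rewrite subr0 !exprS -!mulrA -/dl; lra.
have -> : 64 * kappa * C1 ^+ 2 * (2 * C1) ^+ n * tau a =
    2 * kappa * (C1 ^+ n.+2 * what (N a) * (32 * dl)).
  have -> : 64 * kappa * C1 ^+ 2 * (2 * C1) ^+ n * tau a = 64 * kappa * C1 ^+ 2 * ((2 * C1) ^+ n * tau a) by ring.
  by rewrite tE (exprS _ n.+1) (exprS _ n); ring.
rewrite ler_wpM2l//; first by rewrite mulr_ge0// ltW.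
apply: le_trans dd _; rewrite ler_peMr//; last by lra.
by rewrite mulr_ge0// ?exprn_ge0// ltW.
Qed.

(** The disc lies in a box of comparable size. *)
Lemma Delta_mass_le : exists2 K : R, 0 < K & forall a, N a < 1 ->
  (mass (Delta a Delta_radius) <= (K * tau a)%:E)%E.
Proof.
have /andP[r0 r1] := Delta_radius01.
have r2 : 0 < 1 - Delta_radius ^+ 2 by nra.
pose n := (Num.truncn (4 / (1 - Delta_radius ^+ 2))).+1.
have hn : 4 / (1 - Delta_radius ^+ 2) < 2 ^+ n.
  apply: lt_trans (truncnS_gt _) _; rewrite -natrX ltr_nat; exact: ltn_expl.
exists (64 * kappa * C1 ^+ 2 * (2 * C1) ^+ n).
  by rewrite !mulr_gt0// exprn_gt0// mulr_gt0.
move=> a a1; apply: le_trans (carleson_box_mass n a1).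
have b0 : 0 < 1 - N a by lra.
apply: (mass_subset rw); [exact: measurable_Delta|exact: measurable_box|by move=> z []|].
move=> z Dz; have z1 : disc z by case: Dz.
split => //; apply: le_lt_trans (Delta_one_sub_conj Delta_radius01 a1 Dz) _.
by rewrite ltr_pM2r.
Qed.

End doubling_weights.
(** * Test functions *)

(** The [p]-th power of the norm. *)
Definition bergman_int (R : realType) (omega : R -> R) (p : R) (f : R[i] -> R[i]) : \bar R :=
  (\int[@area R]_(z in @disc R) (normc (f z) `^ p * omega (normc z))%:E)%E.

Lemma measurable_bergman_integrand (R : realType) (omega : R -> R) p f :
  radial_weight omega -> analytic_in_disc f ->
  measurable_fun (@disc R) (fun z => (normc (f z) `^ p * omega (normc z))%:E).
Proof.
move=> rw af; apply/measurable_EFinP; apply: measurable_funM.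
  exact: measurable_abspow.
exact: measurable_omega_disc.
Qed.

Lemma bergman_integrand_ge0 (R : realType) (omega : R -> R) p (f : R[i] -> R[i]) z :
  radial_weight omega -> normc z < 1 -> 0 <= normc (f z) `^ p * omega (normc z).
Proof. by move=> rw z1; rewrite mulr_ge0 ?powR_ge0// (omega_ge0 rw)// normc_ge0. Qed.

Lemma bergman_int_ge0 (R : realType) (omega : R -> R) p (f : R[i] -> R[i]) :
  radial_weight omega -> (0 <= bergman_int omega p f)%E.
Proof.
by move=> rw; apply: integral_ge0 => z z1; rewrite lee_fin bergman_integrand_ge0.
Qed.

Lemma powR_invl (R : realType) (x s : R) : 0 < x -> x^-1 `^ s = (x `^ s)^-1.
Proof. by move=> x0; rewrite /powR !gt_eqF ?invr_gt0// lnV ?posrE// mulrN expRN. Qed.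

Section test_functions.
Variables (R : realType) (omega : R -> R) (C1 : R) (m : nat) (C2 p : R).
Hypotheses (dw : doubling_weight omega C1 m C2) (p0 : 0 < p).
Local Notation C := R[i].
Local Notation N := (@normc R).
Local Notation what := (omega_hat omega).
Local Notation mass := (weight_mass omega).
Local Notation kappa := (unit_area R).
Local Notation tau := (tau omega).

Let rw : radial_weight omega. Proof. by case: dw. Qed.
Let C11 : 1 <= C1. Proof. by case: dw. Qed.
Let C10 : 0 < C1. Proof. exact: lt_le_trans ltr01 C11. Qed.
Let kappa0 : 0 < kappa. Proof. by case: (area_unit_disc R). Qed.

(** The Cauchy-type kernel of exponent [g], normalized to have size about one
    near [a]. *)
Definition kernel_pow (g : nat) (a z : C) : C :=
  (real_complex R (1 - N a) * (1 - conjc a * z)^-1) ^+ g.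

Lemma kernel_pow_analytic g a : N a < 1 -> analytic_in_disc (kernel_pow g a).
Proof.
move=> a1; apply/analyticP => z z1.
have d1 : has_cderiv (fun w => 1 - conjc a * w) z (0 + - conjc a).
  have -> : (fun w => 1 - conjc a * w) = (fun w => 1 + - conjc a * w).
    by apply/funext => w; rewrite mulNr.
  exact: has_cderivD (has_cderiv_cst _ _) (has_cderiv_scale _ _).
have nz : 1 - conjc a * z != 0 by rewrite -normc_gt0; exact: normc_one_sub_conj_gt0.
exact: (has_cderivX g (has_cderivZ _ (has_cderiv_comp d1 (has_cderiv_inv nz)))).
Qed.

Lemma normc_kernel_pow g a z : N a < 1 -> N z < 1 ->
  N (kernel_pow g a z) `^ p = ((1 - N a) / N (1 - conjc a * z)) `^ (g%:R * p).
Proof.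
move=> a1 z1; have d0 := normc_one_sub_conj_gt0 a1 z1.
rewrite normcX normcM normcV normc_real gtr0_norm ?subr_gt0//.
have q0 : 0 <= (1 - N a) / N (1 - conjc a * z) by rewrite divr_ge0 ?(ltW d0)// subr_ge0 ltW.
by rewrite -powR_mulrn// powRrM.
Qed.

Lemma large_power (x : R) : exists g : nat, x <= 2 `^ (g%:R * p).
Proof.
pose n := (Num.truncn x).+1; exists (Num.truncn (n%:R / p)).+1.
have xn : x <= 2 ^+ n.
  apply: le_trans (ltW (truncnS_gt x)) _; rewrite -natrX ler_nat.
  by apply: ltnW; exact: ltn_expl.
apply: le_trans xn _; rewrite -powR_mulrn//; apply: ler_powR; first by rewrite ler1n.
by rewrite -ler_pdivrMr//; exact: ltW (truncnS_gt _).
Qed.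

Definition box_const : R := 64 * kappa * C1 ^+ 2.

Lemma box_const_gt0 : 0 < box_const.
Proof. by rewrite mulr_gt0 ?exprn_gt0// mulr_gt0. Qed.

Variable g : nat.
Hypothesis g_large : 4 * C1 <= 2 `^ (g%:R * p).

Let gp0 : 0 < g%:R * p.
Proof.
rewrite ltNge; apply/negP => h.
have : 2 `^ (g%:R * p) <= 2 `^ 0 :> R by apply: ler_powR h; rewrite ler1n.
rewrite powRr0; have := C11; have := g_large; lra.
Qed.

Lemma pow2_gp n : (2 `^ (g%:R * p)) ^+ n = (2 ^+ n) `^ (g%:R * p) :> R.
Proof.
have -> : (2 ^+ n : R) = 2 `^ n%:R by rewrite powR_mulrn.
by rewrite -[RHS]powRrM (mulrC n%:R) [RHS]powRrM powR_mulrn// powR_ge0.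
Qed.

(** On the shell [2 ^ n <= |1 - conj a z| / (1 - |a|) < 2 ^ n.+1] the kernel is
    at most [(4 C1) ^ - n] while the mass is of order [(2 C1) ^ n], so the shells
    contribute a geometric series. *)
Lemma kernel_pow_box a n : N a < 1 ->
  (\int[@area R]_(z in box a (2 ^+ n * (1 - N a))) (N (kernel_pow g a z) `^ p * omega (N z))%:E
   <= (box_const * (4 * C1) * (2 - 2 ^- n) * tau a)%:E)%E.
Proof.
move=> a1; have b0 : 0 < 1 - N a by lra.
have ta := tau_gt0 dw a1.
pose F z := (N (kernel_pow g a z) `^ p * omega (N z))%:E.
have mF : measurable_fun (@disc R) F by apply: (measurable_bergman_integrand _ rw); exact: kernel_pow_analytic.
have F0 z : disc z -> (0 <= F z)%E by move=> z1; rewrite lee_fin bergman_integrand_ge0.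
have box1 d : box a d `<=` @disc R by move=> z [].
have mFd d : measurable_fun (box a d) F by exact: measurable_funS (@measurable_disc R) (@box1 d) mF.
have mo d : measurable_fun (box a d) (fun z => (omega (N z))%:E).
  apply/measurable_EFinP; apply: (measurable_funS (@measurable_disc R) (@box1 d)).
  exact: measurable_omega_disc.
elim: n => [|n IH].
  apply: (@le_trans _ _ (mass (box a (2 ^+ 0 * (1 - N a))))).
    apply: ge0_le_integral => //.
    - exact: measurable_box.
    - by move=> z /box1/F0.
    - move=> z [z1 _]; rewrite lee_fin ler_piMl ?omega_ge0 ?normc_ge0//.
      rewrite normc_kernel_pow//; have d0 := normc_one_sub_conj_gt0 a1 z1.
      have q0 : 0 <= (1 - N a) / N (1 - conjc a * z) by rewrite divr_ge0// ltW.
      have q1 : (1 - N a) / N (1 - conjc a * z) <= 1.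
        rewrite ler_pdivrMr// mul1r; apply: le_trans (normc_one_sub_conj_ge a z).
        by rewrite lerD2l lerN2 ler_piMr ?normc_ge0// ltW.
      by apply: le_trans (ge0_ler_powR (ltW gp0) _ _ q1) _; rewrite ?nnegrE// powR1.
  apply: le_trans (carleson_box_mass dw 0 a1) _; rewrite lee_fin.
  rewrite -/box_const !expr0 invr1 mulr1 ler_wpM2r ?(ltW ta)//.
  have -> : box_const * (4 * C1) * (2 - 1) = box_const * (4 * C1) by ring.
  rewrite ler_peMr ?(ltW box_const_gt0)//; have := C11; lra.
set B := box a (2 ^+ n * (1 - N a)) in IH *; set B' := box a _.
have BB' : B `<=` B'.
  move=> z [z1 zB]; split => //; apply: lt_le_trans zB _.
  by rewrite ler_wpM2r ?(ltW b0)// exprS ler_peMl// ?exprn_ge0// ler1n.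
have mB : measurable B by exact: measurable_box.
have mB' : measurable B' by exact: measurable_box.
have -> : B' = B `|` (B' `\` B) by rewrite setDUK.
have mBB : measurable (B' `\` B) by exact: measurableD.
rewrite ge0_integral_setU//; last 3 first.
- by rewrite setDUK//; exact: mFd.
- by move=> z; rewrite setDUK// => /box1/F0.
- by apply/disj_setPS => z [? []].
have gpn : 0 < (2 `^ (g%:R * p)) ^+ n by rewrite exprn_gt0// powR_gt0.
have sh : (\int[@area R]_(z in B' `\` B) F z <=
    (((2 `^ (g%:R * p)) ^+ n)^-1)%:E * mass B')%E.
  rewrite -ge0_integralZl_EFin//; last 2 first.
  - by move=> z /box1 z1; rewrite lee_fin omega_ge0// normc_ge0.
  - exact: mo.
  apply: le_trans (_ : \int[@area R]_(z in B' `\` B)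
    ((((2 `^ (g%:R * p)) ^+ n)^-1)%:E * (omega (N z))%:E) <= _)%E; last first.
    apply: ge0_subset_integral => //; first by apply: measurable_funeM; exact: mo.
    move=> z /box1 z1; rewrite mule_ge0 ?lee_fin ?invr_ge0 ?(ltW gpn)//.
    by rewrite omega_ge0// normc_ge0.
  have sB : B' `\` B `<=` B' by move=> z [].
  apply: ge0_le_integral => //.
  - by move=> z /sB/box1/F0.
  - exact: measurable_funS mB' sB (@mFd _).
  - by apply: measurable_funeM; exact: measurable_funS mB' sB (@mo _).
  - move=> z [[z1 _] nB]; rewrite -EFinM lee_fin ler_wpM2r ?omega_ge0 ?normc_ge0//.
    rewrite normc_kernel_pow// pow2_gp; have d0 := normc_one_sub_conj_gt0 a1 z1.
    have p2 : 0 < 2 ^+ n :> R by rewrite exprn_gt0.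
    have ge : 2 ^+ n * (1 - N a) <= N (1 - conjc a * z).
      by rewrite leNgt; apply/negP => h; apply: nB; split.
    rewrite -powR_invl//.
    apply: ge0_ler_powR; rewrite ?nnegrE ?invr_ge0 ?(ltW p2) ?(ltW gp0)//.
      by rewrite divr_ge0 ?(ltW b0) ?(ltW d0).
    by rewrite ler_pdivrMr// ler_pdivlMl.
apply: le_trans (leeD IH sh) _.
have -> : box_const * (4 * C1) * (2 - 2 ^- n.+1) * tau a =
  box_const * (4 * C1) * (2 - 2 ^- n) * tau a + box_const * (2 * C1) * 2 ^- n * tau a.
  by rewrite exprS invfM; field; rewrite gt_eqF// exprn_gt0.
rewrite EFinD leeD2l//.
apply: (@le_trans _ _ ((((2 `^ (g%:R * p)) ^+ n)^-1)%:E *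
   (box_const * (2 * C1) ^+ n.+1 * tau a)%:E)%E).
  apply: lee_wpmul2l; first by rewrite lee_fin invr_ge0 ltW.
  exact: (carleson_box_mass dw n.+1 a1).
rewrite -EFinM lee_fin.
have c4 : ((2 `^ (g%:R * p)) ^+ n)^-1 <= ((4 * C1) ^+ n)^-1.
  rewrite lef_pV2 ?posrE// ?exprn_gt0 ?mulr_gt0//.
  by apply: lerXn2r g_large; rewrite ?nnegrE ?powR_ge0 ?mulr_ge0 ?(ltW C10).
apply: le_trans (ler_wpM2r _ c4) _.
  apply: mulr_ge0 (ltW ta); apply: mulr_ge0; first exact: ltW box_const_gt0.
  by rewrite exprn_ge0// mulr_ge0// ltW.
have -> : 4 * C1 = 2 * (2 * C1) by ring.
rewrite [X in X^-1]exprMn invfM exprS.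
have -> : 2 ^- n * (2 * C1) ^- n * (box_const * (2 * C1 * (2 * C1) ^+ n) * tau a) =
  box_const * (2 * C1) * 2 ^- n * tau a * ((2 * C1) ^- n * (2 * C1) ^+ n) by ring.
by rewrite mulVf ?mulr1// gt_eqF// exprn_gt0// mulr_gt0.
Qed.

Lemma kernel_pow_integral a : N a < 1 ->
  (bergman_int omega p (kernel_pow g a) <= (box_const * (4 * C1) * 2 * tau a)%:E)%E.
Proof.
move=> a1; have b0 : 0 < 1 - N a by lra.
have ta := tau_gt0 dw a1.
pose n := (Num.truncn (2 / (1 - N a))).+1.
have hn : 2 < 2 ^+ n * (1 - N a).
  rewrite -ltr_pdivrMr//; apply: lt_le_trans (truncnS_gt _) _.
  by rewrite -natrX ler_nat ltnW// ltn_expl.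
have -> : bergman_int omega p (kernel_pow g a) =
  (\int[@area R]_(z in box a (2 ^+ n * (1 - N a))) (N (kernel_pow g a z) `^ p * omega (N z))%:E)%E.
  congr integral; apply/seteqP; split => [z z1|z []//]; split => //.
  apply: le_lt_trans (le_normcD _ _) _; apply: le_lt_trans hn.
  rewrite normc1 normcN normcM normc_conj.
  have := normc_ge0 a; have := normc_ge0 z; rewrite /disc /mkset in z1; nra.
apply: le_trans (kernel_pow_box n a1) _; rewrite lee_fin ler_wpM2r ?(ltW ta)//.
apply: ler_wpM2l; last by rewrite gerBl invr_ge0 exprn_ge0.
by apply: mulr_ge0 (ltW box_const_gt0) _; rewrite mulr_ge0// ltW.
Qed.

(** The kernel decays faster than [tau]: this makes the normalized kernels tend
    to zero locally uniformly. *)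
Lemma pow_le_tau b : 0 < b <= 1 ->
  b `^ (g%:R * p) <= 2 `^ (g%:R * p) / what 0 * b * (b * what (1 - b)).
Proof.
move=> /andP[b0 b1].
have exP : exists n, (1 <= 2 ^+ n * b).
  exists (Num.truncn b^-1).+1; rewrite -ler_pdivrMr// div1r.
  apply: le_trans (ltW (truncnS_gt _)) _; rewrite -natrX ler_nat.
  by apply: ltnW; exact: ltn_expl.
(* With [n] least, [2 ^ n b] lies between 1 and 2. *)
case: (ex_minnP exP) => n hn minn.
have w0 : 0 < what 0 by apply: (what_gt0 rw); rewrite lexx ltr01.
have wb : 0 < what (1 - b) by apply: (what_gt0 rw); apply/andP; split; lra.
have n2 : 2 ^+ n * b <= 2.
  case: n minn {hn} => [|n] minn; first by rewrite expr0; lra.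
  rewrite exprS -mulrA -[leRHS]mulr1 ler_wpM2l// leNgt; apply/negP => /ltW/minn.
  by rewrite ltnn.
have dd : what 0 <= C1 ^+ n * what (1 - b).
  apply: (what_doubling dw); rewrite ?lexx ?ltr01//; first by apply/andP; split; lra.
  by rewrite subr0 opprB addrC subrK.
have p2 : 0 < 2 ^+ n :> R by rewrite exprn_gt0.
have bn : b `^ (g%:R * p) <= 2 `^ (g%:R * p) * ((4 * C1) ^+ n)^-1.
  have b2 : b <= 2 * (2 ^+ n)^-1 by rewrite ler_pdivlMr// mulrC.
  have := ge0_ler_powR (ltW gp0) _ _ b2.
  rewrite !nnegrE (ltW b0) mulr_ge0 ?invr_ge0 ?(ltW p2)// => /(_ isT isT) h.
  apply: le_trans h _; rewrite powRM ?invr_ge0 ?(ltW p2)// ler_wpM2l ?powR_ge0//.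
  rewrite powR_invl// -pow2_gp.
  rewrite lef_pV2 ?posrE ?exprn_gt0 ?mulr_gt0 ?powR_gt0//.
  by apply: lerXn2r g_large; rewrite ?nnegrE ?powR_ge0 ?mulr_ge0 ?(ltW C10).
apply: le_trans bn _.
have -> : 2 `^ (g%:R * p) / what 0 * b * (b * what (1 - b)) =
  2 `^ (g%:R * p) * (b * b * what (1 - b) / what 0) by ring.
rewrite ler_wpM2l ?powR_ge0// ler_pdivlMr// ler_pdivrMl ?exprn_gt0 ?mulr_gt0//.
have -> : (4 * C1) ^+ n = 2 ^+ n * 2 ^+ n * C1 ^+ n by rewrite -!exprMn; congr (_ ^+ _); ring.
apply: le_trans dd _.
have -> : 2 ^+ n * 2 ^+ n * C1 ^+ n * (b * b * what (1 - b)) =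
  (2 ^+ n * b) * (2 ^+ n * b) * (C1 ^+ n * what (1 - b)) by ring.
rewrite ler_peMl// ?mulr_ge0 ?exprn_ge0 ?(ltW C10) ?(ltW wb)//.
by nra.
Qed.

End test_functions.

(** The kernels divided by the [p]-th root of the bound for their integral: unit
    vectors that are large on a pseudohyperbolic disc about [a], and that tend to
    zero uniformly on compact sets as [a] tends to the boundary. *)
Lemma test_functions (R : realType) (omega : R -> R) (C1 : R) (m : nat) (C2 p : R) :
  doubling_weight omega C1 m C2 -> 0 < p ->
  exists (c D G : R) (h : R[i] -> R[i] -> R[i]), [/\ 0 < c, 0 < D, 0 < G &
    forall a, normc a < 1 -> [/\ analytic_in_disc (h a),
      (bergman_int omega p (h a) <= 1)%E,
      (forall z, Delta a (Delta_radius R m) z -> c / tau omega a <= normc (h a z) `^ p) &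
      (forall z, normc z < 1 ->
        normc (h a z) `^ p <= D * (1 - normc a) / (1 - normc z) `^ G)]].
Proof.
move=> dw p0; have [rw C11 C21 _ _] := dw.
have C10 : 0 < C1 by exact: lt_le_trans ltr01 C11.
have [_ kappa0] := area_unit_disc R.
have [g g4] := large_power p0 (4 * C1).
have gp0 : 0 < g%:R * p.
  rewrite ltNge; apply/negP => h.
  have : 2 `^ (g%:R * p) <= 2 `^ 0 :> R by apply: ler_powR h; rewrite ler1n.
  rewrite powRr0; have := g4; lra.
have /andP[r0 r1] := Delta_radius01 R m; set r := Delta_radius R m in r0 r1 *.
have r2 : 0 < (1 - r ^+ 2) / 4 by rewrite divr_gt0//; nra.
pose K := box_const C1 * (4 * C1) * 2.
have K0 : 0 < K by apply: mulr_gt0 => //; apply: mulr_gt0; [exact: (box_const_gt0 dw)|exact: mulr_gt0].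
have w0 : 0 < omega_hat omega 0 by apply: (what_gt0 rw); rewrite lexx ltr01.
pose k a := real_complex R ((K * tau omega a) `^ (- p^-1)).
exists (((1 - r ^+ 2) / 4) `^ (g%:R * p) / K), (2 `^ (g%:R * p) / omega_hat omega 0 / K), (g%:R * p).
exists (fun a z => k a * kernel_pow g a z); split => //.
- by rewrite divr_gt0// powR_gt0.
- by rewrite !divr_gt0// powR_gt0.
move=> a a1; have ta := tau_gt0 dw a1; have Kt : 0 < K * tau omega a by rewrite mulr_gt0.
have kE z : normc (k a * kernel_pow g a z) `^ p = (K * tau omega a)^-1 * normc (kernel_pow g a z) `^ p.
  rewrite normcM powRM ?normc_ge0//; congr (_ * _).
  rewrite normc_real ger0_norm ?powR_ge0// -powRrM mulNr mulVf ?gt_eqF//.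
  by rewrite powR_inv1// ltW.
have b0 : 0 < 1 - normc a by lra.
have na := normc_ge0 a.
split.
- apply/analyticP => z z1; have [c hc] := (analyticP (kernel_pow g a)).1 (kernel_pow_analytic a1) z z1.
  by exists (k a * c); exact: has_cderivZ.
- rewrite /bergman_int; under eq_integral do rewrite kE -mulrA EFinM.
  rewrite ge0_integralZl_EFin//; last 4 first.
  - exact: measurable_disc.
  - by move=> z z1; rewrite lee_fin bergman_integrand_ge0.
  - by apply: (measurable_bergman_integrand _ rw); exact: kernel_pow_analytic.
  - by rewrite invr_ge0 ltW.
  apply: (@le_trans _ _ (((K * tau omega a)^-1)%:E * (K * tau omega a)%:E)%E).
    apply: lee_wpmul2l; first by rewrite lee_fin invr_ge0 ltW.
    exact: (kernel_pow_integral dw g4 a1).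
  by rewrite -EFinM mulVf ?gt_eqF.
- move=> z Dz; have z1 : normc z < 1 by case: Dz.
  rewrite kE normc_kernel_pow// -mulrA -invfM mulrC ler_wpM2l ?invr_ge0 ?(ltW Kt)//.
  have d0 := normc_one_sub_conj_gt0 a1 z1.
  apply: ge0_ler_powR; rewrite ?nnegrE ?(ltW r2) ?(ltW gp0)//.
    by rewrite divr_ge0// ltW.
  have := Delta_one_sub_conj (Delta_radius01 R m) a1 Dz; rewrite -/r => h.
  rewrite ler_pdivlMr//; apply: le_trans (ler_wpM2l (ltW r2) h) _.
  have r2' : 1 - r ^+ 2 != 0 by rewrite gt_eqF//; move: r2; lra.
  by rewrite le_eqVlt; apply/orP; left; apply/eqP; field.
- move=> z z1; rewrite kE normc_kernel_pow//.
  have d0 := normc_one_sub_conj_gt0 a1 z1; have z0 : 0 < 1 - normc z by lra.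
  have q : (1 - normc a) / normc (1 - conjc a * z) <= (1 - normc a) / (1 - normc z).
    rewrite ler_wpM2l ?(ltW b0)// lef_pV2 ?posrE//.
    apply: le_trans (normc_one_sub_conj_ge a z).
    by rewrite lerD2l lerN2 ler_piMl ?normc_ge0// ltW.
  have := ge0_ler_powR (ltW gp0) _ _ q; rewrite !nnegrE !divr_ge0 ?(ltW b0) ?(ltW d0) ?(ltW z0)//.
  move=> /(_ isT isT) h.
  apply: le_trans (ler_wpM2l _ h) _; first by rewrite invr_ge0 ltW.
  rewrite powRM ?invr_ge0 ?(ltW b0) ?(ltW z0)//.
  rewrite powR_invl// mulrA ler_wpM2r ?invr_ge0 ?powR_ge0//.
  rewrite ler_pdivrMl//.
  have b01 : 0 < 1 - normc a <= 1 by rewrite b0/=; lra.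
  apply: le_trans (pow_le_tau dw g4 b01) _.
  have -> : 1 - (1 - normc a) = normc a by ring.
  rewrite /tau le_eqVlt; apply/orP; left; apply/eqP; field.
  by rewrite !gt_eqF.
Qed.
(** * The embedding under the disc condition *)

(** The indices lie in a window of length [m] that starts at the least of them. *)
Lemma count_window n m (P : nat -> bool) :
  (forall k k', P k -> P k' -> k' < k + m)%N -> (\sum_(k < n) (P k : nat) <= m)%N.
Proof.
move=> Pm; have [/existsP[k0 Pk0]|/existsPn nP] := boolP [exists k : 'I_n, P k]; last first.
  by rewrite big1// => k _; rewrite (negbTE (nP k)).
have exP : exists k, P k by exists (val k0).
case: (ex_minnP exP) => a Pa mina.
apply: (@leq_trans (\sum_(k < n) ((a <= k < a + m) : nat))).
  apply: leq_sum => k _; case: (boolP (P k)) => // Pk.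
  by rewrite mina//= Pm.
have -> : (\sum_(k < n) ((a <= k < a + m)%N : nat) = \sum_(0 <= k < n) ((a <= k < a + m)%N : nat))%N.
  by rewrite big_mkord.
have -> : (\sum_(0 <= k < n) ((a <= k < a + m)%N : nat) =
    count (fun k => a <= k < a + m) (index_iota 0 n))%N by rewrite -sum1_count [RHS]big_mkcond.
rewrite -size_filter -[leqRHS](size_iota a m); apply: uniq_leq_size.
  by rewrite filter_uniq// iota_uniq.
by move=> k; rewrite mem_filter mem_iota => /andP[].
Qed.

Lemma ge0_integral_le_measure d (T : measurableType d) (R : realType)
    (nu : {measure set T -> \bar R}) (D : set T) (g : T -> R) (B : R) :
  measurable D -> measurable_fun D g -> 0 <= B -> (forall z, D z -> 0 <= g z <= B) ->
  (\int[nu]_(z in D) (g z)%:E <= B%:E * nu D)%E.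
Proof.
move=> mD mg B0 gB; rewrite -integral_cst//; apply: ge0_le_integral => //.
- by move=> z /gB/andP[g0 _]; rewrite lee_fin.
- exact/measurable_EFinP.
- by move=> z /gB/andP[_ h]; rewrite lee_fin.
Qed.

Section carleson_embedding.
Variables (R : realType) (omega : R -> R) (C1 : R) (m : nat) (C2 p : R).
Hypotheses (dw : doubling_weight omega C1 m C2) (p0 : 0 < p).
Local Notation C := R[i].
Local Notation N := (@normc R).
Local Notation Re := (@complex.Re R).
Local Notation Im := (@complex.Im R).
Local Notation what := (omega_hat omega).
Local Notation mass := (weight_mass omega).
Local Notation kappa := (unit_area R).
Local Notation tau := (tau omega).

Let rw : radial_weight omega. Proof. by case: dw. Qed.
Let C11 : 1 <= C1. Proof. by case: dw. Qed.
Let C10 : 0 < C1. Proof. exact: lt_le_trans ltr01 C11. Qed.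
Let kappa0 : 0 < kappa. Proof. by case: (area_unit_disc R). Qed.

Local Notation e_ k := ((2 ^+ k)^-1 : R).

Let e0 k : 0 < e_ k. Proof. by rewrite invr_gt0 exprn_gt0. Qed.
Let eS k : e_ k.+1 = e_ k / 2. Proof. by rewrite exprS invfM mulrC. Qed.
Let e1 k : e_ k <= 1. Proof. by rewrite invf_le1 ?exprn_gt0// exprn_ege1// ler1n. Qed.
Let e_le k l : (k <= l)%N -> e_ l <= e_ k.
Proof. by move=> kl; rewrite lef_pV2 ?posrE ?exprn_gt0// ler_weXn2l// ler1n. Qed.
Let e_lt k l : e_ l < e_ k -> (k < l)%N.
Proof. by rewrite ltNge => h; rewrite ltnNge; apply: contra h; exact: e_le. Qed.

(** The dyadic decomposition of the disc: functions on [dyadic_ring k] are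
    controlled by their averages over [dyadic_collar k], and those, by
    subharmonicity, by their weighted averages over [dyadic_outer k]. *)
Definition dyadic_ring k : set C := annulus (1 - e_ k) (1 - e_ k.+1).
Definition dyadic_collar k : set C := annulus (Num.max 0 (1 - 2 * e_ k)) (1 - e_ k.+2).
Definition dyadic_outer k : set C := annulus (1 - e_ k.+2) (1 - e_ (k.+2 + m)).
Definition ring_mass k : R := e_ k * what (1 - e_ k).

Lemma ring_mass_gt0 k : 0 < ring_mass k.
Proof.
rewrite mulr_gt0// (what_gt0 rw)//; have := e0 k; have := e1 k => h1 h2.
by apply/andP; split; lra.
Qed.

Lemma tau_le_ring_mass k a : dyadic_ring k a -> tau a <= ring_mass k.
Proof.
move=> /andP[a1 a2]; have := e0 k.+1; have := e0 k; have := e1 k => h1 h2 h3.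
have na : N a < 1 by lra.
have -> : tau a = (1 - N a) * what (N a) by [].
rewrite /ring_mass; apply: ler_pM; rewrite ?subr_ge0 ?(ltW na)//.
- by rewrite ltW// (what_gt0 rw)// normc_ge0.
- lra.
- by apply: (what_mono rw); lra.
Qed.

Definition collar_const : R := 4 * C1 / gap_const C1 C2.

Lemma collar_const_gt0 : 0 < collar_const.
Proof. by apply: divr_gt0; [exact: mulr_gt0|exact: gap_const_gt0 dw]. Qed.

Lemma area_collar k : (area R (dyadic_collar k) <= (4 * kappa * e_ k)%:E)%E.
Proof.
have := e0 k.+2; have := e0 k; have := e1 k => h1 h2 h3.
have ss : 0 <= Num.max 0 (1 - 2 * e_ k) by rewrite le_max lexx.
have t1 : 1 - e_ k.+2 <= 1 by lra.
have := @integral_annulus_le R (fun=> 1) (Num.max 0 (1 - 2 * e_ k)) _ t1 _ _.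
rewrite integral_cst ?mul1e; last exact: measurable_annulus.
move=> H; apply: le_trans (H _ _) _ => //.
rewrite integral_cst//= lebesgue_measure_itv/= mul1e.
case: ifPn => _; last by rewrite mule0 lee_fin mulr_ge0 ?mulr_ge0 ?ltW.
rewrite -EFinB -EFinM lee_fin.
have -> : 4 * kappa * e_ k = 2 * kappa * (2 * e_ k) by ring.
rewrite ler_wpM2l ?mulr_ge0 ?(ltW kappa0)//.
have : 1 - 2 * e_ k <= Num.max 0 (1 - 2 * e_ k) by rewrite le_max lexx orbT.
lra.
Qed.

Lemma outer_mass_ge k : exists2 w : R, mass (dyadic_outer k) = w%:E &
  kappa * (gap_const C1 C2 / C1) * what (1 - e_ k) <= w.
Proof.
have := e0 k.+1; have := e0 k; have := e1 k; have := e1 k.+1; have := eS k; have := eS k.+1.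
move=> q1 q2 h1 h2 h3 h4.
pose r := 1 - e_ k.+1.
have r01 : 0 <= r < 1 by apply/andP; rewrite /r; split; lra.
have sE : 1 - e_ k.+2 = (1 + r) / 2 by rewrite /r; lra.
have tE : 1 - e_ (k.+2 + m) = 1 - (1 - r) / (2 * 2 ^+ m).
  rewrite /r; have -> : 1 - (1 - e_ k.+1) = e_ k.+1 by ring.
  by rewrite exprD (exprS _ k.+1); field; rewrite !expf_neq0.
have st : 1 - e_ k.+2 <= 1 - e_ (k.+2 + m) by rewrite lerD2l lerN2 e_le// leq_addr.
have t1 : 1 - e_ (k.+2 + m) <= 1 by rewrite lerBlDr lerDl ltW.
have s2 : 1 / 2 <= 1 - e_ k.+2 by lra.
have s0 : 0 <= 1 - e_ k.+2 by lra.
have fin := mass_annulus_fin rw s0 st t1.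
exists (fine (mass (dyadic_outer k))); first by rewrite fineK.
rewrite -lee_fin fineK//; apply: le_trans (annulus_mass_ge rw s2 st t1).
rewrite lee_fin -mulrA ler_wpM2l ?(ltW kappa0)// sE tE.
apply: le_trans (what_gap dw r01).
rewrite -mulrA ler_wpM2l ?(ltW (gap_const_gt0 dw))// ler_pdivrMl//.
rewrite -[C1]expr1; apply: (what_doubling dw) => //.
  by apply/andP; split; lra.
by rewrite expr1 /r; lra.
Qed.

Section one_function.
Variables (f : C -> C) (k : nat) (F : R).
Hypotheses (af : analytic_in_disc f)
  (fF : (\int[area R]_(z in dyadic_outer k) (N (f z) `^ p * omega (N z))%:E <= F%:E)%E).

Let F0 : 0 <= F.
Proof.
rewrite -lee_fin; apply: le_trans fF; apply: integral_ge0 => z Bz.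
rewrite lee_fin (bergman_integrand_ge0 _ _ rw)//.
have := e0 (k.+2 + m); case/andP: Bz; lra.
Qed.

(** The outer annulus surrounds the collar, so averages over the collar are at most
    weighted averages over the outer annulus; the collar has area at most
    of order [2 ^- k], and the mass of the outer annulus is at least of order
    [what (1 - 2 ^- k)]. *)
Lemma collar_integral_le :
  (\int[area R]_(z in dyadic_collar k) (N (f z) `^ p)%:E <=
    (collar_const * e_ k ^+ 2 * (F / ring_mass k))%:E)%E.
Proof.
have [w wE wge] := outer_mass_ge k.
have := e0 (k.+2 + m); have := e0 k.+2; have := e0 k; have := e1 k; have := e1 k.+2; have := e1 (k.+2 + m).
move=> b1 b2 b3 b4 b5 b6.
have wk : 0 < what (1 - e_ k) by apply: (what_gt0 rw); apply/andP; split; lra.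
have g0 := gap_const_gt0 dw.
have gc : 0 < kappa * (gap_const C1 C2 / C1) * what (1 - e_ k).
  by apply: mulr_gt0 => //; apply: mulr_gt0 => //; exact: divr_gt0.
have w0 : 0 < w by exact: lt_le_trans wge.
have c1 : dyadic_collar k `<=` @disc R by apply: annulus_disc; lra.
have o1 : dyadic_outer k `<=` @disc R by apply: annulus_disc; lra.
have t01 : 0 <= 1 - e_ (k.+2 + m) < 1 by apply/andP; split; lra.
have := @average_le_annulus R f p omega (dyadic_collar k) (4 * kappa * e_ k)
  (1 - e_ k.+2) (1 - e_ (k.+2 + m)) w F p0 af t01 w0.
move=> H; apply: le_trans (H _ _ _ _ _ _ _ _ _) _ => //.
- by move=> x /andP[x1 x2]; apply: (omega_ge0 rw); apply/andP; split; lra.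
- by apply: measurable_funS o1 (measurable_omega_disc rw); exact: measurable_disc.
- exact: measurable_annulus.
- by move=> z /andP[_ /ltW].
- by move=> u z u1; exact: annulus_rot.
- exact: area_collar.
rewrite lee_fin /ring_mass /collar_const.
have -> : 4 * C1 / gap_const C1 C2 * e_ k ^+ 2 * (F / (e_ k * what (1 - e_ k))) =
  4 * kappa * e_ k * (F / (kappa * (gap_const C1 C2 / C1) * what (1 - e_ k))).
  by field; rewrite !gt_eqF// exprn_gt0.
rewrite ler_wpM2l ?mulr_ge0 ?(ltW kappa0) ?(ltW b3)//.
by apply: ler_wpM2l => //; rewrite lef_pV2 ?posrE.
Qed.

Lemma ring_ball_sub z : dyadic_ring k z ->
  [set w | N (w - z) < e_ k.+2] `<=` dyadic_collar k.
Proof.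
move=> /andP[z1 z2] w /= wz; have := eS k; have := eS k.+1; have := e0 k => h q1 q2.
have := normc_dist_abs w z; rewrite ler_norml => /andP[h1 h2].
apply/andP; split; last by lra.
by rewrite ge_max normc_ge0/=; lra.
Qed.

(** The mean over the ball of radius [2 ^- k.+2] about a point of the ring; [D] is a
    square below, and the whole collar in [ring_pointwise]. *)
Lemma ring_local_mean z (D : set C) (J : R) : dyadic_ring k z -> measurable D ->
  [set w | N (w - z) < e_ k.+2] `<=` D -> D `<=` dyadic_collar k ->
  (\int[area R]_(w in D) (N (f w) `^ p)%:E <= J%:E)%E ->
  N (f z) `^ p * (kappa / 64 * e_ k ^+ 2) <= J.
Proof.
move=> kz mD zD Dk DJ; have := eS k; have := eS k.+1; have := e0 k => h q1 q2.
have -> : kappa / 64 * e_ k ^+ 2 = kappa / 4 * e_ k.+2 ^+ 2 by rewrite q1 q2; field; rewrite expf_neq0.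
have c1 : dyadic_collar k `<=` @disc R by apply: annulus_disc; have := e0 k.+2; lra.
apply: local_mean => //; first by case/andP: kz; lra.
apply: le_trans DJ; apply: ge0_subset_integral => //.
- rewrite (_ : [set w | _] = (fun w : C => N (w - z)) @^-1` `]-oo, (e_ k.+2)[); last first.
    by apply/seteqP; split => w; rewrite /= in_itv.
  rewrite -[X in measurable X]setTI.
  have mz : measurable_fun setT (fun w : C => N (w - z)).
    apply: (measurableT_comp (@measurable_normc R)); apply: (@lipschitz_measurableC _ _ 1) => w w'.
    by rewrite mul1r opprB addrA subrK.
  by apply: mz => //; exact: measurable_itv.
- apply/measurable_EFinP; apply: measurable_funS (measurable_abspow p af); first exact: measurable_disc.
  exact: subset_trans Dk c1.
- by move=> w _; rewrite lee_fin powR_ge0.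
Qed.

Definition ring_const : R := 64 * collar_const / kappa.

Lemma ring_const_gt0 : 0 < ring_const.
Proof. by rewrite divr_gt0// mulr_gt0// collar_const_gt0. Qed.

Lemma ring_pointwise z : dyadic_ring k z -> N (f z) `^ p <= ring_const * F / ring_mass k.
Proof.
move=> kz; have := ring_local_mean kz (@measurable_annulus _ _ _) (ring_ball_sub kz)
  (@subset_refl _ _) collar_integral_le.
rewrite -ler_pdivlMr ?mulr_gt0 ?divr_gt0 ?exprn_gt0// => h.
apply: le_trans h _; rewrite le_eqVlt; apply/orP; left; apply/eqP.
rewrite /ring_const; field.
by rewrite !gt_eqF ?ring_mass_gt0 ?exprn_gt0.
Qed.

End one_function.

(** Squares of side [2 ^- k.+2], each contained in one pseudohyperbolic disc,
    cover [dyadic_ring k]. *)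
Definition grid_point k (i : nat) : R := -1 + (i%:R + 1 / 2) * e_ k.+2.
Definition grid_cell k (d : R) (ij : nat * nat) : set C :=
  [set z | `|Re z - grid_point k ij.1| <= d * e_ k.+2 /\
           `|Im z - grid_point k ij.2| <= d * e_ k.+2].

Lemma measurable_grid_cell k d ij : measurable (grid_cell k d ij).
Proof.
have H (h : C -> R) c : measurable_fun setT h -> measurable [set z | `|h z - c| <= d * e_ k.+2].
  move=> mh; rewrite (_ : [set z | _] = h @^-1` `[c - d * e_ k.+2, c + d * e_ k.+2]); last first.
    by apply/seteqP; split => z; rewrite /= in_itv /= ler_distl.
  by rewrite -[X in measurable X]setTI; apply: mh => //; exact: measurable_itv.
by apply: measurableI; apply: H; [exact: measurable_Re|exact: measurable_Im].
Qed.

Lemma grid_cover k z : N z < 1 ->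
  exists ij : 'I_(2 ^ k.+3) * 'I_(2 ^ k.+3), grid_cell k (1 / 2) (val ij.1, val ij.2) z.
Proof.
have H x : `|x| < 1 -> exists i : 'I_(2 ^ k.+3), `|x - grid_point k i| <= 1 / 2 * e_ k.+2.
  rewrite ltr_norml => /andP[x1 x2]; have h := e0 k.+2.
  pose y := (x + 1) / e_ k.+2.
  have y0 : 0 <= y by rewrite divr_ge0 ?(ltW h)//; lra.
  have yx : y * e_ k.+2 = x + 1 by rewrite divfK// gt_eqF.
  have /andP[t1 t2] := truncn_itv y0.
  have yn : (Num.truncn y < 2 ^ k.+3)%N.
    rewrite -(ltr_nat R) natrX; apply: le_lt_trans t1 _.
    rewrite /y ltr_pdivrMr// exprS mulfK ?expf_neq0//; lra.
  exists (Ordinal yn); rewrite /grid_point /=.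
  have -> : x = y * e_ k.+2 - 1 by lra.
  rewrite ler_norml; apply/andP; split.
    have := ler_wpM2r (ltW h) t1; lra.
  have := ler_wpM2r (ltW h) (ltW t2); rewrite -[(Num.truncn y).+1%:R]natr1; lra.
move=> z1; have [i hi] := H (Re z) (le_lt_trans (Defs.normc_ge_Re z) z1).
have [j hj] := H (Im z) (le_lt_trans (Defs.normc_ge_Im z) z1).
by exists (i, j).
Qed.

Lemma grid_cell_dist k d ij z w : grid_cell k d ij z -> grid_cell k d ij w ->
  N (z - w) <= 4 * d * e_ k.+2.
Proof.
move=> [z1 z2] [w1 w2]; apply: le_trans (normc_le_ReIm _) _; rewrite cReB cImB.
have := ler_distD (grid_point k ij.1) (Re z) (Re w).
have := ler_distD (grid_point k ij.2) (Im z) (Im w).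
have := distrC (grid_point k ij.1) (Re w); have := distrC (grid_point k ij.2) (Im w); lra.
Qed.

Lemma grid_cell_ball k ij z w : grid_cell k (1 / 2) ij z -> N (w - z) < e_ k.+2 ->
  grid_cell k (3 / 2) ij w.
Proof.
move=> [z1 z2] wz; have := Defs.normc_ge_Re (w - z); have := Defs.normc_ge_Im (w - z).
rewrite cReB cImB => h1 h2; split.
  have := ler_distD (Re z) (Re w) (grid_point k ij.1); lra.
have := ler_distD (Im z) (Im w) (grid_point k ij.2); lra.
Qed.

Lemma grid_count k n z :
  (\sum_(ij : 'I_n * 'I_n) (z \in grid_cell k (3 / 2) (val ij.1, val ij.2) : nat) <= 16)%N.
Proof.
pose P (x : R) (i : nat) := `|x - grid_point k i| <= 3 / 2 * e_ k.+2.
have H x : (\sum_(i < n) (P x i : nat) <= 4)%N.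
  apply: count_window => i j; rewrite /P !ler_distl /grid_point => /andP[i1 i2] /andP[j1 j2].
  rewrite -(ltr_nat R) natrD -(ltr_pM2r (e0 k.+2)); have := e0 k.+2; lra.
have -> : (\sum_(ij : 'I_n * 'I_n) (z \in grid_cell k (3 / 2) (val ij.1, val ij.2) : nat) =
  \sum_(ij : 'I_n * 'I_n) (P (Re z) ij.1 : nat) * (P (Im z) ij.2 : nat))%N.
  apply: eq_bigr => ij _; rewrite mulnb; congr nat_of_bool.
  by apply/idP/andP; rewrite inE.
rewrite -(pair_bigA _ (fun i j : 'I_n => (P (Re z) i : nat) * (P (Im z) j : nat))%N)/=.
under eq_bigr do rewrite -big_distrr/=.
rewrite -big_distrl/=; exact: leq_mul (H _) (H _).
Qed.

Section embedding.
Variables (q S : R) (mu : {measure set C -> \bar R}) (f : C -> C).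
Hypotheses (pq : p <= q) (S0 : 0 <= S) (af : analytic_in_disc f)
  (muS : forall a, N a < 1 ->
    (mu (Delta a (Delta_radius R m)) <= (S * tau a `^ (q / p))%:E)%E).

Let s1 : 0 <= q / p - 1. Proof. by rewrite subr_ge0 ler_pdivlMr// mul1r. Qed.

Lemma abspow_qE x : 0 <= x -> x `^ q = x `^ p * (x `^ p) `^ (q / p - 1).
Proof.
rewrite le_eqVlt => /predU1P[<-|x0].
  have pn : p != 0 by rewrite gt_eqF.
  have qn : q != 0 by rewrite gt_eqF// (lt_le_trans p0).
  by rewrite (powR0 qn) (powR0 pn) mul0r.
rewrite -powRrM -powRD; last by rewrite (gt_eqF x0) implybT.
by congr (_ `^ _); field; rewrite gt_eqF.
Qed.

Lemma cell_measure_le k ij :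
  (mu (dyadic_ring k `&` grid_cell k (1 / 2) ij) <= (S * ring_mass k `^ (q / p))%:E)%E.
Proof.
set Q := _ `&` _; have mQ : measurable Q.
  by apply: measurableI; [exact: measurable_annulus|exact: measurable_grid_cell].
have [->|/set0P[a [ak aQ]]] := eqVneq Q set0.
  by rewrite measure0 lee_fin mulr_ge0// powR_ge0.
have h := e0 k; have q1 := eS k; have q2 := eS k.+1.
have a1 : N a < 1 by case/andP: ak; lra.
apply: (@le_trans _ _ (mu (Delta a (Delta_radius R m)))).
  apply: le_measure; rewrite ?inE//; first exact: measurable_Delta.
  move=> z [zk zQ]; have p1 : 1 <= 2 ^+ m :> R by rewrite exprn_ege1// ler1n.
  case/andP: ak => a2 a3; case/andP: zk => z2 z3.
  apply: whitney_sub_Delta => //.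
    by have := grid_cell_dist zQ aQ; lra.
  apply: le_trans (_ : (1 - N a) / 2 <= _); last by lra.
  by rewrite ler_wpM2l ?subr_ge0 ?(ltW a1)// lef_pV2 ?posrE//; lra.
apply: le_trans (muS a1) _; rewrite lee_fin; apply: ler_wpM2l; first exact: S0.
apply: ge0_ler_powR; rewrite ?nnegrE ?(ltW (tau_gt0 dw a1)) ?(ltW (ring_mass_gt0 k))//.
  by have := s1; lra.
exact: tau_le_ring_mass.
Qed.

(** On a cell, [|f| ^ q] is at most a power of the pointwise bound times a local
    mean of [|f| ^ p]. These local means are over squares that meet each point
    at most 16 times, so they add up to an average over the collar. *)
Lemma ring_integral_le k F :
  (\int[area R]_(z in dyadic_outer k) (N (f z) `^ p * omega (N z))%:E <= F%:E)%E ->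
  (\int[mu]_(z in dyadic_ring k) (N (f z) `^ q)%:E <=
    (16 * S * (ring_const * F) `^ (q / p))%:E)%E.
Proof.
move=> fF; have F0 : 0 <= F.
  rewrite -lee_fin; apply: le_trans fF; apply: integral_ge0 => z Bz.
  rewrite lee_fin (bergman_integrand_ge0 _ _ rw)//.
  have := e0 (k.+2 + m); case/andP: Bz; lra.
have h := e0 k; have q1 := eS k; have q2 := eS k.+1; have T0 := ring_mass_gt0 k.
have r1 : dyadic_ring k `<=` @disc R by apply: annulus_disc; lra.
have c1 : dyadic_collar k `<=` @disc R by apply: annulus_disc; lra.
pose n := (2 ^ k.+3)%N.
pose G (ij : 'I_n * 'I_n) := grid_cell k (1 / 2) (val ij.1, val ij.2).
pose G3 (ij : 'I_n * 'I_n) := grid_cell k (3 / 2) (val ij.1, val ij.2).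
have mq : measurable_fun (dyadic_ring k) (fun z => N (f z) `^ q).
  by apply: measurable_funS r1 (measurable_abspow q af); exact: measurable_disc.
have mp : measurable_fun (dyadic_collar k) (fun z => N (f z) `^ p).
  by apply: measurable_funS c1 (measurable_abspow p af); exact: measurable_disc.
apply: le_trans.
  apply: (@integral_le_cover _ _ _ mu _ (dyadic_ring k) G (fun z => (N (f z) `^ q)%:E)).
  - exact: measurable_annulus.
  - by move=> ij; exact: measurable_grid_cell.
  - exact/measurable_EFinP.
  - by move=> z _; rewrite lee_fin powR_ge0.
  - by move=> z /r1 z1; exact: (grid_cover k z1).
pose X := ring_const * F / ring_mass k.
have X0 : 0 <= X by rewrite divr_ge0 ?(ltW T0)// mulr_ge0// ltW// ring_const_gt0.
pose J ij := (\int[area R]_(w in dyadic_collar k `&` G3 ij) (N (f w) `^ p)%:E)%E.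
have colF := collar_integral_le af fF.
have Jle ij : (J ij <= \int[area R]_(w in dyadic_collar k) (N (f w) `^ p)%:E)%E.
  apply: ge0_subset_integral => //.
  - by apply: measurableI; [exact: measurable_annulus|exact: measurable_grid_cell].
  - exact: measurable_annulus.
  - exact/measurable_EFinP.
  - by move=> z _; rewrite lee_fin powR_ge0.
have J0 ij : (0 <= J ij)%E by apply: integral_ge0 => z _; rewrite lee_fin powR_ge0.
have Jfin ij : J ij \is a fin_num.
  by rewrite ge0_fin_numE//; apply: le_lt_trans (le_trans (Jle ij) colF) _; rewrite ltry.
pose c := 64 / kappa / e_ k ^+ 2 * X `^ (q / p - 1) * (S * ring_mass k `^ (q / p)).
have c0 : 0 <= c by rewrite !mulr_ge0 ?powR_ge0 ?invr_ge0 ?sqr_ge0// ltW.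
have cell ij : (\int[mu]_(z in dyadic_ring k `&` G ij) (N (f z) `^ q)%:E <= c%:E * J ij)%E.
  have Jf0 : 0 <= fine (J ij) by rewrite fine_ge0.
  pose b := 64 / kappa / e_ k ^+ 2 * X `^ (q / p - 1) * fine (J ij).
  have b0 : 0 <= b by rewrite !mulr_ge0 ?powR_ge0 ?invr_ge0 ?sqr_ge0// ltW.
  have mrG : measurable (dyadic_ring k `&` G ij).
    by apply: measurableI; [exact: measurable_annulus|exact: measurable_grid_cell].
  apply: le_trans (ge0_integral_le_measure mu mrG _ b0 _) _.
  - by apply: measurable_funS mq => //; exact: measurable_annulus.
  - move=> z [zk zG]; rewrite powR_ge0/= abspow_qE ?normc_ge0//.
    have fz := ring_pointwise af fF zk.
    have mean : N (f z) `^ p * (kappa / 64 * e_ k ^+ 2) <= fine (J ij).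
      apply: (ring_local_mean af zk (D := dyadic_collar k `&` G3 ij)) => //.
      - by apply: measurableI; [exact: measurable_annulus|exact: measurable_grid_cell].
      - move=> w wz; split; first exact: (ring_ball_sub zk).
        exact: grid_cell_ball zG wz.
      - by rewrite fineK.
    have pos : 0 < kappa / 64 * e_ k ^+ 2 by rewrite mulr_gt0 ?divr_gt0// exprn_gt0.
    have -> : b = 64 / kappa / e_ k ^+ 2 * fine (J ij) * X `^ (q / p - 1) by rewrite /b; ring.
    apply: ler_pM; rewrite ?powR_ge0//; last first.
      by apply: ge0_ler_powR; rewrite ?nnegrE ?powR_ge0.
    have -> : 64 / kappa / e_ k ^+ 2 * fine (J ij) = fine (J ij) / (kappa / 64 * e_ k ^+ 2).
      by field; rewrite !gt_eqF// exprn_gt0.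
    by rewrite ler_pdivlMr.
  apply: (@le_trans _ _ (b%:E * (S * ring_mass k `^ (q / p))%:E)%E).
    by apply: lee_wpmul2l; [rewrite lee_fin|exact: cell_measure_le].
  rewrite -(fineK (Jfin ij)) -!EFinM lee_fin /b /c.
  by rewrite le_eqVlt; apply/orP; left; apply/eqP; ring.
apply: (@le_trans _ _ (\sum_ij (c%:E * J ij))%E); first by apply: lee_sum => ij _; exact: cell.
rewrite -ge0_sume_distrr//.
apply: (@le_trans _ _ (c%:E * (16%:R%:E * \int[area R]_(w in dyadic_collar k) (N (f w) `^ p)%:E))%E).
  apply: lee_wpmul2l; first by rewrite lee_fin.
  apply: (@sum_integral_le_count _ _ _ (area R) _ (dyadic_collar k) G3 (fun z => (N (f z) `^ p)%:E)).
  - exact: measurable_annulus.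
  - by move=> ij; exact: measurable_grid_cell.
  - exact/measurable_EFinP.
  - by move=> z _; rewrite lee_fin powR_ge0.
  - by move=> z _; exact: grid_count.
apply: (@le_trans _ _ (c%:E * (16%:R%:E * (collar_const * e_ k ^+ 2 * (F / ring_mass k))%:E))%E).
  apply: lee_wpmul2l; first by rewrite lee_fin.
  by apply: lee_wpmul2l; first by rewrite lee_fin.
rewrite -!EFinM lee_fin.
have XE : 64 / kappa * collar_const * (F / ring_mass k) = X.
  by rewrite /X /ring_const; field; rewrite !gt_eqF.
have XT : X `^ (q / p - 1) * X * ring_mass k `^ (q / p) = (ring_const * F) `^ (q / p).
  have -> : X `^ (q / p - 1) * X = X `^ (q / p).
    have := X0; rewrite le_eqVlt => /predU1P[<-|X1].
      by rewrite mulr0 powR0// gt_eqF// divr_gt0// (lt_le_trans p0).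
    rewrite -{2}[X]powRr1 ?(ltW X1)// -powRD ?subrK//.
    by rewrite (gt_eqF X1) implybT.
  rewrite -powRM ?(ltW T0)//; congr (_ `^ _).
  by rewrite /X divfK// gt_eqF.
rewrite /c -XT; set y := X `^ _; set t := ring_mass k `^ _.
rewrite -XE le_eqVlt; apply/orP; left; apply/eqP; field.
by rewrite !gt_eqF// exprn_gt0.
Qed.

Lemma disc_dyadic_rings : @disc R = \bigcup_k dyadic_ring k.
Proof.
apply/seteqP; split => [z z1|z [k _ /andP[_ h]]]; last first.
  by apply: lt_le_trans h _; rewrite lerBlDr lerDl ltW.
have exn : exists n, N z < 1 - e_ n.
  have b0 : 0 < 1 - N z by rewrite subr_gt0.
  exists (Num.truncn (1 - N z)^-1).+1; rewrite ltrBrDr -ltrBrDl -[ltRHS]invrK ltf_pV2 ?posrE ?invr_gt0 ?exprn_gt0//.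
  apply: lt_le_trans (truncnS_gt _) _; rewrite -natrX ler_nat.
  by apply: ltnW; exact: ltn_expl.
case: (ex_minnP exn) => -[|k] hk mink.
  by move: hk; rewrite expr0 invr1 subrr ltNge normc_ge0.
exists k => //; apply/andP; split => //; rewrite leNgt; apply/negP => /mink.
by rewrite ltnn.
Qed.

Lemma trivIset_dyadic_rings : trivIset setT dyadic_ring.
Proof.
have H k l z : dyadic_ring k z -> dyadic_ring l z -> (k <= l)%N.
  move=> /andP[k1 _] /andP[_ l2]; rewrite -ltnS; apply: e_lt.
  by have := le_lt_trans k1 l2; lra.
by move=> k l _ _ [z [zk zl]]; apply/eqP; rewrite eqn_leq !(H _ _ z).
Qed.

Lemma outer_count n z : (\sum_(k < n) (z \in dyadic_outer k : nat) <= m)%N.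
Proof.
apply: (@count_window n m (fun k => z \in dyadic_outer k)) => k l.
rewrite !inE => /andP[_ k2] /andP[l1 _].
by have := le_lt_trans l1 k2 => h; have /e_lt : e_ (k.+2 + m) < e_ l.+2 by lra.
Qed.

Lemma outer_integral_sum n F : (bergman_int omega p f <= F%:E)%E ->
  (\sum_(k < n) \int[area R]_(z in dyadic_outer k) (N (f z) `^ p * omega (N z))%:E
    <= (m%:R * F)%:E)%E.
Proof.
move=> fF; have o1 k : dyadic_outer k `<=` @disc R.
  by apply: annulus_disc; rewrite lerBlDr lerDl ltW.
apply: (@le_trans _ _ (m%:R%:E * bergman_int omega p f)%E); last first.
  by rewrite EFinM; apply: lee_wpmul2l; rewrite ?lee_fin.
apply: le_trans (sum_integral_le_count (area R) (@measurable_disc R) (F := fun k : 'I_n => dyadic_outer k) _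
  (measurable_bergman_integrand p rw af) _ (M := m) _).
- by apply: lee_sum => k _; rewrite setIidr.
- by move=> k; exact: measurable_annulus.
- by move=> z z1; rewrite lee_fin (bergman_integrand_ge0 _ _ rw).
- by move=> z _; exact: outer_count.
Qed.

(** The outer annuli overlap at most [m] times. As [p <= q], the powers [q / p] of
    the integrals over them are dominated by the integrals themselves, up to a
    power of the whole integral. *)
Lemma carleson_upper F : (bergman_int omega p f <= F%:E)%E ->
  (\int[mu]_(z in @disc R) (N (f z) `^ q)%:E <=
    (16 * S * ring_const `^ (q / p) * m%:R * F `^ (q / p))%:E)%E.
Proof.
move=> fF; have F0 : 0 <= F by rewrite -lee_fin; apply: le_trans fF; exact: bergman_int_ge0 rw.
have rc0 := ring_const_gt0.
have o1 k : dyadic_outer k `<=` @disc R.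
  by apply: annulus_disc; rewrite lerBlDr lerDl ltW.
have mF : measurable_fun (@disc R) (fun z => (N (f z) `^ p * omega (N z))%:E).
  exact: (measurable_bergman_integrand p rw af).
pose I k := (\int[area R]_(z in dyadic_outer k) (N (f z) `^ p * omega (N z))%:E)%E.
have I0 k : (0 <= I k)%E.
  by apply: integral_ge0 => z /o1 z1; rewrite lee_fin (bergman_integrand_ge0 _ _ rw).
have IF k : (I k <= F%:E)%E.
  apply: le_trans fF; apply: ge0_subset_integral => //.
  - exact: measurable_annulus.
  - exact: measurable_disc.
  - by move=> z z1; rewrite lee_fin (bergman_integrand_ge0 _ _ rw).
have Ifin k : I k \is a fin_num.
  by rewrite ge0_fin_numE//; apply: le_lt_trans (IF k) _; rewrite ltry.
pose c := 16 * S * ring_const `^ (q / p) * F `^ (q / p - 1).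
have c0 : 0 <= c by rewrite !mulr_ge0 ?powR_ge0.
have ring k : (\int[mu]_(z in dyadic_ring k) (N (f z) `^ q)%:E <= c%:E * I k)%E.
  have fk : (I k <= (fine (I k))%:E)%E by rewrite fineK.
  apply: le_trans (ring_integral_le fk) _.
  rewrite -[X in (_ <= _ * X)%E](fineK (Ifin k)) -EFinM lee_fin /c.
  have x0 : 0 <= fine (I k) by rewrite fine_ge0.
  rewrite powRM ?(ltW rc0)//.
  have qp : q = p * (q / p) by field; rewrite gt_eqF.
  have -> : fine (I k) `^ (q / p) = fine (I k) * fine (I k) `^ (q / p - 1).
    have := x0; rewrite le_eqVlt => /predU1P[<-|x1].
      by rewrite mul0r powR0// gt_eqF// divr_gt0// (lt_le_trans p0).
    rewrite -{2}[fine (I k)]powRr1 ?(ltW x1)// -powRD; last by rewrite (gt_eqF x1) implybT.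
    by rewrite addrC subrK.
  have -> : 16 * S * ring_const `^ (q / p) * F `^ (q / p - 1) * fine (I k) =
    16 * S * (ring_const `^ (q / p) * (fine (I k) * F `^ (q / p - 1))) by ring.
  apply: ler_wpM2l; first by rewrite mulr_ge0.
  apply: ler_wpM2l; first exact: powR_ge0.
  apply: ler_wpM2l => //; apply: ge0_ler_powR; rewrite ?nnegrE//.
  by rewrite -lee_fin fineK.
rewrite disc_dyadic_rings ge0_integral_bigcup//; last 4 first.
- by move=> k; exact: measurable_annulus.
- rewrite -disc_dyadic_rings; apply/measurable_EFinP; exact: measurable_abspow.
- by move=> z _; rewrite lee_fin powR_ge0.
- exact: trivIset_dyadic_rings.
apply: lime_le.
  by apply: is_cvg_ereal_nneg_natsum_cond => k _ _; apply: integral_ge0 => z _; rewrite lee_fin powR_ge0.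
apply: nearW => n; rewrite big_mkord.
apply: (@le_trans _ _ (\sum_(k < n) (c%:E * I k))%E); first by apply: lee_sum => k _; exact: ring.
rewrite -ge0_sume_distrr//.
apply: (@le_trans _ _ (c%:E * (m%:R * F)%:E)%E).
  by apply: lee_wpmul2l; [rewrite lee_fin|exact: outer_integral_sum].
rewrite -EFinM lee_fin /c.
have -> : F `^ (q / p) = F `^ (q / p - 1) * F.
  have := F0; rewrite le_eqVlt => /predU1P[<-|x1].
    by rewrite mulr0 powR0// gt_eqF// divr_gt0// (lt_le_trans p0).
  rewrite -{3}[F]powRr1 ?(ltW x1)// -powRD ?subrK//.
  by rewrite (gt_eqF x1) implybT.
by rewrite le_eqVlt; apply/orP; left; apply/eqP; ring.
Qed.

End embedding.
End carleson_embedding.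
(** * Carleson measures *)

Lemma poweR_inv_le (R : realType) (X : \bar R) (p B : R) : 0 < p -> (0 <= X)%E -> 0 <= B ->
  (X `^ p^-1 <= B%:E)%E <-> (X <= (B `^ p)%:E)%E.
Proof.
move=> p0 X0 B0; rewrite -poweR_EFin; split => h.
  have := gt0_ler_poweR (ltW p0) _ _ h; rewrite -poweRrM mulVf ?gt_eqF// poweRe1//.
  by apply; rewrite in_itv/= leey andbT ?poweR_ge0 ?lee_fin.
have pV : 0 <= p^-1 by rewrite invr_ge0 ltW.
have := gt0_ler_poweR pV _ _ h; rewrite -poweRrM mulfV ?gt_eqF// poweRe1 ?lee_fin//.
by apply; rewrite in_itv/= leey andbT; [exact: X0|rewrite lee_fin powR_ge0].
Qed.

Section norms.
Variables (R : realType) (omega : R -> R) (p q : {posnum R})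
  (mu : {measure set R[i] -> \bar R}).
Hypothesis rw : radial_weight omega.
Local Notation C := R[i].
Local Notation N := (@normc R).
Implicit Types f : C -> C.

Let p0 : 0 < p%:num. Proof. by []. Qed.
Let q0 : 0 < q%:num. Proof. by []. Qed.

Lemma bergman_normE f : bergman_norm omega p%:num f = (bergman_int omega p%:num f `^ p%:num^-1)%E.
Proof. by []. Qed.

Lemma bergman_norm_le f B : 0 <= B ->
  (bergman_norm omega p%:num f <= B%:E)%E <-> (bergman_int omega p%:num f <= (B `^ p%:num)%:E)%E.
Proof. by move=> B0; rewrite bergman_normE; apply: poweR_inv_le => //; exact: bergman_int_ge0. Qed.

Lemma bergman_norm_le1 f :
  (bergman_norm omega p%:num f <= 1)%E <-> (bergman_int omega p%:num f <= 1)%E.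
Proof. by have := bergman_norm_le f ler01; rewrite powR1. Qed.

Lemma bergmanP f : bergman omega p%:num f <->
  analytic_in_disc f /\ exists2 F, 0 <= F & bergman_int omega p%:num f = F%:E.
Proof.
split=> -[af h]; split => //.
  have h' : (bergman_int omega p%:num f < +oo)%E.
    by apply: lty_poweRy h; rewrite invr_eq0 gt_eqF.
  have f0 := bergman_int_ge0 p%:num f rw.
  exists (fine (bergman_int omega p%:num f)); first by rewrite fine_ge0.
  by rewrite fineK// ge0_fin_numE.
by case: h => F _ FE; rewrite bergman_normE FE poweR_EFin ltry.
Qed.

Lemma lebesgue_norm_le f B : 0 <= B ->
  (lebesgue_norm mu q f <= B%:E)%E <-> (lebesgue_int mu q f <= (B `^ q%:num)%:E)%E.
Proof. by move=> B0; apply: poweR_inv_le => //; exact: lebesgue_int_ge0. Qed.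

Lemma lebesgue_norm_fin f : (lebesgue_int mu q f < +oo)%E -> (lebesgue_norm mu q f < +oo)%E.
Proof. exact: poweR_lty. Qed.

Lemma analytic_in_Lq f : analytic_in_disc f -> (lebesgue_int mu q f < +oo)%E ->
  range (@Lq_fun R mu q) f.
Proof.
by move=> af fin; exists (MkLq (analytic_measurable af) (lebesgue_norm_fin fin)).
Qed.

End norms.

Section carleson_measures.
Variables (R : realType) (omega : R -> R) (C1 : R) (m : nat) (C2 : R) (p q : {posnum R}).
Hypotheses (dw : doubling_weight omega C1 m C2) (pq : p%:num <= q%:num).
Local Notation C := R[i].
Local Notation N := (@normc R).
Local Notation mass := (weight_mass omega).
Local Notation tau := (tau omega).
Local Notation r := (Delta_radius R m).
Local Notation s := (q%:num / p%:num).
Implicit Types (f : C -> C) (mu : {measure set C -> \bar R}).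

Let rw : radial_weight omega. Proof. by case: dw. Qed.
Let s0 : 0 < s. Proof. by []. Qed.

Lemma Delta_mass : exists k1 k2 : R, [/\ 0 < k1, 0 < k2 & forall a, N a < 1 ->
  exists w, mass (Delta a r) = w%:E /\ k1 * tau a <= w <= k2 * tau a].
Proof.
have [_ kappa0] := area_unit_disc R.
have [K K0 HK] := Delta_mass_le dw.
exists (gap_const C1 C2 * unit_area R / 9), K; split => //.
  by apply: divr_gt0 => //; apply: mulr_gt0 => //; exact: gap_const_gt0 dw.
move=> a a1; have lo := Delta_mass_ge dw a1; have hi := HK a a1.
have fin : mass (Delta a r) \is a fin_num.
  rewrite ge0_fin_numE; first by apply: le_lt_trans hi _; rewrite ltry.
  by apply: (mass_ge0 rw) => z [].
exists (fine (mass (Delta a r))); rewrite fineK//; split => //.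
by rewrite -!lee_fin fineK// lo hi.
Qed.

(** In the quotient, the mass of a pseudohyperbolic disc may be replaced by the
    explicit quantity [tau]. *)
Lemma quotient_tau : exists A B : R, [/\ 0 < A, 0 < B & forall mu a S, N a < 1 -> 0 <= S ->
  ((carleson_quotient omega p q mu r a <= S%:E)%E ->
     (mu (Delta a r) <= (A * S * tau a `^ s)%:E)%E) /\
  ((mu (Delta a r) <= (S * tau a `^ s)%:E)%E ->
     (carleson_quotient omega p q mu r a <= (B * S)%:E)%E)].
Proof.
have [k1 [k2 [k10 k20 H]]] := Delta_mass.
exists (k2 `^ s), (k1 `^ s)^-1; split; rewrite ?invr_gt0 ?powR_gt0//.
move=> mu a S a1 S0; have [w [wE /andP[w1 w2]]] := H a a1.
have ta := tau_gt0 dw a1.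
have w0 : 0 < w by apply: lt_le_trans w1; exact: mulr_gt0.
have ws0 : 0 < w `^ s by exact: powR_gt0.
have -> : carleson_quotient omega p q mu r a = (mu (Delta a r) * ((w `^ s)^-1)%:E)%E.
  by rewrite /carleson_quotient wE poweR_EFin inver gt_eqF.
split => h.
  have : (mu (Delta a r) * ((w `^ s)^-1)%:E * (w `^ s)%:E <= S%:E * (w `^ s)%:E)%E.
    by apply: lee_wpmul2r => //; rewrite lee_fin ltW.
  rewrite -muleA -!EFinM mulVf ?gt_eqF// mule1 => /le_trans; apply.
  have -> : k2 `^ s * S * tau a `^ s = S * (k2 `^ s * tau a `^ s) by ring.
  rewrite lee_fin; apply: ler_wpM2l => //.
  rewrite -powRM ?(ltW k20) ?(ltW ta)//.
  have kt : 0 <= k2 * tau a by exact: mulr_ge0 (ltW _) (ltW _).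
  by apply: ge0_ler_powR; rewrite ?nnegrE ?(ltW s0) ?(ltW w0) ?kt.
apply: (@le_trans _ _ ((S * tau a `^ s)%:E * ((w `^ s)^-1)%:E)%E).
  by apply: lee_wpmul2r => //; rewrite lee_fin invr_ge0 ltW.
rewrite -EFinM lee_fin [leRHS]mulrC -mulrA; apply: ler_wpM2l => //.
rewrite ler_pdivrMr// ler_pdivlMl ?powR_gt0// -powRM ?(ltW k10) ?(ltW ta)//.
have kt : 0 <= k1 * tau a by exact: mulr_ge0 (ltW _) (ltW _).
by apply: ge0_ler_powR; rewrite ?nnegrE ?(ltW s0) ?(ltW w0) ?kt.
Qed.

(** The sufficiency of the disc condition, with its constant; [s] is [q / p]. *)
Lemma carleson_embedding : exists2 CU : R, 0 < CU & forall mu S f F, 0 <= S ->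
  (forall a, N a < 1 -> (mu (Delta a r) <= (S * tau a `^ s)%:E)%E) ->
  analytic_in_disc f -> 0 <= F -> (bergman_int omega p%:num f <= F%:E)%E ->
  (lebesgue_int mu q f <= (CU * S * F `^ s)%:E)%E.
Proof.
have rc0 := ring_const_gt0 dw.
exists (16 * ring_const C1 C2 `^ s * m.+1%:R).
  by rewrite mulr_gt0 ?ltr0n// mulr_gt0// powR_gt0.
move=> mu S f F S0 muS af F0 fF.
have p0 : 0 < p%:num by [].
apply: le_trans (carleson_upper dw p0 pq S0 af muS fF) _; rewrite lee_fin.
have -> : 16 * ring_const C1 C2 `^ s * m.+1%:R * S * F `^ s =
  16 * S * ring_const C1 C2 `^ s * m.+1%:R * F `^ s by ring.
apply: ler_wpM2r; first exact: powR_ge0.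
apply: ler_wpM2l; last by rewrite ler_nat.
by apply: mulr_ge0; [rewrite mulr_ge0|exact: powR_ge0].
Qed.

(** Chebyshev's inequality. *)
Lemma Delta_measure_le mu f a t B : N a < 1 -> analytic_in_disc f -> 0 < t ->
  (forall z, Delta a r z -> t <= N (f z) `^ p%:num) ->
  (lebesgue_int mu q f <= B%:E)%E -> (mu (Delta a r) <= (B / t `^ s)%:E)%E.
Proof.
move=> a1 af t0 ft fB; have ts : 0 < t `^ s by exact: powR_gt0.
have mD := measurable_Delta r a1.
have D1 : Delta a r `<=` @disc R by move=> z [].
have : ((t `^ s)%:E * mu (Delta a r) <= B%:E)%E.
  apply: le_trans fB; rewrite -integral_cst//.
  apply: le_trans (_ : \int[mu]_(z in Delta a r) (N (f z) `^ q%:num)%:E <= _)%E; last first.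
    apply: ge0_subset_integral => //; first exact: measurable_disc.
      by apply/measurable_EFinP; exact: measurable_abspow.
    by move=> z _; rewrite lee_fin powR_ge0.
  apply: ge0_le_integral => //.
  - by move=> z _; rewrite lee_fin ltW.
  - by apply/measurable_EFinP; apply: measurable_funS D1 (measurable_abspow _ af); exact: measurable_disc.
  move=> z Dz; rewrite lee_fin.
  have qE : q%:num = p%:num * s by rewrite mulrC divfK.
  by rewrite [X in _ <= _ `^ X]qE [leRHS]powRrM; apply: ge0_ler_powR; rewrite ?nnegrE ?powR_ge0 ?ft ?(ltW s0) ?(ltW t0).
move=> h; rewrite [X in (X <= _)%E](_ : _ = ((t `^ s)^-1)%:E * ((t `^ s)%:E * mu (Delta a r)))%E.
  rewrite (mulrC B) EFinM; apply: lee_wpmul2l => //.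
  by rewrite lee_fin invr_ge0 ltW.
by rewrite muleA -EFinM mulVf ?mul1e// gt_eqF.
Qed.

(** The necessity of the disc condition: the test function at [a] is bounded below
    on the disc about [a]. *)
Lemma carleson_test : exists2 CL : R, 0 < CL & forall mu B, 0 <= B ->
  (forall f, analytic_in_disc f -> (bergman_int omega p%:num f <= 1)%E ->
    (lebesgue_int mu q f <= B%:E)%E) ->
  forall a, N a < 1 -> (mu (Delta a r) <= (CL * B * tau a `^ s)%:E)%E.
Proof.
have p0 : 0 < p%:num by [].
have [c [D [G [h [c0 D0 G0 H]]]]] := test_functions dw p0.
exists (c `^ s)^-1; first by rewrite invr_gt0 powR_gt0.
move=> mu B B0 HB a a1; have ta := tau_gt0 dw a1; have [ah h1 hD _] := H a a1.
have ct : 0 < c / tau a by exact: divr_gt0.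
apply: le_trans (Delta_measure_le a1 ah ct hD (HB _ ah h1)) _.
rewrite lee_fin powRM ?invr_ge0 ?(ltW c0) ?(ltW ta)// powR_invl// invfM invrK.
by rewrite le_eqVlt; apply/orP; left; apply/eqP; ring.
Qed.

Lemma carleson_quotient_ge0 mu a : (0 <= carleson_quotient omega p q mu r a)%E.
Proof. by rewrite /carleson_quotient mule_ge0// inve_ge0 poweR_ge0. Qed.

Lemma carleson_sup_ge0 mu : (0 <= carleson_sup omega p q mu r)%E.
Proof.
apply: le_trans (carleson_quotient_ge0 mu 0) _; apply: ereal_sup_ubound.
by exists 0 => //; rewrite /disc /mkset normc0.
Qed.

Lemma carleson_sup_le mu (S : \bar R) :
  (forall a, N a < 1 -> (carleson_quotient omega p q mu r a <= S)%E) ->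
  (carleson_sup omega p q mu r <= S)%E.
Proof. by move=> H; apply: ge_ereal_sup => _ [a a1 <-]; exact: H. Qed.

Lemma carleson_sup_embedding : exists2 CU : R, 0 < CU & forall mu S f F, 0 <= S ->
  (carleson_sup omega p q mu r <= S%:E)%E ->
  analytic_in_disc f -> 0 <= F -> (bergman_int omega p%:num f <= F%:E)%E ->
  (lebesgue_int mu q f <= (CU * S * F `^ s)%:E)%E.
Proof.
have [CU CU0 HU] := carleson_embedding; have [A [B [A0 B0 AB]]] := quotient_tau.
exists (CU * A); first exact: mulr_gt0.
move=> mu S f F S0 supS af F0 fF; rewrite -(mulrA CU); apply: HU => //.
  by rewrite mulr_ge0// ltW.
move=> a a1; apply: (AB mu a S a1 S0).1; apply: le_trans supS.
by apply: ereal_sup_ubound; exists a.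
Qed.

Lemma carleson_sup_test : exists2 CL : R, 0 < CL & forall mu B, 0 <= B ->
  (forall f, analytic_in_disc f -> (bergman_int omega p%:num f <= 1)%E ->
    (lebesgue_int mu q f <= B%:E)%E) ->
  (carleson_sup omega p q mu r <= (CL * B)%:E)%E.
Proof.
have [CL CL0 HL] := carleson_test; have [A [B [A0 B0 AB]]] := quotient_tau.
exists (B * CL); first exact: mulr_gt0.
move=> mu b b0 Hb; apply: carleson_sup_le => a a1; rewrite -mulrA.
apply: (AB mu a (CL * b) a1 _).2; first by rewrite mulr_ge0// ltW.
exact: HL.
Qed.

Lemma carleson_measureP mu :
  carleson_measure omega p q mu <-> (carleson_sup omega p q mu r < +oo)%E.
Proof.
have p0 : 0 < p%:num by []. have q0 : 0 < q%:num by [].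
split=> [[_ [c Hc]]|fin].
  have [CL CL0 HL] := carleson_sup_test.
  apply: le_lt_trans (HL mu (`|c| `^ q%:num) (powR_ge0 _ _) _) _; last by rewrite ltry.
  move=> f af f1; apply/(lebesgue_norm_le _ _ _ (normr_ge0 c)).
  have fb : bergman omega p%:num f.
    split => //; apply: (@le_lt_trans _ _ 1%E); last by rewrite ltry.
    exact/bergman_norm_le1.
  apply: le_trans (Hc f fb) _.
  apply: (@le_trans _ _ (`|c|%:E * bergman_norm omega p%:num f)%E).
    by apply: lee_wpmul2r; [exact: poweR_ge0|rewrite lee_fin ler_norm].
  rewrite -[leRHS]mule1; apply: lee_wpmul2l => //; exact/bergman_norm_le1.
have S0 := carleson_sup_ge0 mu.
have supE : carleson_sup omega p q mu r = (fine (carleson_sup omega p q mu r))%:E.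
  by rewrite fineK// ge0_fin_numE.
set S := fine _ in supE; have {}S0 : 0 <= S by rewrite -lee_fin -supE.
have [CU CU0 HU] := carleson_sup_embedding.
have supS : (carleson_sup omega p q mu r <= S%:E)%E by rewrite supE.
split.
  move=> f /(bergmanP _ rw)[af [F F0 FE]]; apply: analytic_in_Lq => //.
  by apply: le_lt_trans (HU mu S f F S0 supS af F0 _) _; rewrite ?FE ?ltry.
exists ((CU * S) `^ q%:num^-1) => f /(bergmanP _ rw)[af [F F0 FE]].
rewrite bergman_normE FE poweR_EFin -EFinM.
apply/lebesgue_norm_le; first by rewrite mulr_ge0// powR_ge0.
rewrite (powRM _ (powR_ge0 _ _) (powR_ge0 _ _)) -!powRrM mulVf ?gt_eqF// powRr1 ?mulr_ge0 ?(ltW CU0)//.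
by rewrite (mulrC p%:num^-1); apply: HU => //; rewrite FE.
Qed.

Lemma identity_norm_asymp : exists C : R, 0 < C /\
  forall mu, carleson_measure omega p q mu ->
    (C^-1%:E * carleson_sup omega p q mu r <= identity_norm omega p q mu `^ q%:num)%E /\
    (identity_norm omega p q mu `^ q%:num <= C%:E * carleson_sup omega p q mu r)%E.
Proof.
have p0 : 0 < p%:num by []. have q0 : 0 < q%:num by [].
have [CU CU0 HU] := carleson_sup_embedding; have [CL CL0 HL] := carleson_sup_test.
exists (CU + CL); have C0 : 0 < CU + CL by exact: addr_gt0.
split => // mu cm; have fin := (carleson_measureP mu).1 cm.
have S0 := carleson_sup_ge0 mu.
have supE : carleson_sup omega p q mu r = (fine (carleson_sup omega p q mu r))%:E.
  by rewrite fineK// ge0_fin_numE.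
set S := fine _ in supE; have {}S0 : 0 <= S by rewrite -lee_fin -supE.
have supS : (carleson_sup omega p q mu r <= S%:E)%E by rewrite supE.
have up f : bergman omega p%:num f -> (bergman_norm omega p%:num f <= 1)%E ->
    (lebesgue_norm mu q f <= ((CU * S) `^ q%:num^-1)%:E)%E.
  move=> [af _] /(bergman_norm_le1 _ rw) f1; apply/lebesgue_norm_le; first exact: powR_ge0.
  rewrite -powRrM mulVf ?gt_eqF// powRr1 ?mulr_ge0 ?(ltW CU0)//.
  by have := HU mu S f 1 S0 supS af ler01 f1; rewrite powR1 mulr1.
have nup : (identity_norm omega p q mu <= ((CU * S) `^ q%:num^-1)%:E)%E.
  by apply: ge_ereal_sup => _ [f [fb f1] <-]; exact: up.
have n0 : (0 <= identity_norm omega p q mu)%E.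
  apply: (@le_trans _ _ (lebesgue_norm mu q (fun=> 0))); first exact: poweR_ge0.
  have i0 : bergman_int omega p%:num (fun=> 0) = 0%E.
    apply: integral0_eq => z _; rewrite normc0 powR0 ?mul0r//.
  apply: ereal_sup_ubound; exists (fun=> 0) => //; split.
    apply/(bergmanP _ rw); split; last by exists 0.
    by apply/analyticP => z _; exists 0; exact: has_cderiv_cst.
  by apply/(bergman_norm_le1 _ rw); rewrite i0 lee_fin.
have nE : identity_norm omega p q mu = (fine (identity_norm omega p q mu))%:E.
  by rewrite fineK// ge0_fin_numE//; apply: le_lt_trans nup _; rewrite ltry.
set n := fine _ in nE; have {}n0 : 0 <= n by rewrite -lee_fin -nE.
rewrite nE poweR_EFin supE -!EFinM !lee_fin; split.
  have lo : (carleson_sup omega p q mu r <= (CL * n `^ q%:num)%:E)%E.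
    apply: HL; first exact: powR_ge0.
    move=> f af f1; apply/(lebesgue_norm_le _ _ _ n0); rewrite -nE.
    have f1' : (bergman_norm omega p%:num f <= 1)%E by exact/(bergman_norm_le1 _ rw).
    apply: ereal_sup_ubound; exists f => //; split => //.
    by split => //; apply: le_lt_trans f1' _; rewrite ltry.
  rewrite ler_pdivrMl//; move: lo; rewrite supE lee_fin => /le_trans; apply.
  by apply: ler_wpM2r; [exact: powR_ge0|rewrite lerDr ltW].
move: nup; rewrite nE lee_fin => nup.
have := ge0_ler_powR (ltW q0) _ _ nup; rewrite !nnegrE powR_ge0 n0 => /(_ isT isT).
rewrite -powRrM mulVf ?gt_eqF// powRr1 ?mulr_ge0 ?(ltW CU0)// => /le_trans; apply.
by apply: ler_wpM2r => //; rewrite lerDl ltW.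
Qed.

End carleson_measures.
(** * Normal families *)

Section local_estimates.
Variables (R : realType) (f : R[i] -> R[i]) (z0 : R[i]) (h M : R).
Local Notation C := R[i].
Local Notation N := (@normc R).
Hypotheses (af : analytic_in_disc f) (h0 : 0 < h) (zh : N z0 + h <= 1)
  (fM : forall z, N (z - z0) < h -> N (f z) <= M).

Let g (x : C) := f (z0 + real_complex R h * x).
Let ag : analytic_in_disc g. Proof. by apply: analytic_rescale => //; exact: ltW. Qed.

Let gM x : N x < 1 -> N (g x) <= M.
Proof.
move=> x1; apply: fM; rewrite addrC addrA addNr add0r normcM normc_real gtr0_norm//.
by rewrite gtr_pMr.
Qed.

Let hC : real_complex R h != 0. Proof. by rewrite -normc_gt0 normc_real gtr0_norm. Qed.

Let wE w : f w = g ((w - z0) / real_complex R h).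
Proof. by rewrite /g mulrC divfK// addrC subrK. Qed.

Let zE : f z0 = g 0. Proof. by rewrite /g mulr0 addr0. Qed.

Let wN w : N ((w - z0) / real_complex R h) = N (w - z0) / h.
Proof. by rewrite normcM normcV normc_real gtr0_norm. Qed.

Lemma local_lip w : N (w - z0) <= h / 2 -> N (f w - f z0) <= 8 * M / h * N (w - z0).
Proof.
move=> wh; rewrite wE zE; apply: le_trans (analytic_lip ag gM _ _) _.
- by rewrite wN ler_pdivrMr//; lra.
- by rewrite normc0.
by rewrite subr0 wN le_eqVlt; apply/orP; left; apply/eqP; ring.
Qed.

Let deriv_rescale c : has_cderiv f z0 c -> has_cderiv g 0 (c * (0 + real_complex R h)).
Proof.
move=> hc; apply: (@has_cderiv_comp _ (fun x => z0 + real_complex R h * x) f).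
  exact: has_cderivD (has_cderiv_cst _ _) (has_cderiv_scale _ _).
by rewrite mulr0 addr0.
Qed.

Lemma local_cderiv_le c : has_cderiv f z0 c -> N c <= 8 * M / h.
Proof.
move=> /deriv_rescale hc; have n0 : N (0 : C) <= 1 / 2 by rewrite normc0; lra.
have := cderiv_bound ag gM n0 hc.
by rewrite add0r normcM normc_real gtr0_norm// ler_pdivlMr.
Qed.

Lemma local_taylor c w : has_cderiv f z0 c -> N (w - z0) <= h / 4 ->
  N (f w - f z0 - c * (w - z0)) <= 128 * M / h ^+ 2 * N (w - z0) ^+ 2.
Proof.
move=> hc wh; rewrite wE zE.
have -> : c * (w - z0) = c * (0 + real_complex R h) * ((w - z0) / real_complex R h).
  by rewrite add0r -mulrA (mulrCA (real_complex R h)) mulfV// mulr1.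
apply: le_trans (analytic_taylor1 ag gM (deriv_rescale hc) _) _.
  by rewrite wN ler_pdivrMr//; lra.
rewrite wN le_eqVlt; apply/orP; left; apply/eqP; field.
by rewrite gt_eqF.
Qed.

End local_estimates.

Lemma ultra_lim (R : realType) (T : Type) (U : set_system T) (g : T -> R[i]) K :
  UltraFilter U -> compact K -> U (g @^-1` K) ->
  exists2 l, K l & forall e : R, 0 < e -> U [set t | normc (g t - l) < e].
Proof.
move=> UF cK UK; have UP := @ultra_proper _ _ UF.
have [l [Kl cl]] := cK (g @ U) _ UK; exists l => // e e0.
have [//|UA] := in_ultra_setVsetC [set t | normc (g t - l) < e] UF.
have nb : nbhs l [set z | normc (z - l) < e].
  apply/nbhs_ballP; exists (real_complex R e) => /=; first by rewrite ltcR.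
  by move=> z /ball_complexE; rewrite normc_distC.
by have [z [/= h1 h2]] := cl [set z | ~ normc (z - l) < e] _ UA nb.
Qed.

Section montel.
Variables (R : realType) (T : Type) (U : set_system T) (UF : UltraFilter U)
  (phi : T -> R[i] -> R[i]) (M : R -> R).
Local Notation C := R[i].
Local Notation N := (@normc R).
Hypothesis Uphi : U [set t | analytic_in_disc (phi t) /\
  forall rho z, rho < 1 -> N z <= rho -> N (phi t z) <= M rho].

Let UP : ProperFilter U := @ultra_proper _ _ UF.

Let good t := analytic_in_disc (phi t) /\
  forall rho z, rho < 1 -> N z <= rho -> N (phi t z) <= M rho.

(** Ultrafilters replace the extraction of subsequences: a bounded family of values
    converges at every point at once. *)
Lemma pointwise_limit : exists f0 : C -> C, forall z, N z < 1 ->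
  forall e : R, 0 < e -> U [set t | N (phi t z - f0 z) < e].
Proof.
suff : forall z, exists l, N z < 1 -> forall e : R, 0 < e -> U [set t | N (phi t z - l) < e].
  by move=> /boolp.choice[f0 H]; exists f0.
move=> z; have [z1|] := pselect (N z < 1); last by exists 0.
have [|l _ hl] := @ultra_lim R T U (fun t => phi t z) _ UF (@compact_cdisc R (M (N z))).
  by apply: filterS Uphi => t [_ h]; apply: h.
by exists l.
Qed.

Variable f0 : C -> C.
Hypothesis f0_lim : forall z, N z < 1 ->
  forall e : R, 0 < e -> U [set t | N (phi t z - f0 z) < e].

(** The derivatives at a point are bounded, hence converge along the ultrafilter,
    and the second order estimate passes to the limit. *)
Lemma limit_analytic : analytic_in_disc f0.
Proof.
apply/analyticP => z z1; pose h := (1 - N z) / 2.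
have h0 : 0 < h by rewrite divr_gt0// subr_gt0.
pose K := M (N z + h).
have zh : N z + h <= 1 by rewrite /h; lra.
have bd t : good t -> forall w, N (w - z) < h -> N (phi t w) <= K.
  move=> [_ b] w wz; apply: b; first by rewrite /h; lra.
  by have := normc_subD w z; lra.
have [d hd] : exists d : T -> C, forall t, good t -> has_cderiv (phi t) z (d t).
  suff : forall t, exists c, good t -> has_cderiv (phi t) z c by move=> /boolp.choice[d hd]; exists d.
  move=> t; have [gt|] := pselect (good t); last by exists 0.
  by have [c hc] := (analyticP (phi t)).1 gt.1 z z1; exists c.
have [|c _ hc] := @ultra_lim R T U d _ UF (@compact_cdisc R (8 * K / h)).
  apply: filterS Uphi => t gt; exact: (local_cderiv_le gt.1 h0 zh (bd t gt) (hd t gt)).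
exists c.
pose A := 128 * K / h ^+ 2.
have main w : N (w - z) <= h / 4 -> N (f0 w - f0 z - c * (w - z)) <= A * N (w - z) ^+ 2.
  move=> wh; apply/ler_addgt0Pr => e e0.
  have w1 : N w < 1 by have := normc_subD w z; rewrite /h in wh; lra.
  have wn : 0 < N (w - z) + 1 by rewrite ltr_wpDl// normc_ge0.
  have e3 : 0 < e / 3 by rewrite divr_gt0.
  have ew : 0 < e / 3 / (N (w - z) + 1) by rewrite divr_gt0.
  have [t [gt [ht1 [ht2 ht3]]]] := filter_ex (filterI Uphi
    (filterI (f0_lim w1 e3) (filterI (f0_lim z1 e3) (hc _ ew)))).
  have ty := local_taylor gt.1 h0 zh (bd t gt) (hd t gt) wh.
  have -> : f0 w - f0 z - c * (w - z) = (phi t w - phi t z - d t * (w - z)) -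
    (phi t w - f0 w) + (phi t z - f0 z) + (d t - c) * (w - z) by ring.
  apply: le_trans (le_normcD _ _) _; rewrite normcM.
  have t3 : N (d t - c) * N (w - z) <= e / 3.
    apply: le_trans (_ : N (d t - c) * (N (w - z) + 1) <= _).
      by rewrite ler_wpM2l ?normc_ge0// lerDl.
    by rewrite -ler_pdivlMr// ltW.
  have := le_normcD (phi t w - phi t z - d t * (w - z) - (phi t w - f0 w)) (phi t z - f0 z).
  have := le_normcD (phi t w - phi t z - d t * (w - z)) (- (phi t w - f0 w)).
  rewrite normcN -/A in ty *; rewrite /= in ht1 ht2.
  by move: ty; rewrite -/A; lra.
move=> e e0; have A1 : 0 < `|A| + 1 by rewrite ltr_wpDl.
exists (Num.min (h / 4) (e / (`|A| + 1))); first by rewrite lt_min; apply/andP; split; exact: divr_gt0.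
move=> w; rewrite lt_min => /andP[w1 w2]; apply: le_trans (main w (ltW w1)) _.
rewrite expr2 mulrA ler_wpM2r ?normc_ge0//.
move: w2; rewrite ltr_pdivlMr// => w2.
have := ler_norm A; have := normc_ge0 (w - z); nra.
Qed.

(** Locally uniform convergence: the functions are equicontinuous, so otherwise
    the points where the convergence fails would accumulate at a point of failure. *)
Lemma limit_uniform rho (e : R) : rho < 1 -> 0 < e ->
  U [set t | forall z, N z <= rho -> N (phi t z - f0 z) < e].
Proof.
move=> r1 e0; set A := [set t | _].
have [//|UA] := in_ultra_setVsetC A UF; exfalso.
have [zt hz] : exists zt : T -> C, forall t, ~ A t ->
    N (zt t) <= rho /\ e <= N (phi t (zt t) - f0 (zt t)).
  suff : forall t, exists y, ~ A t -> N y <= rho /\ e <= N (phi t y - f0 y) by move=> /boolp.choice[y hy]; exists y.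
  move=> t; have [At|nA] := pselect (A t); first by exists 0.
  have /existsNP[z /not_implyP[z1 z2]] := nA; exists z => _; split => //.
  by rewrite leNgt; apply/negP.
have [|l lr hl] := @ultra_lim R T U zt _ UF (@compact_cdisc R rho).
  by apply: filterS UA => t /hz[].
have l1 : N l < 1 by exact: le_lt_trans lr r1.
pose h := (1 - N l) / 2; have h0 : 0 < h by rewrite divr_gt0// subr_gt0.
have lh : N l + h <= 1 by rewrite /h; lra.
pose K := M (N l + h).
have e3 : 0 < e / 3 by rewrite divr_gt0.
have [d d0 hd] := analytic_continuous limit_analytic l1 e3.
have K1 : 0 < `|8 * K / h| + 1 by rewrite ltr_wpDl.
have d1 : 0 < Num.min d (Num.min (h / 2) (e / 3 / (`|8 * K / h| + 1))).
  by rewrite !lt_min d0/=; apply/andP; split; exact: divr_gt0.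
have [t [gt [nA [ht1]]]] := filter_ex (filterI Uphi (filterI UA (filterI (f0_lim l1 e3) (hl _ d1)))).
rewrite /= !lt_min => /andP[t1 /andP[t2 t3]].
have [zr ze] := hz t nA.
have bd w : N (w - l) < h -> N (phi t w) <= K.
  move=> wl; apply: gt.2; first by rewrite /h; lra.
  by have := normc_subD w l; lra.
have lip := local_lip gt.1 h0 lh bd (ltW t2).
have f0d := hd _ t1.
have lip' : N (phi t (zt t) - phi t l) <= e / 3.
  apply: le_trans lip _; move: t3; rewrite ltr_pdivlMr// => t3.
  have := ler_norm (8 * K / h); have := normc_ge0 (zt t - l); nra.
move: ze; apply/negP; rewrite -ltNge.
have -> : phi t (zt t) - f0 (zt t) = (phi t (zt t) - phi t l) + (phi t l - f0 l) - (f0 (zt t) - f0 l) by ring.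
apply: le_lt_trans (le_normcD _ _) _; rewrite normcN.
have := le_normcD (phi t (zt t) - phi t l) (phi t l - f0 l).
by rewrite /= in ht1; lra.
Qed.

End montel.
(** * Compactness *)

(** Relative compactness need only be tested on ultrafilters that contain the set
    itself: in a uniform space a filter on the closure may be moved into the set. *)
Lemma compact_closure_ultra (T : uniformType) (A : set T) :
  (forall U : set_system T, UltraFilter U -> U A -> exists x : T, U --> x) ->
  compact (closure A).
Proof.
move=> H F FF FA.
pose S (i : set T * set (T * T)) := [set a | A a /\ exists2 u, i.1 u & i.2 (u, a)].
pose I := [set i : set T * set (T * T) | F i.1 /\ entourage i.2].
have GP : ProperFilter (filter_from I S).
  apply: filter_from_proper.
    apply: filter_from_filter.
      by exists (setT, setT); split; exact: filterT.
    move=> [W E] [W' E'] [/= FW eE] [/= FW' eE'].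
    exists (W `&` W', E `&` E'); first by split; exact: filterI.
    by move=> a [Aa [u [Wu W'u] [Eu E'u]]]; split; split => //; exists u.
  move=> [W E] [/= FW eE].
  have [u [Wu cu]] := filter_ex (filterI FW FA).
  have [a [Aa Ea]] := cu _ (nbhs_entourage u eE).
  by exists a; split => //; exists u => //; apply/xsectionP.
have [U [UU GU]] := ultraFilterLemma GP.
have UP := @ultra_proper _ _ UU.
have UA : U A.
  by apply: GU; exists (setT, setT); [split; exact: filterT|move=> a []].
have [x Ux] := H U UU UA; exists x; split.
  by move=> V nV; have [a [? ?]] := filter_ex (filterI UA (Ux V nV)); exists a.
move=> W V FW /nbhsP[E eE EV].
have [D eD DE] := entourage_split_ex eE.
have U1 := Ux _ (nbhs_entourage x eD).
have U2 : U (S (W, D^-1)%relation).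
  by apply: GU; exists (W, (D^-1)%relation) => //; split => //; exact: entourage_inv.
have [a [xa [_ [u Wu ua]]]] := filter_ex (filterI U1 U2).
exists u; split => //; apply: EV; apply/xsectionP; apply: DE.
by exists a => //; exact/xsectionP.
Qed.

Lemma to_boundaryP (R : realType) (A : set R[i]) :
  to_boundary A <-> exists2 t0 : R, t0 < 1 & forall a, t0 < normc a < 1 -> A a.
Proof.
rewrite /to_boundary /=; split.
  move=> /nbhs_ballP[e /= e0 he]; exists (1 - e); first by rewrite gtrBl.
  move=> a /andP[a0 a1]; apply: (he (normc a)) => //.
  by rewrite /ball /= ltr_distl; apply/andP; split; lra.
move=> [t0 t1 H]; apply/nbhs_ballP; exists (1 - t0) => /=; first by rewrite subr_gt0.
move=> t; rewrite /ball /= ltr_distl => /andP[h1 h2] tlt a at_; apply: H.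
by rewrite at_; apply/andP; split; lra.
Qed.

Section exhaustion.
Variables (R : realType) (nu : {measure set R[i] -> \bar R}) (g : R[i] -> \bar R).
Hypotheses (mg : measurable_fun (@disc R) g) (g0 : forall z, disc z -> (0 <= g z)%E).

Lemma cdisc_disc (rho : R) : rho < 1 -> cdisc rho `<=` @disc R.
Proof. by move=> r1 z zr; exact: le_lt_trans zr r1. Qed.

Lemma integral_disc_split rho : rho < 1 -> (\int[nu]_(z in @disc R) g z =
  \int[nu]_(z in cdisc rho) g z + \int[nu]_(z in @disc R `\` cdisc rho) g z)%E.
Proof.
move=> r1; have dE : @disc R = cdisc rho `|` (@disc R `\` cdisc rho).
  by rewrite setDUK//; exact: cdisc_disc.
rewrite {1}dE ge0_integral_setU//.
- exact: measurable_cdisc.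
- by apply: measurableD; [exact: measurable_disc|exact: measurable_cdisc].
- by rewrite -dE.
- by rewrite -dE.
- by apply/disj_setPS => z [? []].
Qed.

Lemma integral_disc_le B : (forall rho, 0 <= rho < 1 -> (\int[nu]_(z in cdisc rho) g z <= B)%E) ->
  (\int[nu]_(z in @disc R) g z <= B)%E.
Proof.
move=> HB; pose F n : set R[i] := cdisc (1 - n.+1%:R^-1).
have n0 n : 0 < n.+1%:R^-1 :> R by rewrite invr_gt0 ltr0n.
have F1 n : F n `<=` @disc R by apply: cdisc_disc; rewrite gtrBl.
have dE : @disc R = \bigcup_n F n.
  apply/seteqP; split => [z z1|z [n _ /F1]//].
  have b0 : 0 < 1 - normc z by rewrite subr_gt0.
  exists (Num.truncn (1 - normc z)^-1) => //; rewrite /F /cdisc /mkset.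
  rewrite lerBrDr -lerBrDl -[leRHS]invrK lef_pV2 ?posrE ?ltr0n ?invr_gt0//.
  exact: ltW (truncnS_gt _).
have ndF : nondecreasing_seq F.
  move=> n k nk; rewrite subsetEset => z; rewrite /F /cdisc /mkset => /le_trans; apply.
  by rewrite lerD2l lerN2 lef_pV2 ?posrE ?ltr0n// ler_nat.
have mF n : measurable (F n) by exact: measurable_cdisc.
have mgF n : measurable_fun (F n) g by exact: measurable_funS (@measurable_disc R) (F1 n) mg.
have gF n z : F n z -> (0 <= g z)%E by move=> /F1/g0.
have cv := ge0_nondecreasing_set_cvg_integral (mu := nu) ndF mF mgF gF.
rewrite dE; apply: (cvge_le _ cv); apply: nearW => n; apply: HB; rewrite gtrBl n0 andbT subr_ge0 invf_le1 ?ltr0n//.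
by rewrite ler1n.
Qed.

End exhaustion.

Section compactness.
Variables (R : realType) (omega : R -> R) (C1 : R) (m : nat) (C2 : R) (p q : {posnum R}).
Hypotheses (dw : doubling_weight omega C1 m C2) (pq : p%:num <= q%:num).
Variable mu : {measure set R[i] -> \bar R}.
Hypothesis mu_fin : locally_finite_on_disc mu.
Local Notation C := R[i].
Local Notation N := (@normc R).
Local Notation mass := (weight_mass omega).
Local Notation tau := (tau omega).
Local Notation r := (Delta_radius R m).
Local Notation s := (q%:num / p%:num).
Implicit Types (f g : C -> C).

Let rw : radial_weight omega. Proof. by case: dw. Qed.
Let s0 : 0 < s. Proof. by []. Qed.

Lemma mu_cdisc rho : rho < 1 -> exists2 K : R, 0 <= K & mu (cdisc rho) = K%:E.
Proof.
move=> r1; have fin := mu_fin (@compact_cdisc R rho) (cdisc_disc r1).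
exists (fine (mu (cdisc rho))); first by rewrite fine_ge0.
by rewrite fineK// ge0_fin_numE.
Qed.

Lemma measurable_analytic_pow f : analytic_in_disc f ->
  measurable_fun (@disc R) (fun z => (N (f z) `^ q%:num)%:E).
Proof. by move=> af; apply/measurable_EFinP; exact: measurable_abspow. Qed.

Lemma lebesgue_int_split f rho : analytic_in_disc f -> rho < 1 ->
  (lebesgue_int mu q f = \int[mu]_(z in cdisc rho) (N (f z) `^ q%:num)%:E +
    \int[mu]_(z in @disc R `\` cdisc rho) (N (f z) `^ q%:num)%:E)%E.
Proof.
move=> af r1; apply: integral_disc_split => //; first exact: measurable_analytic_pow.
by move=> z _; rewrite lee_fin powR_ge0.
Qed.

Lemma cdisc_integral_le f rho (B K : R) : analytic_in_disc f -> rho < 1 -> 0 <= B ->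
  mu (cdisc rho) = K%:E -> (forall z, N z <= rho -> N (f z) <= B) ->
  (\int[mu]_(z in cdisc rho) (N (f z) `^ q%:num)%:E <= (B `^ q%:num * K)%:E)%E.
Proof.
move=> af r1 B0 KE fB; rewrite EFinM -KE.
apply: ge0_integral_le_measure.
- exact: measurable_cdisc.
- apply: measurable_funS (measurable_abspow _ af); first exact: measurable_disc.
  exact: cdisc_disc.
- exact: powR_ge0.
- move=> z zr; rewrite powR_ge0/=.
  by apply: ge0_ler_powR; rewrite ?nnegrE ?normc_ge0 ?B0 ?fB.
Qed.

(** Functions in the unit ball are bounded on compact subsets of the disc, by a
    bound that depends on the subset only. *)
Definition local_bound (F rho : R) : R :=
  (ring_const C1 C2 * F / ((1 - rho) * omega_hat omega rho)) `^ p%:num^-1.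

Lemma local_bound_le f F rho z : analytic_in_disc f -> 0 <= F ->
  (bergman_int omega p%:num f <= F%:E)%E -> rho < 1 -> N z <= rho ->
  N (f z) <= local_bound F rho.
Proof.
move=> af F0 fF r1 zr; have z1 : N z < 1 by exact: le_lt_trans zr r1.
have p0 : 0 < p%:num by [].
have : @disc R z by []. rewrite disc_dyadic_rings => -[k _ kz].
have o1 : dyadic_outer m k `<=` @disc R.
  by apply: annulus_disc; rewrite lerBlDr lerDl ltW// invr_gt0 exprn_gt0.
have fk : (\int[area R]_(w in dyadic_outer m k) (N (f w) `^ p%:num * omega (N w))%:E <= F%:E)%E.
  apply: le_trans fF; apply: ge0_subset_integral => //.
  - exact: measurable_annulus.
  - exact: measurable_disc.
  - exact: (measurable_bergman_integrand _ rw).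
  - by move=> w w1; rewrite lee_fin (bergman_integrand_ge0 _ _ rw).
have fz := ring_pointwise dw p0 af fk kz.
have rc0 := ring_const_gt0 dw.
have rho0 : 0 <= rho by apply: le_trans zr; exact: normc_ge0.
have wr : 0 < omega_hat omega rho by apply: (what_gt0 rw); rewrite rho0.
have ek : (2 ^+ k)^-1 <= 1 :> R by rewrite invf_le1 ?exprn_gt0// exprn_ege1// ler1n.
case/andP: kz => k1 _.
have T0 : (1 - rho) * omega_hat omega rho <= ring_mass omega k.
  apply: ler_pM; rewrite ?subr_ge0 ?(ltW r1) ?(ltW wr)//; first by lra.
  by apply: (what_mono rw); lra.
have Tp : 0 < (1 - rho) * omega_hat omega rho by rewrite mulr_gt0// subr_gt0.
have b0 : 0 <= ring_const C1 C2 * F / ((1 - rho) * omega_hat omega rho).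
  by rewrite divr_ge0 ?(ltW Tp)// mulr_ge0// ltW.
have h : N (f z) `^ p%:num <= ring_const C1 C2 * F / ((1 - rho) * omega_hat omega rho).
  apply: le_trans fz _; apply: ler_wpM2l; first by rewrite mulr_ge0// ltW.
  by rewrite lef_pV2 ?posrE// (lt_le_trans Tp).
have -> : N (f z) = (N (f z) `^ p%:num) `^ p%:num^-1.
  by rewrite -powRrM mulfV ?gt_eqF// powRr1// normc_ge0.
by apply: ge0_ler_powR; rewrite ?nnegrE ?powR_ge0 ?b0 ?invr_ge0.
Qed.

Lemma normc_powR_le (x : {posnum R}) (u v w : C) : N u <= N v + N w ->
  N u `^ x%:num <= 2 `^ x%:num * (N v `^ x%:num + N w `^ x%:num).
Proof.
move=> uvw; have vw0 : 0 <= N v + N w by rewrite addr_ge0 ?normc_ge0.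
have := normc_powR_triangle x (real_complex R (N v)) (real_complex R (N w)).
rewrite -rmorphD !normc_real (ger0_norm vw0) !ger0_norm ?normc_ge0//.
by apply: le_trans; apply: ge0_ler_powR; rewrite ?nnegrE ?normc_ge0.
Qed.

Lemma integral_powR_triangle (nu : {measure set C -> \bar R}) (x : {posnum R}) (k : C -> R)
    (D : set C) (u v w : C -> C) : measurable D -> (forall z, D z -> 0 <= k z) ->
  measurable_fun D (fun z => (N (u z) `^ x%:num * k z)%:E) ->
  measurable_fun D (fun z => (N (v z) `^ x%:num * k z)%:E) ->
  measurable_fun D (fun z => (N (w z) `^ x%:num * k z)%:E) ->
  (forall z, N (u z) <= N (v z) + N (w z)) ->
  (\int[nu]_(z in D) (N (u z) `^ x%:num * k z)%:E <=
   (2 `^ x%:num)%:E * (\int[nu]_(z in D) (N (v z) `^ x%:num * k z)%:E +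
     \int[nu]_(z in D) (N (w z) `^ x%:num * k z)%:E))%E.
Proof.
move=> mD k0 mu' mv mw uvw.
have pos (h : C -> C) z : D z -> (0 <= (N (h z) `^ x%:num * k z)%:E)%E.
  by move=> Dz; rewrite lee_fin mulr_ge0 ?powR_ge0// k0.
rewrite -ge0_integralD//; last 2 first.
- by move=> z; exact: pos.
- by move=> z; exact: pos.
rewrite -ge0_integralZl_EFin ?powR_ge0//; last 2 first.
- by move=> z Dz; rewrite adde_ge0// pos.
- exact: emeasurable_funD.
apply: ge0_le_integral => //.
- by move=> z; exact: pos.
- by apply: measurable_funeM; exact: emeasurable_funD.
move=> z Dz; rewrite -EFinD -EFinM lee_fin -mulrDl mulrA.
by apply: ler_wpM2r; [exact: k0|exact: normc_powR_le].
Qed.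

Lemma Lq_triangle (D : set C) (u v w : C -> C) : measurable D -> D `<=` @disc R ->
  measurable_fun (@disc R) (fun z => (N (u z) `^ q%:num)%:E) ->
  measurable_fun (@disc R) (fun z => (N (v z) `^ q%:num)%:E) ->
  measurable_fun (@disc R) (fun z => (N (w z) `^ q%:num)%:E) ->
  (forall z, N (u z) <= N (v z) + N (w z)) ->
  (\int[mu]_(z in D) (N (u z) `^ q%:num)%:E <=
   (2 `^ q%:num)%:E * (\int[mu]_(z in D) (N (v z) `^ q%:num)%:E +
     \int[mu]_(z in D) (N (w z) `^ q%:num)%:E))%E.
Proof.
move=> mD D1 mu' mv mw uvw; have mS := measurable_funS (@measurable_disc R) D1.
have E (h : C -> C) : (fun z => (N (h z) `^ q%:num)%:E) = (fun z => (N (h z) `^ q%:num * 1)%:E).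
  by apply/funext => z; rewrite mulr1.
rewrite !E; apply: (@integral_powR_triangle mu q (fun=> 1)) => //; rewrite -E; exact: mS.
Qed.

Lemma measurable_Lq_pow (g : Lq mu q) : measurable_fun (@disc R) (fun z => (N (g z) `^ q%:num)%:E).
Proof.
apply/measurable_EFinP; apply: (measurableT_comp (measurable_powR _)).
exact: (measurableT_comp (@measurable_normc R) (Lq_measurable g)).
Qed.

Lemma Delta_sub_cdisc (t0 : R) : t0 < 1 -> exists2 rho, 0 <= rho < 1 &
  forall a, N a < 1 -> N a <= t0 -> Delta a r `<=` cdisc rho.
Proof.
move=> t1; have /andP[r0 r1] := Delta_radius01 R m.
have r2 : 0 < 1 - r ^+ 2 by nra.
have k0 : 0 < (1 - r ^+ 2) / 4 by rewrite divr_gt0.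
have k1 : (1 - r ^+ 2) / 4 <= 1 by have := sqr_ge0 r; lra.
pose t := Num.max t0 0.
have tt1 : t < 1 by rewrite /t gt_max t1 ltr01.
have tt0 : 0 <= t by rewrite /t le_max lexx orbT.
exists (1 - (1 - r ^+ 2) / 4 * (1 - t)).
  apply/andP; split; last by rewrite gtrBl mulr_gt0// subr_gt0.
  by rewrite subr_ge0 mulr_ile1 ?(ltW k0) ?subr_ge0 ?(ltW tt1)// gerBl.
move=> a a1 at0 z Dz; have z1 : N z < 1 by case: Dz.
have sym : Delta z r a.
  apply/(DeltaP _ z1 a1); move/(DeltaP _ a1 z1): Dz.
  rewrite normc_distC; congr (_ < _ * _).
  by rewrite -normc_conj rmorphB rmorph1 rmorphM/= conjcK mulrC.
have h := Delta_one_sub_conj (Delta_radius01 R m) z1 sym.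
have low := normc_one_sub_conj_ge z a; have nz := normc_ge0 z; have na := normc_ge0 a.
have at1 : N a <= t by rewrite /t le_max at0.
have : 1 - t <= 4 / (1 - r ^+ 2) * (1 - N z).
  apply: le_trans h; apply: le_trans low; rewrite lerD2l lerN2; nra.
rewrite mulrAC ler_pdivlMr// /cdisc /mkset => h1.
lra.
Qed.

Section vanishing.
Hypothesis vanish : forall e : R, 0 < e -> exists2 t0 : R, t0 < 1 & forall a, t0 < N a < 1 ->
  (carleson_quotient omega p q mu r a <= e%:E)%E.

(** The part of the measure near the boundary embeds with small constant. *)
Lemma tail_integral (e : R) : 0 < e -> exists2 rho, 0 <= rho < 1 & forall f F,
  analytic_in_disc f -> 0 <= F -> (bergman_int omega p%:num f <= F%:E)%E ->
  (\int[mu]_(z in @disc R `\` cdisc rho) (N (f z) `^ q%:num)%:E <= (e * F `^ s)%:E)%E.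
Proof.
move=> e0; have [CU CU0 HU] := carleson_embedding dw pq.
have [A [B [A0 B0 AB]]] := quotient_tau p q dw.
pose eta := e / (CU * A); have eta0 : 0 < eta by rewrite divr_gt0// mulr_gt0.
have [t0 t1 Ht] := vanish eta0.
have [rho r01 Hr] := Delta_sub_cdisc t1; exists rho => // f F af F0 fF.
have mK : measurable (~` @cdisc R rho) by apply: measurableC; exact: measurable_cdisc.
(* Discs about points near the boundary are controlled by the quotient, and the
   other discs do not meet the support of [mu']. *)
pose mu' : {measure set C -> \bar R} := mrestr mu mK.
have bound a : N a < 1 -> (mu' (Delta a r) <= (A * eta * tau a `^ s)%:E)%E.
  move=> a1; have [at0|at0] := leP (N a) t0.
    rewrite (_ : mu' (Delta a r) = 0%E).
      by rewrite lee_fin mulr_ge0 ?powR_ge0// mulr_ge0// ltW.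
    rewrite /mu' /= /mrestr (_ : _ `&` _ = set0) ?measure0//.
    by rewrite -subset0 => z [/(Hr a a1 at0)].
  have mD := measurable_Delta r a1.
  apply: (@le_trans _ _ (mu (Delta a r))).
    by rewrite /mu' /= /mrestr; apply: le_measure; rewrite ?inE//; exact: measurableI.
  by apply: (AB mu a eta a1 (ltW eta0)).1; apply: Ht; rewrite at0.
have Aeta : 0 <= A * eta by rewrite mulr_ge0// ltW.
have := HU mu' (A * eta) f F Aeta bound af F0 fF.
have -> : CU * (A * eta) = e by rewrite /eta; field; rewrite !gt_eqF.
apply: le_trans.
have mO : measurable (@disc R `\` cdisc rho).
  by apply: measurableD; [exact: measurable_disc|exact: measurable_cdisc].
rewrite (@eq_measure_integral _ _ _ _ mu').
  apply: ge0_subset_integral => //; first exact: measurable_disc.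
    exact: measurable_analytic_pow.
  by move=> z _; rewrite lee_fin powR_ge0.
move=> E mE EO; rewrite /mu' /= /mrestr; congr (mu _).
by apply/seteqP; split => [z Ez|z []//]; split => //; have [] := EO z Ez.
Qed.

Lemma vanishing_identity_into : identity_into omega p q mu.
Proof.
move=> f /(bergmanP _ rw)[af [F F0 FE]].
have fF : (bergman_int omega p%:num f <= F%:E)%E by rewrite FE.
apply: analytic_in_Lq => //.
have [rho /andP[_ r1] Ht] := tail_integral ltr01.
have [K K0 KE] := mu_cdisc r1.
rewrite (lebesgue_int_split af r1).
apply: lte_add_pinfty; last by apply: le_lt_trans (Ht f F af F0 fF) _; rewrite ltry.
apply: le_lt_trans (cdisc_integral_le (B := local_bound F rho) af r1 _ KE _) _.
- exact: powR_ge0.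
- by move=> z; exact: local_bound_le.
- by rewrite ltry.
Qed.

End vanishing.
End compactness.
Lemma analytic_sub (R : realType) (f g : R[i] -> R[i]) : analytic_in_disc f ->
  analytic_in_disc g -> analytic_in_disc (fun z => f z - g z).
Proof.
move=> /analyticP af /analyticP ag; apply/analyticP => z z1.
have [c1 h1] := af z z1; have [c2 h2] := ag z z1; exists (c1 + -1 * c2).
have -> : (fun w => f w - g w) = (fun w => f w + -1 * g w).
  by apply/funext => w; rewrite mulN1r.
exact: has_cderivD h1 (has_cderivZ (-1) h2).
Qed.

Section compact_embedding.
Variables (R : realType) (omega : R -> R) (C1 : R) (m : nat) (C2 : R) (p q : {posnum R}).
Hypotheses (dw : doubling_weight omega C1 m C2) (pq : p%:num <= q%:num).
Variable mu : {measure set R[i] -> \bar R}.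
Hypothesis mu_fin : locally_finite_on_disc mu.
Local Notation C := R[i].
Local Notation N := (@normc R).
Local Notation mass := (weight_mass omega).
Local Notation tau := (tau omega).
Local Notation r := (Delta_radius R m).
Local Notation s := (q%:num / p%:num).
Implicit Types (f g : C -> C).

Let rw : radial_weight omega. Proof. by case: dw. Qed.
Let s0 : 0 < s. Proof. by []. Qed.
Let p0 : 0 < p%:num. Proof. by []. Qed.
Let q0 : 0 < q%:num. Proof. by []. Qed.

Definition vanishing_quotient := forall e : R, 0 < e -> exists2 t0 : R, t0 < 1 &
  forall a, t0 < N a < 1 -> (carleson_quotient omega p q mu r a <= e%:E)%E.

Lemma vanishing_quotientP : vanishing_quotient <->
  carleson_quotient omega p q mu r a @[a --> @to_boundary R] --> (0 : \bar R).
Proof.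
split => [van|cv].
  apply/fine_cvgP; split.
    apply/to_boundaryP; have [t0 t1 H] := van 1 ltr01; exists t0 => // a /H h.
    rewrite ge0_fin_numE ?carleson_quotient_ge0//.
    by apply: le_lt_trans h _; rewrite ltry.
  apply/cvgrPdist_le => e e0; apply/to_boundaryP; have [t0 t1 H] := van e e0.
  exists t0 => // a /H h /=; have Q0 := carleson_quotient_ge0 omega m p q mu a.
  have fin : carleson_quotient omega p q mu r a \is a fin_num.
    by rewrite ge0_fin_numE//; apply: le_lt_trans h _; rewrite ltry.
  by rewrite sub0r normrN ger0_norm ?fine_ge0// -lee_fin fineK.
move=> e e0; have /fine_cvgP[fin /cvgrPdist_le/(_ e e0) H] := cv.
have [t0 t1 h] := (to_boundaryP _).1 (filterI fin H); exists t0 => // a /h[/= fa].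
rewrite sub0r normrN => ea; rewrite -(fineK fa) lee_fin.
exact: le_trans (ler_norm _) ea.
Qed.

Lemma disc_annulus : @disc R = annulus 0 1.
Proof. by apply/seteqP; split => z; rewrite /annulus /disc /mkset normc_ge0. Qed.

Lemma mass_disc : exists2 W : R, 0 <= W & mass (@disc R) = W%:E.
Proof.
have fin := mass_annulus_fin rw (lexx 0) ler01 (lexx 1).
have W0 : (0 <= mass (@disc R))%E by exact: (mass_ge0 rw).
by exists (fine (mass (@disc R))); rewrite ?fine_ge0// fineK// disc_annulus.
Qed.

(** Along an ultrafilter in a bounded set the functions converge uniformly on
    each closed disc inside the unit disc. Such a disc has finite measure, and the
    rest of the measure embeds with small constant, so they converge in the
    Lebesgue space. The limit is in the Bergman space, with a constant from the
    quasi-triangle inequality. *)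
Lemma vanishing_compact : vanishing_quotient -> identity_compact omega p q mu.
Proof.
move=> van; have into := vanishing_identity_into dw pq mu_fin van.
split => // B [Bb [M' HM]]; apply: compact_closure_ultra => U UU UB.
have UP := @ultra_proper _ _ UU.
pose F := `|M'| `^ p%:num; have F0 : 0 <= F by exact: powR_ge0.
have BF f : B f -> analytic_in_disc f /\ (bergman_int omega p%:num f <= F%:E)%E.
  move=> Bf; have [af _] := Bb f Bf; split => //.
  apply/(bergman_norm_le _ rw _ (normr_ge0 M')); apply: le_trans (HM f Bf) _.
  by rewrite lee_fin ler_norm.
pose phi (t : Lq mu q) : C -> C := t.
have Uphi : U [set t | analytic_in_disc (phi t) /\
    forall rho z, rho < 1 -> N z <= rho -> N (phi t z) <= local_bound omega C1 C2 p F rho].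
  apply: filterS UB => t /BF[at_ tF]; split => // rho z r1 zr.
  exact: (local_bound_le dw at_ F0 tF r1 zr).
have [f0 hf0] := pointwise_limit UU Uphi.
have af0 := limit_analytic UU Uphi hf0.
have unif := limit_uniform UU Uphi hf0.
have [W W0 WE] := mass_disc.
pose F0' := 2 `^ p%:num * (F + W).
have F0'0 : 0 <= F0' by rewrite mulr_ge0 ?powR_ge0// addr_ge0.
have mint h : analytic_in_disc h -> forall D : set C, D `<=` @disc R ->
    measurable_fun D (fun z => (N (h z) `^ p%:num * omega (N z))%:E).
  move=> ah D D1; apply: measurable_funS D1 _; first exact: measurable_disc.
  exact: (measurable_bergman_integrand _ rw).
have pos (h : C -> C) z : @disc R z -> (0 <= (N (h z) `^ p%:num * omega (N z))%:E)%E.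
  by move=> z1; rewrite lee_fin (bergman_integrand_ge0 _ _ rw).
have om0 z : @disc R z -> 0 <= omega (N z) by move=> z1; rewrite (omega_ge0 rw)// normc_ge0.
have f0F : (bergman_int omega p%:num f0 <= F0'%:E)%E.
  apply: integral_disc_le; [exact: (mint f0 af0 _ (@subset_refl _ _))|by move=> z; exact: pos|].
  move=> rho /andP[_ r1]; have D1 := cdisc_disc r1.
  have mD := @measurable_cdisc R rho.
  have [t [/BF[at_ tF] ut]] := filter_ex (filterI UB (unif rho 1 r1 ltr01)).
  have aft := analytic_sub af0 at_.
  apply: le_trans (@integral_powR_triangle _ (area R) p (fun z => omega (N z)) _
    f0 (phi t) (fun z => f0 z - phi t z) mD _ _ _ _ _) _.
  - by move=> z /D1/om0.
  - exact: (mint f0 af0 _ D1).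
  - exact: (mint _ at_ _ D1).
  - exact: (mint _ aft _ D1).
  - by move=> z; apply: le_trans (le_normcD _ _); rewrite addrC subrK.
  rewrite /F0' EFinM; apply: lee_wpmul2l; first by rewrite lee_fin powR_ge0.
  rewrite EFinD; apply: leeD.
    apply: le_trans tF; apply: ge0_subset_integral => //; first exact: measurable_disc.
      exact: (mint _ at_ _ (@subset_refl _ _)).
    by move=> z; exact: (pos (phi t)).
  rewrite -WE; apply: (@le_trans _ _ (\int[area R]_(z in cdisc rho) (omega (N z))%:E)%E).
    apply: ge0_le_integral => //.
    - by move=> z /D1; exact: (pos (fun z => f0 z - phi t z)).
    - exact: (mint _ aft _ D1).
    - apply/measurable_EFinP; apply: measurable_funS (measurable_omega_disc rw) => //.
      exact: measurable_disc.
    move=> z zr; rewrite lee_fin ler_piMl ?om0//; first exact: D1.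
    have h := ut z zr; rewrite normc_distC in h.
    have := ge0_ler_powR (ltW p0) _ _ (ltW h); rewrite powR1; apply.
      by rewrite nnegrE normc_ge0.
    by rewrite nnegrE.
  apply: (mass_subset rw) => //; exact: measurable_disc.
have [|g0 _ g0E] := into f0.
  apply/(bergmanP _ rw); split => //; have b0 := bergman_int_ge0 p%:num f0 rw.
  exists (fine (bergman_int omega p%:num f0)); first by rewrite fine_ge0.
  by rewrite fineK// ge0_fin_numE//; apply: le_lt_trans f0F _; rewrite ltry.
exists g0; apply/cvg_entourageP => A [e e0 eA].
pose F1 := 2 `^ p%:num * (F0' + F).
have F10 : 0 <= F1 by rewrite mulr_ge0 ?powR_ge0// addr_ge0.
have F1s : 0 < F1 `^ s + 1 by rewrite ltr_wpDl// powR_ge0.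
have eps0 : 0 < e / 4 / (F1 `^ s + 1) by rewrite !divr_gt0.
have [rho /andP[_ r1] Ht] := tail_integral dw pq van eps0.
have [K K0 KE] := mu_cdisc mu_fin r1.
have K1 : 0 < K + 1 by rewrite ltr_wpDl.
pose dl := (e / 4 / (K + 1)) `^ q%:num^-1.
have dl0 : 0 < dl by rewrite powR_gt0// !divr_gt0.
apply: (filterS _ (filterI UB (unif rho dl r1 dl0))) => t [/BF[at_ tF] ut].
apply: eA; rewrite /Lq_ball /= g0E.
have aft := analytic_sub af0 at_.
rewrite (lebesgue_int_split q mu aft r1).
have i1 : (\int[mu]_(z in cdisc rho) (N (f0 z - t z)%R `^ q%:num)%:E <= (e / 4)%:E)%E.
  apply: le_trans (cdisc_integral_le (B := dl) q aft r1 (ltW dl0) KE _) _.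
    by move=> z zr; rewrite normc_distC ltW//; exact: ut.
  rewrite lee_fin /dl -powRrM mulVf ?gt_eqF// powRr1; last by rewrite !divr_ge0 ?ltW.
  rewrite mulrAC ler_pdivrMr//; apply: ler_wpM2l; first by rewrite divr_ge0// ltW.
  by rewrite lerDl.
have i2 : (\int[mu]_(z in @disc R `\` cdisc rho) (N (f0 z - t z)%R `^ q%:num)%:E <= (e / 4)%:E)%E.
  apply: le_trans (Ht _ F1 aft F10 _) _.
    apply: le_trans (@integral_powR_triangle _ (area R) p (fun z => omega (N z)) (@disc R)
      (fun z => f0 z - t z) f0 t _ _ _ _ _ _) _ => //.
    - exact: measurable_disc.
    - exact: (mint _ aft _ (@subset_refl _ _)).
    - exact: (mint _ af0 _ (@subset_refl _ _)).
    - exact: (mint _ at_ _ (@subset_refl _ _)).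
    - by move=> z; apply: le_trans (le_normcD _ _) _; rewrite normcN.
    rewrite /F1 EFinM; apply: lee_wpmul2l; first by rewrite lee_fin powR_ge0.
    by rewrite EFinD; apply: leeD.
  rewrite lee_fin mulrAC ler_pdivrMr//; apply: ler_wpM2l; first by rewrite divr_ge0// ltW.
  by rewrite lerDl.
apply: le_lt_trans (leeD i1 i2) _; rewrite -EFinD lte_fin; lra.
Qed.

(** If the quotients did not vanish, the test functions at points [a n] tending to
    the boundary would have norms bounded below in the Lebesgue space; but a
    cluster point of them must be zero almost everywhere, because they tend to
    zero uniformly on closed discs. *)
Lemma compact_vanishing : identity_compact omega p q mu -> vanishing_quotient.
Proof.
move=> [into comp] e e0; apply: contrapT => nvan.
have [a ha] : exists a : nat -> C, forall n, [/\ 1 - n.+1%:R^-1 < N (a n), N (a n) < 1 &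
    (e%:E < carleson_quotient omega p q mu r (a n))%E].
  suff : forall n : nat, exists x, [/\ 1 - n.+1%:R^-1 < N x, N x < 1 &
      (e%:E < carleson_quotient omega p q mu r x)%E] by move=> /boolp.choice[a ha]; exists a.
  move=> n; apply: contrapT => nex; apply: nvan.
  exists (1 - n.+1%:R^-1); first by rewrite gtrBl invr_gt0 ltr0n.
  move=> x /andP[x1 x2]; rewrite leNgt; apply/negP => ex; apply: nex.
  by exists x.
have [c [D [G [h [c0 D0 G0 H]]]]] := test_functions dw p0.
pose B : set (C -> C) := [set f | exists2 x, N x < 1 & f = h x].
have hB x : N x < 1 -> bergman omega p%:num (h x) /\ (bergman_norm omega p%:num (h x) <= 1)%E.
  move=> x1; have [ah h1 _ _] := H x x1; have h1' := (bergman_norm_le1 _ rw _).2 h1.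
  by split => //; split => //; apply: le_lt_trans h1' _; rewrite ltry.
have Bb : bergman_bounded omega p%:num B.
  by split => [_ [x x1 ->]|]; [exact: (hB x x1).1|exists 1 => _ [x x1 ->]; exact: (hB x x1).2].
have [gs hgs] : exists gs : nat -> Lq mu q, forall n, Lq_fun (gs n) = h (a n).
  suff : forall n, exists g : Lq mu q, Lq_fun g = h (a n) by move=> /boolp.choice[gs hgs]; exists gs.
  by move=> n; have [_ a1 _] := ha n; have [g _ gE] := into _ (hB _ a1).1; exists g.
have [|g [_ cg]] := comp B Bb (gs @ \oo) _.
  exists 0%N => // n _; apply: subset_closure; exists (a n); first by have [] := ha n.
  by rewrite hgs.
have close (d : R) n0 : 0 < d -> exists2 n, (n0 <= n)%N &
    (lebesgue_int mu q (fun z => g z - h (a n) z)%R < d%:E)%E.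
  move=> d0; have ent : entourage (Lq_ball (mu := mu) (q := q) d) by exists d.
  have inA : (gs @ \oo) [set x | exists2 n, (n0 <= n)%N & x = gs n].
    by exists n0 => // n /= nn; exists n.
  have [x [[n nn ->] /xsectionP]] := cg _ _ inA (nbhs_entourage g ent).
  by rewrite /Lq_ball /= hgs; exists n.
have mgp := measurable_Lq_pow g.
have mhp n : measurable_fun (@disc R) (fun z => (N (h (a n) z) `^ q%:num)%:E).
  by have [_ a1 _] := ha n; have [ah _ _ _] := H _ a1; exact: measurable_analytic_pow.
have mdp n : measurable_fun (@disc R) (fun z => (N (g z - h (a n) z) `^ q%:num)%:E).
  by rewrite -hgs; exact: measurable_dist_powR.
have pq2 : 0 < 2 `^ q%:num :> R by rewrite powR_gt0.
have zero : (lebesgue_int mu q g <= 0)%E.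
  apply: integral_disc_le => //; first by move=> z _; rewrite lee_fin powR_ge0.
  move=> rho /andP[r0 r1]; apply/lee_addgt0Pr => eta eta0; rewrite add0e.
  have [K K0 KE] := mu_cdisc mu_fin r1.
  pose d := eta / 2 `^ q%:num / 2; have d0 : 0 < d by rewrite !divr_gt0.
  have K1 : 0 < K + 1 by rewrite ltr_wpDl.
  pose b := (d / (K + 1)) `^ q%:num^-1; have b0 : 0 < b by rewrite powR_gt0// divr_gt0.
  have rG : 0 < (1 - rho) `^ G by rewrite powR_gt0// subr_gt0.
  pose y := b `^ p%:num * (1 - rho) `^ G / D.
  have y0 : 0 < y by rewrite divr_gt0// mulr_gt0// powR_gt0.
  have [n nn hn] := close d (Num.truncn y^-1) d0.
  have [a0 a1 _] := ha n; have [ah _ _ hz] := H _ a1.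
  have ay : 1 - N (a n) <= y.
    have : n.+1%:R^-1 <= y.
      rewrite -[leRHS]invrK lef_pV2 ?posrE ?ltr0n ?invr_gt0//.
      by apply: ltW; apply: lt_le_trans (truncnS_gt _) _; rewrite ler_nat.
    by apply: le_trans; rewrite lerBlDr addrC -lerBlDr ltW.
  have hb z : N z <= rho -> N (h (a n) z) <= b.
    move=> zr; have z1 : N z < 1 by exact: le_lt_trans zr r1.
    have hp : N (h (a n) z) `^ p%:num <= b `^ p%:num.
      apply: le_trans (hz z z1) _.
      have zG : (1 - rho) `^ G <= (1 - N z) `^ G.
        by apply: ge0_ler_powR; rewrite ?nnegrE ?(ltW G0) ?subr_ge0 ?(ltW r1) ?(ltW z1)// lerD2l lerN2.
      rewrite ler_pdivrMr; last exact: lt_le_trans zG.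
      apply: le_trans (_ : b `^ p%:num * (1 - rho) `^ G <= _); last first.
        by apply: ler_wpM2l => //; exact: powR_ge0.
      by rewrite mulrC -ler_pdivlMr.
    rewrite leNgt; apply/negP => bh.
    have := gt0_ltr_powR p0 _ _ bh; rewrite !nnegrE normc_ge0 (ltW b0) => /(_ isT isT).
    by rewrite ltNge hp.
  have D1 := cdisc_disc r1.
  apply: le_trans (@Lq_triangle _ q mu (cdisc rho) g (fun z => g z - h (a n) z) (h (a n)) _ D1 _ _ _ _) _ => //.
  - exact: measurable_cdisc.
  - by move=> z; apply: le_trans (le_normcD _ _); rewrite subrK.
  have i1 : (\int[mu]_(z in cdisc rho) (N (g z - h (a n) z)%R `^ q%:num)%:E <= d%:E)%E.
    apply: le_trans (ltW hn); apply: ge0_subset_integral => //.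
    - exact: measurable_cdisc.
    - exact: measurable_disc.
    - by move=> z _; rewrite lee_fin powR_ge0.
  have i2 : (\int[mu]_(z in cdisc rho) (N (h (a n) z) `^ q%:num)%:E <= d%:E)%E.
    apply: le_trans (cdisc_integral_le q ah r1 (ltW b0) KE hb) _.
    rewrite lee_fin /b -powRrM mulVf ?gt_eqF// powRr1; last by rewrite divr_ge0 ?ltW.
    by rewrite mulrAC ler_pdivrMr//; apply: ler_wpM2l; [exact: ltW|rewrite lerDl].
  apply: le_trans (lee_wpmul2l _ (leeD i1 i2)) _; first by rewrite lee_fin ltW.
  rewrite -EFinD -EFinM lee_fin /d -splitr mulrC divfK// gt_eqF//.
have [A' [B' [A0 B0 AB]]] := quotient_tau p q dw.
pose d := e / B' * c `^ s / 2 `^ q%:num.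
have cs0 : 0 < c `^ s by rewrite powR_gt0.
have d0 : 0 < d by rewrite divr_gt0// mulr_gt0// divr_gt0.
have [n _ hn] := close d 0%N d0.
have [_ a1 Qe] := ha n; have [ah _ hD _] := H _ a1; have ta := tau_gt0 dw a1.
have hint : (lebesgue_int mu q (h (a n)) <= (2 `^ q%:num * d)%:E)%E.
  apply: le_trans (@Lq_triangle _ q mu (@disc R) (h (a n)) g (fun z => g z - h (a n) z) _ _ _ _ _ _) _ => //.
  - exact: measurable_disc.
  - by move=> z; have := le_normcD (g z) (- (g z - h (a n) z)); rewrite normcN subKr.
  rewrite EFinM; apply: lee_wpmul2l; first by rewrite lee_fin ltW.
  by rewrite -[leRHS]add0e; apply: leeD => //; exact: ltW.
have ct : 0 < c / tau (a n) by exact: divr_gt0.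
have mD := Delta_measure_le a1 ah ct hD hint.
have : (carleson_quotient omega p q mu r (a n) <= (B' * (e / B'))%:E)%E.
  apply: (AB mu (a n) (e / B') a1 _).2; first by rewrite divr_ge0// ltW.
  apply: le_trans mD _; rewrite lee_fin powRM ?invr_ge0 ?(ltW c0) ?(ltW ta)// powR_invl//.
  have t0 : 0 < tau (a n) `^ s by exact: powR_gt0.
  rewrite le_eqVlt; apply/orP; left; apply/eqP; rewrite /d; field.
  by rewrite !gt_eqF.
have -> : B' * (e / B') = e by rewrite mulrC divfK// gt_eqF.
by rewrite leNgt Qe.
Qed.

End compact_embedding.

Theorem theorem2 (R : realType) (omega : R -> R) (homega : D_class omega) :
  exists r : R, 0 < r < 1 /\
  forall p q : {posnum R}, p%:num <= q%:num ->
  [/\ forall mu : {measure set R[i] -> \bar R},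
        carleson_measure omega p q mu <->
        (carleson_sup omega p q mu r < +oo)%E,
      exists C : R, 0 < C /\
        forall mu : {measure set R[i] -> \bar R},
          carleson_measure omega p q mu ->
          (C^-1%:E * carleson_sup omega p q mu r
             <= identity_norm omega p q mu `^ q%:num)%E /\
          (identity_norm omega p q mu `^ q%:num
             <= C%:E * carleson_sup omega p q mu r)%E &
      forall mu : {measure set R[i] -> \bar R},
        locally_finite_on_disc mu ->
        (identity_compact omega p q mu <->
         carleson_quotient omega p q mu r a @[a --> @to_boundary R]
           --> (0 : \bar R)) ].
Proof.
have [C1 [m [C2 dw]]] := D_class_doubling homega.
exists (Delta_radius R m); split; first exact: Delta_radius01.
move=> p q pq; split.
- by move=> mu; exact: carleson_measureP dw pq mu.
- exact: identity_norm_asymp dw pq.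
- move=> mu mu_fin; rewrite -vanishing_quotientP; split.
    exact: (compact_vanishing dw mu_fin).
  exact: (vanishing_compact dw pq mu_fin).
Qed.
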